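(* Let $\mathcal{L}_0[u]=-\lambda_0\Delta u-\mathrm{tr}(\Sigma(x)\Sigma^*(x)D^2u)$, where $\lambda_0>0$ and $\Sigma:\mathbb{R}^d\to\mathbb{R}^{d\times\ell}$ satisfies $\|\Sigma(x)\|\le\sigma_0$, $\|\Sigma(x)-\Sigma(y)\|\le\sigma_1|x-y|$ for all $x,y\in\mathbb{R}^d$. Assume that $b$ is a continuous vector field such that there exist $\gamma\in(0,2)$ and $\alpha,R>0$ with $b(t,x)\cdot x\ge\alpha|x|^\gamma$ for all $|x|\ge R$, $t>0$, and there exists $c_0>0$ with $(b(t,x)-b(t,y))\cdot(x-y)\ge-c_0|x-y|$ for all $x,y\in\mathbb{R}^d$, $t>0$. Let $u_0$ be continuous on $\mathbb{R}^d$ and let $u$ be a viscosity solution of $$\partial_tu+\mathcal{L}_0[u]+b(t,x)\cdot Du=0\ \text{ in }(0,T)\times\mathbb{R}^d,\qquad u(0,x)=u_0(x)\ \text{ in }\mathbb{R}^d,$$ such that $|u(t,x)|\le C(1+|x|)^m$ for some $m>0$ and $C>0$ (uniformly in time). Then, for any $k>2-\gamma$ with $u_0\in L^\infty(\langle x\rangle^{-k})$, and for any $\bar k>k$, there exists a positive constant $M>0$ (depending on $\alpha,\gamma,c_0,d,\lambda_0,\sigma_0,\sigma_1,k,\bar k$) such that $$[u(t)]_{\langle x\rangle^{\bar k}}\le M(1+t)^{-q}[u_0]_{\langle x\rangle^k}\quad\text{for all }t\in(0,T),\qquad q=\frac{\bar k-k}{2-\gamma}.$$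
   Context: $\langle x\rangle:=\sqrt{1+|x|^2}$. $L^\infty(\langle x\rangle^{-k})$ is the space of measurable $u$ with $u\langle x\rangle^{-k}\in L^\infty(\mathbb{R}^d)$. The weighted oscillation seminorm is $[u]_{\langle x\rangle^k}:=\sup_{x,y\in\mathbb{R}^d}\frac{|u(x)-u(y)|}{\langle x\rangle^k+\langle y\rangle^k}$. Viscosity solution: $u\in C^0([0,T]\times\mathbb{R}^d)$ with $u(0,\cdot)=u_0$ such that, for every $\chi\in C^{1,2}((0,T)\times\mathbb{R}^d)$, at every global maximum (resp. minimum) point $(t_0,x_0)\in(0,T)\times\mathbb{R}^d$ of $u-\chi$ one has $\partial_t\chi+\mathcal{L}_0[\chi]+b\cdot D\chi\le0$ (resp. $\ge0$) at $(t_0,x_0)$.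
   Formalization: The constant M is allowed to depend also on the radius R of the drift condition b(t,x)·x ≥ α|x|^γ for |x| ≥ R, which the stated list of dependencies omits; no constant uniform in R exists. *)

(* Defs.v *)
From HB Require Import structures.
From mathcomp Require Import all_boot all_order all_algebra.
From mathcomp Require Import all_classical all_reals all_analysis.

Set Implicit Arguments.
Unset Strict Implicit.
Unset Printing Implicit Defensive.

Import Order.TTheory GRing.Theory Num.Theory.
Import numFieldNormedType.Exports.

Local Open Scope classical_set_scope.
Local Open Scope ring_scope.

(* Points of R^d are row vectors.  [enorm] is the Euclidean norm on vectors and
   the Frobenius norm on matrices; the library norm `|A| on matrices is the
   maximum of the absolute values of the entries. *)
Definition enorm (R : realType) (m n : nat) (A : 'M[R]_(m, n)) : R :=
  Num.sqrt (\sum_i \sum_j A i j ^+ 2).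

Definition dotv (R : realType) (d : nat) (x y : 'rV[R]_d) : R :=
  \sum_i x 0 i * y 0 i.

Definition japanese (R : realType) (d : nat) (x : 'rV[R]_d) : R :=
  Num.sqrt (1 + enorm x ^+ 2).

(* Extended-real valued: it is +oo when the quotients are unbounded. *)
Definition osc (R : realType) (d : nat) (k : R) (u : 'rV[R]_d -> R) : \bar R :=
  ereal_sup [set z | exists x y : 'rV[R]_d,
    z = (`|u x - u y| / (japanese x `^ k + japanese y `^ k))%:E].

(* The library has no Lebesgue measure on R^d: it is introduced here as the
   Lebesgue outer measure (infimum of the total volumes of countable covers by
   closed boxes), its measurable sets being those of Caratheodory. *)
Definition box (R : realType) (d : nat) (a b : 'rV[R]_d) : set 'rV[R]_d :=
  [set x | forall i, a 0 i <= x 0 i <= b 0 i].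

Definition lebesgue_outer (R : realType) (d : nat) (A : set 'rV[R]_d) : \bar R :=
  ereal_inf [set s | exists a b : nat -> 'rV[R]_d,
    [/\ forall n i, a n 0 i <= b n 0 i,
        A `<=` \bigcup_n box (a n) (b n) &
        s = (\sum_(0 <= n <oo) (\prod_i (b n 0 i - a n 0 i))%:E)%E]].

Definition lebesgue_measurable_fun (R : realType) (d : nat)
    (u : 'rV[R]_d -> R) : Prop :=
  forall B : set R, measurable B ->
    caratheodory_measurable (@lebesgue_outer R d) (u @^-1` B).

Definition Linfty_weight (R : realType) (d : nat) (k : R)
    (u : 'rV[R]_d -> R) : Prop :=
  lebesgue_measurable_fun u /\
  exists K : R, lebesgue_outer [set x | K < `|u x * japanese x `^ (- k)|] = 0%E.

Section Derivatives.
Variables (R : realType) (d : nat).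

Definition pderiv (i : 'I_d) (f : 'rV[R]_d -> R) (x : 'rV[R]_d) : R :=
  'D_(delta_mx 0 i) f x.

Definition grad (f : 'rV[R]_d -> R) (x : 'rV[R]_d) : 'rV[R]_d :=
  \row_i pderiv i f x.

Definition hess (f : 'rV[R]_d -> R) (x : 'rV[R]_d) : 'M[R]_d :=
  \matrix_(i, j) pderiv i (pderiv j f) x.

Definition laplacian (f : 'rV[R]_d -> R) (x : 'rV[R]_d) : R :=
  \sum_i pderiv i (pderiv i f) x.

Definition dtime (chi : R -> 'rV[R]_d -> R) (t : R) (x : 'rV[R]_d) : R :=
  derive1 (fun s => chi s x) t.

Definition cylinder (T : R) : set (R * 'rV[R]_d) := [set p | 0 < p.1 < T].

(* Derivatives are total in the library, so their existence is required
   separately from their continuity. *)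
Definition C12 (T : R) (chi : R -> 'rV[R]_d -> R) : Prop :=
  [/\ forall t x, 0 < t < T ->
        [/\ derivable (fun s => chi s x) t 1,
            forall i, derivable (chi t) x (delta_mx 0 i) &
            forall i j, derivable (pderiv j (chi t)) x (delta_mx 0 i)],
      {within cylinder T, continuous (fun p => chi p.1 p.2)},
      {within cylinder T, continuous (fun p => dtime chi p.1 p.2)},
      forall i, {within cylinder T, continuous (fun p => pderiv i (chi p.1) p.2)} &
      forall i j, {within cylinder T,
        continuous (fun p => pderiv i (pderiv j (chi p.1)) p.2)}].

End Derivatives.

Definition L0 (R : realType) (d l : nat) (lambda0 : R)
    (Sigma : 'rV[R]_d -> 'M[R]_(d, l)) (f : 'rV[R]_d -> R) (x : 'rV[R]_d) : R :=
  - lambda0 * laplacian f x - \tr (Sigma x *m (Sigma x)^T *m hess f x).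

Definition pde_op (R : realType) (d l : nat) (lambda0 : R)
    (Sigma : 'rV[R]_d -> 'M[R]_(d, l)) (b : R -> 'rV[R]_d -> 'rV[R]_d)
    (chi : R -> 'rV[R]_d -> R) (t : R) (x : 'rV[R]_d) : R :=
  dtime chi t x + L0 lambda0 Sigma (chi t) x + dotv (b t x) (grad (chi t) x).

(* Only the values of [u t] for t in [0, T] and of [b t], [chi t] for t in
   (0, T) are involved; extrema of u - chi are over (0, T) x R^d. *)
Definition viscosity_solution (R : realType) (d l : nat) (T lambda0 : R)
    (Sigma : 'rV[R]_d -> 'M[R]_(d, l)) (b : R -> 'rV[R]_d -> 'rV[R]_d)
    (u0 : 'rV[R]_d -> R) (u : R -> 'rV[R]_d -> R) : Prop :=
  [/\ {within [set p : R * 'rV[R]_d | 0 <= p.1 <= T],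
        continuous (fun p => u p.1 p.2)},
      forall x, u 0 x = u0 x,
      forall chi, C12 T chi -> forall t0 x0, 0 < t0 < T ->
        (forall t x, 0 < t < T -> u t x - chi t x <= u t0 x0 - chi t0 x0) ->
        pde_op lambda0 Sigma b chi t0 x0 <= 0 &
      forall chi, C12 T chi -> forall t0 x0, 0 < t0 < T ->
        (forall t x, 0 < t < T -> u t0 x0 - chi t0 x0 <= u t x - chi t x) ->
        0 <= pde_op lambda0 Sigma b chi t0 x0].

(* Main.v *)
Require Import Defs.
From HB Require Import structures.
From mathcomp Require Import all_boot all_order all_algebra.
From mathcomp Require Import all_classical all_reals all_analysis.
From mathcomp Require Import ring lra.

Set Implicit Arguments.
Unset Strict Implicit.
Unset Printing Implicit Defensive.

Import Order.TTheory GRing.Theory Num.Theory.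
Import numFieldNormedType.Exports.

Local Open Scope classical_set_scope.
Local Open Scope ring_scope.

(** Doubling of variables. With W = 1 + (max 0 (|x|^2 - R0^2))^2, the drift makes the
    powers W^a Lyapunov functions for a > (2 - gamma) / 4: the operator applied to W^a
    is at least c W^(a - (2 - gamma) / 4) - C. Hence
    F(t, x) = min (W^(k/4), (1 + dl t)^(-q) W^(kbar/4)) is a supersolution up to a
    multiple of (1 + dl t)^(-q), and this error is compensated, for
    u(t, x) - u(t, y), by B (1 + dl t)^(-q) (2 - exp (- th |x - y|)) thanks to the
    reflection coupling of the nondegenerate noise lambda0 and to the one-sided
    estimate on b. So u(t, x) - u(t, y) stays below a multiple of
    F(t, x) + F(t, y) + 2 B (1 + dl t)^(-q), which is O((1 + t)^(-q)) with weight kbar.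

    The comparison at a maximum of u(t, x) - u(t, y) - barrier does not go through
    Alexandrov's theorem and Jensen's lemma. In a frame moving with the drift, u is
    dominated near the maximum by the average of a smooth sup-convolution of its past
    values along a random walk with the covariance of the equation; two such walks
    driven by the same signs give the inequality for the doubled function. *)

(** * Euclidean algebra and compact cylinders *)

Section Euclid.
Context {R : realType}.

(** Origin of q: the drift needs a time of order W^((2 - gamma) / 4) to bring W down to order 1, and
    the two branches of F cross exactly where W^((2 - gamma) / 4) = 1 + dl t. The fourth-power
    growth of W comes from squaring the cut-off, which gives it a quadratic upper expansion across
    |x| = R0; hence the exponents k/4. Why reflection: the drift may cost c0 phi'(|x - y|), which
    does not vanish with |x - y|. A synchronous coupling creates no compensating term, whereas
    reflection creates 4 lambda0 phi''; for phi = 2 - exp(- th r) one has phi'' = - th phi', so a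
    large th pays for everything. The obstacle at the maximum is that u is merely continuous. The
    smoothed sup-convolution has its Hessian bounded below by -K only, and freezing the coefficients
    costs om (1 + K). This closes because K depends only on the quadratic jet and on the tolerance:
    om is chosen after K, then the time span h, then the step of the walk. Only the marginals of the
    two walks are tested against the equation, so their joint law is free; this freedom is what
    admits the reflection coupling. All averages are finite sums, so no integral over R^d
    appears. *)

Definition n2 n (z : 'rV[R]_n) : R := dotv z z.
(** No symmetry is required of [X]: second-order data enter the argument through this form, which
    sees only the symmetric part. *)
Definition qf n (X : 'M[R]_n) (z : 'rV[R]_n) : R := dotv (z *m X) z.

Section Dotv.
Variable n : nat.
Implicit Types (x y z w : 'rV[R]_n) (X Y : 'M[R]_n).

Lemma dotvC x y : dotv x y = dotv y x.
Proof. by apply: eq_bigr => i _; rewrite mulrC. Qed.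

Lemma dotvE x y : dotv x y = (x *m y^T) 0 0.
Proof. by rewrite mxE; apply: eq_bigr => i _; rewrite mxE. Qed.

Lemma dotvDl x y z : dotv (x + y) z = dotv x z + dotv y z.
Proof. by rewrite !dotvE mulmxDl mxE. Qed.

Lemma dotvZl a x y : dotv (a *: x) y = a * dotv x y.
Proof. by rewrite !dotvE -scalemxAl mxE. Qed.

Lemma dotvDr x y z : dotv x (y + z) = dotv x y + dotv x z.
Proof. by rewrite !(dotvC x) dotvDl. Qed.

Lemma dotvZr a x y : dotv x (a *: y) = a * dotv x y.
Proof. by rewrite !(dotvC x) dotvZl. Qed.

Lemma dotvNl x y : dotv (- x) y = - dotv x y.
Proof. by rewrite -scaleN1r dotvZl mulN1r. Qed.

Lemma dotvNr x y : dotv x (- y) = - dotv x y.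
Proof. by rewrite !(dotvC x) dotvNl. Qed.

Lemma dotvBl x y z : dotv (x - y) z = dotv x z - dotv y z.
Proof. by rewrite dotvDl dotvNl. Qed.

Lemma dotvBr x y z : dotv x (y - z) = dotv x y - dotv x z.
Proof. by rewrite dotvDr dotvNr. Qed.

Lemma dotv0l x : dotv 0 x = 0.
Proof. by rewrite -(scale0r 0) dotvZl mul0r. Qed.

Lemma dotv0r x : dotv x 0 = 0.
Proof. by rewrite dotvC dotv0l. Qed.

Lemma dotv_suml (I : finType) (P : pred I) (F : I -> 'rV[R]_n) y :
  dotv (\sum_(i | P i) F i) y = \sum_(i | P i) dotv (F i) y.
Proof.
by apply: (big_ind2 (fun a b => dotv a y = b)) => [|a b c d <- <-|//];
  rewrite ?dotv0l ?dotvDl.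
Qed.

Lemma dotv_delta x i : dotv x (delta_mx 0 i) = x 0 i.
Proof.
rewrite /dotv (bigD1 i) //= big1 ?addr0; last first.
  by move=> j ji; rewrite mxE eqxx (negPf ji) mulr0.
by rewrite mxE !eqxx mulr1.
Qed.

Lemma n2_ge0 x : 0 <= n2 x.
Proof. by apply: sumr_ge0 => i _; rewrite -expr2 sqr_ge0. Qed.

Lemma n20 : n2 (0 : 'rV[R]_n) = 0.
Proof. exact: dotv0l. Qed.

Lemma n2_eq0 x : n2 x = 0 -> x = 0.
Proof.
move=> /eqP; rewrite psumr_eq0 => [|i _]; last by rewrite -expr2 sqr_ge0.
move=> /allP h; apply/rowP => i; rewrite mxE.
by have := h i (mem_index_enum _); rewrite /= -expr2 sqrf_eq0 => /eqP.
Qed.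

Lemma n2D x y : n2 (x + y) = n2 x + 2 * dotv x y + n2 y.
Proof. rewrite /n2 dotvDl !dotvDr (dotvC y x); ring. Qed.

Lemma n2N x : n2 (- x) = n2 x.
Proof. by rewrite /n2 dotvNl dotvNr opprK. Qed.

Lemma n2B x y : n2 (x - y) = n2 x - 2 * dotv x y + n2 y.
Proof. rewrite n2D n2N dotvNr; ring. Qed.

Lemma n2Z a x : n2 (a *: x) = a ^+ 2 * n2 x.
Proof. by rewrite /n2 dotvZl dotvZr mulrA expr2. Qed.

Lemma enormE x : enorm x = Num.sqrt (n2 x).
Proof.
by rewrite /enorm big_ord1; congr Num.sqrt; apply: eq_bigr => i _; rewrite expr2.
Qed.

Lemma enorm_sqr x : enorm x ^+ 2 = n2 x.
Proof. by rewrite enormE sqr_sqrtr // n2_ge0. Qed.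

Lemma enorm_ge0 m (A : 'M[R]_(m, n)) : 0 <= enorm A.
Proof. exact: sqrtr_ge0. Qed.

Lemma enorm0 : enorm (0 : 'rV[R]_n) = 0.
Proof. by rewrite enormE n20 sqrtr0. Qed.

Lemma enorm0_eq0 x : enorm x = 0 -> x = 0.
Proof. by move=> h; apply: n2_eq0; rewrite -enorm_sqr h expr0n. Qed.

Lemma enormZ a x : enorm (a *: x) = `|a| * enorm x.
Proof. by rewrite !enormE n2Z sqrtrM ?sqr_ge0 // sqrtr_sqr. Qed.

Lemma enormN x : enorm (- x) = enorm x.
Proof. by rewrite !enormE n2N. Qed.

Lemma enormBC x y : enorm (x - y) = enorm (y - x).
Proof. by rewrite -enormN opprB. Qed.

Lemma dotv_sqr_le x y : dotv x y ^+ 2 <= n2 x * n2 y.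
Proof.
have [y0|yn0] := eqVneq (n2 y) 0.
  by rewrite (n2_eq0 y0) dotv0r n20 mulr0 expr0n.
have yp : 0 < n2 y by rewrite lt0r yn0 n2_ge0.
have := n2_ge0 (n2 y *: x - dotv x y *: y).
rewrite n2B !n2Z dotvZl dotvZr.
have -> : n2 y ^+ 2 * n2 x - 2 * (n2 y * (dotv x y * dotv x y)) +
    dotv x y ^+ 2 * n2 y = n2 y * (n2 x * n2 y - dotv x y ^+ 2) by ring.
by rewrite pmulr_rge0 // subr_ge0.
Qed.

Lemma dotv_le x y : `|dotv x y| <= enorm x * enorm y.
Proof.
rewrite -(@ler_pXn2r _ 2) ?nnegrE ?mulr_ge0 ?enorm_ge0 //.
by rewrite real_normK ?num_real // exprMn !enorm_sqr dotv_sqr_le.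
Qed.

Lemma enormD x y : enorm (x + y) <= enorm x + enorm y.
Proof.
rewrite -(@ler_pXn2r _ 2) ?nnegrE ?addr_ge0 ?enorm_ge0 //.
rewrite enorm_sqr n2D sqrrD !enorm_sqr.
have := le_trans (ler_norm _) (dotv_le x y); lra.
Qed.

Lemma enormB x y : enorm (x - y) <= enorm x + enorm y.
Proof. by rewrite -(enormN y); exact: enormD. Qed.

Lemma coord_le_enorm x i : `|x 0 i| <= enorm x.
Proof.
rewrite -(@ler_pXn2r _ 2) ?nnegrE ?enorm_ge0 // enorm_sqr real_normK ?num_real //.
rewrite /n2 /dotv (bigD1 i) //= -expr2 lerDl sumr_ge0 // => j _.
by rewrite -expr2 sqr_ge0.
Qed.

Lemma n2D_le x y : n2 (x + y) <= 2 * n2 x + 2 * n2 y.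
Proof. have := n2_ge0 (x - y); rewrite n2B n2D; lra. Qed.

Lemma qfDX X Y z : qf (X + Y) z = qf X z + qf Y z.
Proof. by rewrite /qf mulmxDr dotvDl. Qed.

Lemma qfZX a X z : qf (a *: X) z = a * qf X z.
Proof. by rewrite /qf -scalemxAr dotvZl. Qed.

Lemma qf0X z : qf 0 z = 0.
Proof. by rewrite /qf mulmx0 dotv0l. Qed.

Lemma qfNX X z : qf (- X) z = - qf X z.
Proof. by rewrite -scaleN1r qfZX mulN1r. Qed.

Lemma qf_sumX (I : finType) (P : pred I) (F : I -> 'M[R]_n) z :
  qf (\sum_(i | P i) F i) z = \sum_(i | P i) qf (F i) z.
Proof. by rewrite /qf mulmx_sumr dotv_suml. Qed.

Lemma qfZ X a z : qf X (a *: z) = a ^+ 2 * qf X z.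
Proof. by rewrite /qf -scalemxAl dotvZl dotvZr mulrA expr2. Qed.

Lemma qfN X z : qf X (- z) = qf X z.
Proof. by rewrite -scaleN1r qfZ sqrrN expr1n mul1r. Qed.

Lemma qf0 X : qf X 0 = 0.
Proof. by rewrite -(scale0r 0) qfZ expr0n mul0r. Qed.

Lemma qfD X z w :
  qf X (z + w) = qf X z + dotv (z *m X) w + dotv (w *m X) z + qf X w.
Proof. rewrite /qf mulmxDl dotvDl !dotvDr; ring. Qed.

Lemma qf_scalar a z : qf a%:M z = a * n2 z.
Proof. by rewrite /qf mul_mx_scalar dotvZl. Qed.

Lemma qf_outer (v z : 'rV[R]_n) : qf (v^T *m v) z = dotv v z ^+ 2.
Proof.
rewrite /qf mulmxA (mx11_scalar (z *m v^T)) mul_scalar_mx dotvZl -dotvE.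
by rewrite (dotvC z) expr2.
Qed.

End Dotv.

(** Cauchy-Schwarz on each column: the Frobenius norm dominates the operator norm. *)
Lemma n2_mul_le m n (z : 'rV[R]_m) (M : 'M[R]_(m, n)) :
  n2 (z *m M) <= enorm M ^+ 2 * n2 z.
Proof.
rewrite /enorm sqr_sqrtr; last first.
  by apply: sumr_ge0 => i _; apply: sumr_ge0 => j _; rewrite sqr_ge0.
rewrite exchange_big mulr_suml; apply: ler_sum => j _.
have -> : (z *m M) 0 j = dotv z (col j M)^T.
  by rewrite mxE; apply: eq_bigr => i _; rewrite !mxE.
rewrite -expr2 mulrC (le_trans (dotv_sqr_le _ _)) // ler_wpM2l ?n2_ge0 //.
by apply: ler_sum => i _; rewrite !mxE expr2.
Qed.

Lemma enorm_mul_le m n (z : 'rV[R]_m) (M : 'M[R]_(m, n)) :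
  enorm (z *m M) <= enorm M * enorm z.
Proof.
rewrite -(@ler_pXn2r _ 2) ?nnegrE ?mulr_ge0 ?enorm_ge0 //.
by rewrite exprMn !enorm_sqr n2_mul_le.
Qed.

Lemma dotv_mul_le m n (z : 'rV[R]_m) (M : 'M[R]_(m, n)) (w : 'rV[R]_n) :
  `|dotv (z *m M) w| <= enorm M * enorm z * enorm w.
Proof.
by apply: (le_trans (dotv_le _ _)); rewrite ler_wpM2r ?enorm_ge0 ?enorm_mul_le.
Qed.

Lemma qf_le n (X : 'M[R]_n) z : `|qf X z| <= enorm X * n2 z.
Proof.
by rewrite -enorm_sqr expr2 mulrA; exact: dotv_mul_le.
Qed.

Lemma dotv_mulr m n (z : 'rV[R]_m) (M : 'M[R]_(m, n)) (w : 'rV[R]_n) :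
  dotv (z *m M) w = dotv z (w *m M^T).
Proof. by rewrite !dotvE trmx_mul trmxK mulmxA. Qed.

Lemma qf_mul m n (X : 'M[R]_n) (M : 'M[R]_(m, n)) z :
  qf (M *m X *m M^T) z = qf X (z *m M).
Proof. by rewrite /qf !mulmxA dotv_mulr trmxK. Qed.

Lemma dotv_row m n (a b : 'rV[R]_m) (c e : 'rV[R]_n) :
  dotv (row_mx a c) (row_mx b e) = dotv a b + dotv c e.
Proof. by rewrite !dotvE tr_row_mx mul_row_col mxE. Qed.

Lemma n2_row m n (a : 'rV[R]_m) (c : 'rV[R]_n) : n2 (row_mx a c) = n2 a + n2 c.
Proof. exact: dotv_row. Qed.

Lemma n2_pair m n (z : 'rV[R]_(m + n)) : n2 z = n2 (lsubmx z) + n2 (rsubmx z).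
Proof. by rewrite -n2_row hsubmxK. Qed.

End Euclid.

(** * Euclidean neighbourhoods, and continuity on compact cylinders *)

Section Topology.
Context {R : realType}.

(** The topology of row vectors comes from the sup norm; this comparison turns its neighbourhoods
    into Euclidean balls. The crude factor [n.+1] stays positive for n = 0, which allows dividing by
    it. *)
Lemma enorm_le_sup n (x : 'rV[R]_n) (e : R) : 0 <= e ->
  (forall i, `|x 0 i| <= e) -> enorm x <= n.+1%:R * e.
Proof.
move=> e0 xe; rewrite -(@ler_pXn2r _ 2) ?nnegrE ?mulr_ge0 ?enorm_ge0 //.
rewrite enorm_sqr (@le_trans _ _ (\sum_(i < n) e ^+ 2)) //.
  by apply: ler_sum => i _; rewrite -expr2 -[x 0 i ^+ 2]real_normK ?num_real //
    ler_pXn2r ?nnegrE.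
rewrite sumr_const card_ord -[leLHS]mulr_natl exprMn ler_wpM2r ?sqr_ge0 //.
by rewrite -natrX ler_nat (leq_trans (leqnSn n)) // -{1}[n.+1]expn1 leq_pexp2l.
Qed.

Lemma nbhs_rVP n (p : 'rV[R]_n) (P : set 'rV[R]_n) :
  nbhs p P <-> exists2 d : R, 0 < d & forall q, enorm (q - p) <= d -> P q.
Proof.
split=> [/nbhs_ballP[e /= e0 eP]|[d d0 dP]].
  exists (e / 2) => [|q qp]; first by rewrite divr_gt0.
  apply: eP; split=> // i j; rewrite (ord1 i) /ball /= distrC.
  have := coord_le_enorm (q - p) j; rewrite !mxE => h.
  by apply: (le_lt_trans h); apply: (le_lt_trans qp); lra.
have n0 : 0 < n.+1%:R :> R by rewrite ltr0n.
apply/nbhs_ballP; exists (d / n.+1%:R) => /=; first by rewrite divr_gt0.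
move=> q [_ pq]; apply: dP.
apply: (le_trans (@enorm_le_sup _ _ (d / n.+1%:R) _ _)).
- by rewrite divr_ge0 // ltW.
- by move=> i; rewrite !mxE distrC; apply/ltW/pq.
- by rewrite mulrC divfK // gt_eqF.
Qed.

Lemma nbhs_prodP n (p : R * 'rV[R]_n) (P : set (R * 'rV[R]_n)) :
  nbhs p P <-> exists2 d : R, 0 < d &
    forall (t : R) z, `|t - p.1| <= d -> enorm (z - p.2) <= d -> P (t, z).
Proof.
split=> [[[A B] /= [/nbhs_ballP[e /= e0 eA] /nbhs_rVP[d d0 dB]] AB]|].
  exists (Num.min (e / 2) d) => [|t z]; first by rewrite lt_min divr_gt0.
  rewrite !le_min => /andP[te _] /andP[_ zd]; apply: AB; split => /=.
    by apply: eA; rewrite /ball /= distrC (le_lt_trans te) //; lra.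
  exact: dB.
move=> [d d0 dP]; exists ([set t | `|t - p.1| <= d], [set z | enorm (z - p.2) <= d]).
  split => /=; last by apply/nbhs_rVP; exists d.
  apply/nbhs_ballP; exists d => //= t; rewrite /ball /= distrC.
  exact: ltW.
by move=> [t z] /= [? ?]; exact: dP.
Qed.

Definition cont_on n (A : set (R * 'rV[R]_n)) (g : R -> 'rV[R]_n -> R) :=
  {within A, continuous (fun p => g p.1 p.2)}.

Lemma cont_onP n (A : set (R * 'rV[R]_n)) g :
  cont_on A g <-> forall (t : R) z, A (t, z) -> forall e : R, 0 < e -> exists2 d : R, 0 < d &
    forall (t' : R) z', A (t', z') -> `|t' - t| <= d -> enorm (z' - z) <= d ->
      `|g t' z' - g t z| <= e.
Proof.
rewrite /cont_on subspace_continuousP; split=> [h t z Atz e e0|h [t z] Atz].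
  have /cvgrPdist_le /(_ e e0) := h _ Atz.
  rewrite near_withinE => /nbhs_prodP[d d0 dP]; exists d => // t' z' A' h1 h2.
  by rewrite distrC; exact: dP.
apply/cvgrPdist_le => e e0; rewrite near_withinE; apply/nbhs_prodP.
have [d d0 dP] := h t z Atz e e0; exists d => // t' z' h1 h2 A'.
by rewrite distrC; exact: dP.
Qed.

Lemma cont_onW n (A B : set (R * 'rV[R]_n)) g :
  B `<=` A -> cont_on A g -> cont_on B g.
Proof. exact: continuous_subspaceW. Qed.

Lemma cont_on_cts n (A : set (R * 'rV[R]_n)) g :
  continuous (fun p : R * 'rV[R]_n => g p.1 p.2) -> cont_on A g.
Proof. exact: continuous_subspaceT. Qed.

Lemma cont_onD n (A : set (R * 'rV[R]_n)) g h :
  cont_on A g -> cont_on A h -> cont_on A (fun t z => g t z + h t z).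
Proof. by move=> cg ch x; apply: cvgD; [exact: cg|exact: ch]. Qed.

Lemma cont_onB n (A : set (R * 'rV[R]_n)) g h :
  cont_on A g -> cont_on A h -> cont_on A (fun t z => g t z - h t z).
Proof. by move=> cg ch x; apply: cvgB; [exact: cg|exact: ch]. Qed.

Lemma cont_onM n (A : set (R * 'rV[R]_n)) g h :
  cont_on A g -> cont_on A h -> cont_on A (fun t z => g t z * h t z).
Proof. by move=> cg ch x; apply: cvgM; [exact: cg|exact: ch]. Qed.

Lemma cont_on_cst n (A : set (R * 'rV[R]_n)) (c : R) : cont_on A (fun _ _ => c).
Proof. by move=> x; exact: cvg_cst. Qed.

Definition cyl n (a b : R) (c : 'rV[R]_n) (r : R) : set (R * 'rV[R]_n) :=
  [set p | a <= p.1 <= b /\ enorm (p.2 - c) <= r].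

Lemma closed_eball n (c : 'rV[R]_n) (r : R) : closed [set z | enorm (z - c) <= r].
Proof.
move=> z clz; rewrite /= leNgt; apply/negP => rz.
have e0 : 0 < (enorm (z - c) - r) / 2 by rewrite divr_gt0 // subr_gt0.
have [w [/= wr wz]] : [set z | enorm (z - c) <= r] `&`
    [set w | enorm (w - z) <= (enorm (z - c) - r) / 2] !=set0.
  by apply: clz; apply/nbhs_rVP; exists ((enorm (z - c) - r) / 2).
have := enormD (w - c) (z - w); rewrite addrC addrA subrK (enormBC z w); lra.
Qed.

Lemma compact_eball n (c : 'rV[R]_n) (r : R) : compact [set z | enorm (z - c) <= r].
Proof.
apply: bounded_closed_compact; last exact: closed_eball.
exists (r + enorm c); split; first exact: num_real.
move=> M rM z /= zr; rewrite [leLHS]/Num.norm /= mx_normrE.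
have M0 : 0 <= M by have := enorm_ge0 (z - c); have := enorm_ge0 c; lra.
apply/bigmax_leP; split=> //= -[i j] _ /=; rewrite (ord1 i).
apply: (le_trans (coord_le_enorm _ _)).
by have := enormD (z - c) c; rewrite subrK; lra.
Qed.

Lemma compact_cyl n (a b : R) (c : 'rV[R]_n) (r : R) : compact (cyl a b c r).
Proof.
have -> : cyl a b c r = `[a, b]%classic `*` [set z | enorm (z - c) <= r].
  by apply/seteqP; split=> -[t z] /=; rewrite /cyl /= in_itv.
by apply: compact_setX; [exact: segment_compact|exact: compact_eball].
Qed.

Lemma cyl_max n (a b : R) (c : 'rV[R]_n) (r : R) g : a <= b -> 0 <= r ->
  cont_on (cyl a b c r) g ->
  exists (t : R) z, cyl a b c r (t, z) /\
    forall (t' : R) z', cyl a b c r (t', z') -> g t' z' <= g t z.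
Proof.
move=> ab r0 cg.
have A0 : cyl a b c r !=set0.
  by exists (a, c); split=> /=; rewrite ?lexx ?ab // subrr enorm0.
have [[t z] tzA h] := compact_EVT_max A0 (@compact_cyl _ a b c r) cg.
by exists t, z; split=> [|t' z' h']; [exact: set_mem|apply: (h (t', z')); exact: mem_set].
Qed.

Lemma cyl_bounded n (a b : R) (c : 'rV[R]_n) (r : R) g : cont_on (cyl a b c r) g ->
  exists2 C : R, 0 <= C & forall (t : R) z, cyl a b c r (t, z) -> `|g t z| <= C.
Proof.
move=> cg.
have [M0 [_ h]] := compact_bounded (continuous_compact cg (@compact_cyl _ a b c r)).
exists (`|M0| + 1); first by rewrite addr_ge0.
move=> t z tz; apply: h; last by exists (t, z).
by have := ler_norm M0; lra.
Qed.

(** Heine-Cantor through the near-covering form of compactness: the modulus [d] is a parameter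
    tending to 0 from the right, and pointwise continuity shows that the uniform statement holds
    near each point for small [d]. *)
Lemma cyl_unif n (a b : R) (c : 'rV[R]_n) (r : R) g : cont_on (cyl a b c r) g ->
  forall e : R, 0 < e -> exists2 d : R, 0 < d & forall (t : R) z (t' : R) z',
    cyl a b c r (t, z) -> cyl a b c r (t', z') ->
    `|t' - t| <= d -> enorm (z' - z) <= d -> `|g t' z' - g t z| <= e.
Proof.
move=> /cont_onP cg e e0.
have /compact_near_coveringP/near_covering_withinP H := @compact_cyl n a b c r.
pose P (d : R) (p : R * 'rV[R]_n) := forall (t' : R) z', cyl a b c r (t', z') ->
  `|t' - p.1| <= d -> enorm (z' - p.2) <= d -> `|g t' z' - g p.1 p.2| <= e.
have := H R (0^'+) P _; case.
  move=> [t z] tzA.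
  have [d d0 dP] := cg _ _ tzA (e / 2) ltac:(lra).
  exists ([set p | `|p.1 - t| <= d / 2 /\ enorm (p.2 - z) <= d / 2],
          [set s | s <= d / 2]).
    split => /=; first by apply/nbhs_prodP; exists (d / 2) => //; lra.
    by apply: nbhs_right_le; lra.
  move=> [[t1 z1] s] /= [[h1 h2] h3] Atz t' z' A' h4 h5.
  have H2 := dP _ _ A'.
  have K1 : `|g t1 z1 - g t z| <= e / 2 by apply: dP => //; lra.
  have K2 : `|g t' z' - g t z| <= e / 2.
    apply: H2.
      by have := ler_normD (t' - t1) (t1 - t); rewrite addrA subrK; lra.
    by have := enormD (z' - z1) (z1 - z); rewrite addrA subrK; lra.
  have := ler_normB (g t' z' - g t z) (g t1 z1 - g t z).
  by rewrite opprB addrA subrK /=; lra.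
move=> d /= d0 dP; exists (d / 2); first by rewrite divr_gt0.
have d2 : 0 < d / 2 by rewrite divr_gt0.
have hd : ball_ Num.norm (0 : R) d (d / 2).
  by rewrite /ball_ /= sub0r normrN ger0_norm; lra.
move=> t z t' z' A A'; exact: (dP _ hd d2 (t, z) A).
Qed.

(** Total boundedness; it lets a finite maximum replace the supremum in the sup-convolution. *)
Lemma eball_net n (c : 'rV[R]_n) (r d : R) : 0 < d ->
  exists s : seq 'rV[R]_n, (forall y, y \in s -> enorm (y - c) <= r) /\
    forall z, enorm (z - c) <= r -> exists2 y, y \in s & enorm (z - y) <= d.
Proof.
move=> d0.
have := @compact_eball n c r; rewrite compact_cover => /(_ _
  [set y | enorm (y - c) <= r] (fun y => interior [set z | enorm (z - y) <= d])).
case=> [y _|z zr|D' D'D cov]; first exact: open_interior.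
  by exists z => //=; apply/nbhs_rVP; exists d => // q.
exists (finmap.enum_fset D'); split=> [y yD|z zr].
  by have := D'D y yD; rewrite inE.
have [y yD /interior_subset/= zy] := cov z zr.
by exists y.
Qed.

End Topology.

(** * Test functions and parabolic superjets *)

Section TestFunctions.
Context {R : realType}.

(** Apart from powers of [n2], the test functions are quadratic along each line, so their
    derivatives are read off an exact expansion. *)
Lemma is_derive_quad (V : normedModType R) (f : V -> R) (x v : V) (a b : R) :
  (forall h, f (h *: v + x) = f x + h * a + h ^+ 2 * b) -> is_derive x v f a.
Proof.
move=> fE.
have cv : (fun h : R => h^-1 *: ((f \o shift x) (h *: v) - f x)) @ 0^' --> a.
  have ca : (fun h : R => a + h * b) @ 0^' --> a.
    rewrite -[X in _ --> X]addr0 -[X in _ --> a + X](mul0r b).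
    apply: cvgD; first exact: cvg_cst.
    by apply: cvgMl; apply: cvg_within; exact: cvg_id.
  apply: cvg_trans ca; apply: near_eq_cvg; near=> h.
  have h0 : h != 0 by near: h; exact: nbhs_dnbhs_neq.
  rewrite /= fE -[X in X - f x]addrA [f x + _]addrC addrK /GRing.scale /=.
  by rewrite mulrDr mulKf // expr2 -mulrA mulKf.
apply: DeriveDef; first by apply/cvg_ex; exists a.
exact: cvg_lim cv.
Unshelve. all: end_near. Qed.

Section Continuous.
Variable T : topologicalType.
Implicit Types f g : T -> R.

Lemma contD f g : continuous f -> continuous g -> continuous (fun x => f x + g x).
Proof. by move=> cf cg x; apply: cvgD; [exact: cf|exact: cg]. Qed.

Lemma contM f g : continuous f -> continuous g -> continuous (fun x => f x * g x).
Proof. by move=> cf cg x; apply: cvgM; [exact: cf|exact: cg]. Qed.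

Lemma cont_cst (c : R) : continuous (fun _ : T => c).
Proof. by move=> x; exact: cvg_cst. Qed.

Lemma contX f k : continuous f -> continuous (fun x => f x ^+ k).
Proof.
move=> cf x; apply: (@continuous_comp _ _ _ f (fun y : R => y ^+ k)).
  exact: cf.
exact: exprn_continuous.
Qed.

Lemma cont_sum (I : finType) (F : I -> T -> R) :
  (forall i, continuous (F i)) -> continuous (fun x => \sum_i F i x).
Proof.
move=> cF; elim: (index_enum I) => [|i s IH].
  by under eq_fun do rewrite big_nil; exact: cont_cst.
by under eq_fun do rewrite big_cons; apply: contD.
Qed.

End Continuous.

Lemma continuous_coordB n (x0 : 'rV[R]_n) i :
  continuous (fun x : 'rV[R]_n => (x - x0) 0 i).
Proof.
move=> x; apply: (@continuous_comp _ _ _ (fun y : 'rV[R]_n => y - x0) (fun z => z 0 i)).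
  apply: (@cvgB _ _ _ (nbhs x) _ (fun y : 'rV[R]_n => y) (fun _ => x0) x x0); last exact: cvg_cst.
  by move=> A.
exact: coord_continuous.
Qed.

Lemma continuous_n2 n (x0 : 'rV[R]_n) : continuous (fun x : 'rV[R]_n => n2 (x - x0)).
Proof. by apply: cont_sum => i; apply: contM; exact: continuous_coordB. Qed.

Lemma continuous_dotv n (x0 v : 'rV[R]_n) :
  continuous (fun x : 'rV[R]_n => dotv (x - x0) v).
Proof.
by apply: cont_sum => i; apply: contM; [exact: continuous_coordB|exact: cont_cst].
Qed.

Section Pol.
Variables (n : nat) (x0 p : 'rV[R]_n) (X : 'M[R]_n) (B : R) (N : nat).
Notation e_ := (fun i : 'I_n => delta_mx 0 i : 'rV[R]_n).

(** The last summand has zero second-order jet at [x0] and, for large [B] and [N], beats the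
    polynomial growth of a subsolution. It turns local maxima into the global ones demanded by the
    definition of viscosity solutions. *)
Definition pol (x : 'rV[R]_n) : R :=
  dotv p (x - x0) + qf X (x - x0) / 2 + B * n2 (x - x0) ^+ N.+2.

Definition gpol (i : 'I_n) (x : 'rV[R]_n) : R :=
  p 0 i + (dotv (x - x0) (e_ i *m X) + dotv (x - x0) (e_ i *m X^T)) / 2
  + B * (N.+2%:R * n2 (x - x0) ^+ N.+1 * (2 * (x - x0) 0 i)).

Definition hpol (i j : 'I_n) (x : 'rV[R]_n) : R :=
  (X j i + X i j) / 2
  + B * (N.+2%:R * (N.+1%:R * n2 (x - x0) ^+ N * (2 * (x - x0) 0 i)) *
           (2 * (x - x0) 0 j)
         + N.+2%:R * n2 (x - x0) ^+ N.+1 * (2 * (i == j)%:R)).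

Lemma is_derive_n2X k x i : is_derive x (e_ i)
  (fun x => n2 (x - x0) ^+ k) (k%:R * n2 (x - x0) ^+ k.-1 * (2 * (x - x0) 0 i)).
Proof.
have d1 : is_derive x (e_ i) (fun x => n2 (x - x0)) (2 * (x - x0) 0 i).
  apply: (@is_derive_quad _ _ _ _ _ 1) => h.
  rewrite -addrA n2D n2Z dotvZl dotvC !dotv_delta.
  have -> : n2 (e_ i) = 1 by rewrite /n2 dotv_delta mxE !eqxx.
  ring.
have -> : (fun x => n2 (x - x0) ^+ k) = (fun x => n2 (x - x0)) ^+ k.
  by rewrite exprfctE.
exact: (is_deriveX k d1).
Qed.

Lemma is_derive_coord (x : 'rV[R]_n) i j :
  is_derive x (e_ i) (fun x => (x - x0) 0 j) (i == j)%:R.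
Proof.
apply: (@is_derive_quad _ _ _ _ _ 0) => h.
by rewrite !mxE eqxx /= [j == i]eq_sym; ring.
Qed.

Lemma is_derive_pol x i : is_derive x (e_ i) pol (gpol i x).
Proof.
apply: is_deriveD; last first.
  exact: (@is_deriveZ _ _ _ _ B _ _ _ (is_derive_n2X N.+2 x i)).
apply: (@is_derive_quad _ _ _ _ _ (qf X (e_ i) / 2)) => h.
rewrite -addrA; move: (x - x0) => w.
rewrite dotvDr dotvZr dotv_delta qfD qfZ -!scalemxAl dotvZl dotvZr.
rewrite [dotv (_ *m X) w]dotvC (dotv_mulr w) [dotv w _]dotvC; ring.
Qed.

Lemma is_derive_gpol x i j : is_derive x (e_ i) (gpol j) (hpol i j x).
Proof.
apply: is_deriveD.
  apply: (@is_derive_quad _ _ _ _ _ 0) => h.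
  have eM (M : 'M[R]_n) : dotv (e_ i) (e_ j *m M) = M j i.
    by rewrite dotvC dotv_delta -rowE mxE.
  rewrite -addrA !(dotvDl (h *: _)) !dotvZl !eM mxE; ring.
apply: (@is_deriveZ _ _ _ _ B).
apply: is_derive_eq; first apply: is_deriveM.
- exact: (@is_deriveZ _ _ _ _ N.+2%:R _ _ _ (is_derive_n2X N.+1 x i)).
- exact: (@is_deriveZ _ _ _ _ 2 _ _ _ (is_derive_coord x i j)).
by rewrite /GRing.scale /= addrC; congr (_ + _); rewrite mulrC.
Qed.

Lemma continuous_n2X k : continuous (fun x : 'rV[R]_n => n2 (x - x0) ^+ k).
Proof. by apply: contX; exact: continuous_n2. Qed.

Lemma continuous_pol : continuous pol.
Proof.
rewrite /pol; under eq_fun do rewrite dotvC.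
apply: contD; first apply: contD.
- exact: continuous_dotv.
- apply: contM; last exact: cont_cst.
  have -> : (fun y : 'rV[R]_n => qf X (y - x0)) =
    (fun y => \sum_i dotv (y - x0) (e_ i *m X^T) * (y - x0) 0 i).
    apply/funext => y; apply: eq_bigr => i _; congr (_ * _).
    by rewrite -dotv_mulr dotv_delta.
  apply: cont_sum => i; apply: contM; first exact: continuous_dotv.
  exact: continuous_coordB.
- by apply: contM; [exact: cont_cst|exact: continuous_n2X].
Qed.

Lemma continuous_coordB2 i : continuous (fun x : 'rV[R]_n => 2 * (x - x0) 0 i).
Proof. by apply: contM; [exact: cont_cst|exact: continuous_coordB]. Qed.

Lemma continuous_gpol i : continuous (gpol i).
Proof.
apply: contD.
  apply: contD; first exact: cont_cst.
  by apply: contM; [apply: contD; exact: continuous_dotv|exact: cont_cst].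
apply: contM; first exact: cont_cst.
apply: contM; last exact: continuous_coordB2.
by apply: contM; [exact: cont_cst|exact: continuous_n2X].
Qed.

Lemma continuous_hpol i j : continuous (hpol i j).
Proof.
apply: contD; first exact: cont_cst.
apply: contM; first exact: cont_cst.
apply: contD.
  apply: contM; last exact: continuous_coordB2.
  apply: contM; first exact: cont_cst.
  apply: contM; last exact: continuous_coordB2.
  by apply: contM; [exact: cont_cst|exact: continuous_n2X].
apply: contM; last exact: cont_cst.
by apply: contM; [exact: cont_cst|exact: continuous_n2X].
Qed.

Lemma pderiv_gpol i j : pderiv i (gpol j) = hpol i j.
Proof. by apply/funext => x; exact: (derive_val (is_derive := is_derive_gpol x i j)). Qed.

Variables (t0 tau C : R).

Definition test (t : R) (x : 'rV[R]_n) : R :=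
  tau * (t - t0) + C * (t - t0) ^+ 2 + pol x.

Lemma is_derive_test t x i : is_derive x (e_ i) (test t) (gpol i x).
Proof.
rewrite -[gpol i x]add0r; apply: is_deriveD; last exact: is_derive_pol.
Qed.

Lemma pderiv_test i t : pderiv i (test t) = gpol i.
Proof.
by apply/funext => x; exact: (derive_val (is_derive := is_derive_test t x i)).
Qed.

Lemma is_derive_test_time t x :
  is_derive t (1 : R) (fun s => test s x) (tau + 2 * C * (t - t0)).
Proof.
apply: (@is_derive_quad _ _ _ _ _ C) => h.
by rewrite /test /GRing.scale /=; ring.
Qed.

Lemma dtime_test t x : dtime test t x = tau + 2 * C * (t - t0).
Proof.
by rewrite /dtime derive1E; exact: (derive_val (is_derive := is_derive_test_time t x)).
Qed.

Lemma continuous_test : continuous (fun y : R * 'rV[R]_n => test y.1 y.2).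
Proof.
have cont_snd (f : 'rV[R]_n -> R) : continuous f ->
    continuous (fun y : R * 'rV[R]_n => f y.2).
  by move=> cf y; apply: (@continuous_comp _ _ _ snd f); [exact: cvg_snd|exact: cf].
have cont_t : continuous (fun y : R * 'rV[R]_n => y.1 - t0).
  by move=> y; apply: cvgB; [exact: cvg_fst|exact: cvg_cst].
apply: contD; last exact: (cont_snd _ continuous_pol).
apply: contD; first by apply: contM; [exact: cont_cst|exact: cont_t].
by apply: contM; [exact: cont_cst|exact: contX].
Qed.

Lemma C12_test T : C12 T test.
Proof.
have cont_snd (f : 'rV[R]_n -> R) : continuous f ->
    continuous (fun y : R * 'rV[R]_n => f y.2).
  by move=> cf y; apply: (@continuous_comp _ _ _ snd f); [exact: cvg_snd|exact: cf].
have cont_t : continuous (fun y : R * 'rV[R]_n => y.1 - t0).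
  by move=> y; apply: cvgB; [exact: cvg_fst|exact: cvg_cst].
split.
- move=> t x _; split.
  + by case: (is_derive_test_time t x).
  + by move=> i; case: (is_derive_test t x i).
  + by move=> i j; rewrite pderiv_test; case: (is_derive_gpol x i j).
- by apply: continuous_subspaceT; exact: continuous_test.
- apply: continuous_subspaceT.
  under eq_fun do rewrite dtime_test.
  apply: contD; first exact: cont_cst.
  by apply: contM; [exact: cont_cst|exact: cont_t].
- move=> i; apply: continuous_subspaceT.
  have -> : (fun y : R * 'rV[R]_n => pderiv i (test y.1) y.2) =
      (fun y => gpol i y.2) by apply/funext => y; rewrite pderiv_test.
  by apply: cont_snd; exact: continuous_gpol.
- move=> i j; apply: continuous_subspaceT.
  have -> : (fun y : R * 'rV[R]_n => pderiv i (pderiv j (test y.1)) y.2) =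
      (fun y => hpol i j y.2) by apply/funext => y; rewrite pderiv_test pderiv_gpol.
  by apply: cont_snd; exact: continuous_hpol.
Qed.

End Pol.
End TestFunctions.

(** * Parabolic superjets of viscosity subsolutions *)

Section Jets.
Context {R : realType}.

Lemma min3_le (a b c : R) : let m := Num.min a (Num.min b c) in
  [/\ m <= a, m <= b & m <= c].
Proof. by split; rewrite !ge_min lexx ?orbT. Qed.

(* Only times before [t] are looked at, since maxima over [0, t1] x R^d may lie on
   the final slice. *)
Definition upper_jet n (g : R -> 'rV[R]_n -> R) (t : R) z (tau : R) (p : 'rV[R]_n)
    (Q : 'M[R]_n) :=
  forall kap : R, 0 < kap -> exists2 del : R, 0 < del & forall (s : R) zeta,
    - del <= s <= 0 -> enorm zeta <= del ->
    g (t + s) (z + zeta) <=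
      g t z + tau * s + dotv p zeta + qf Q zeta / 2 + kap * (n2 zeta - s).

(* A square root of the diffusion matrix: the sum of [qf H] over these vectors is
   lam tr H + tr (S S^T H). *)
Definition Acol d l (lam : R) (S : 'M[R]_(d, l)) (j : 'I_d + 'I_l) : 'rV[R]_d :=
  match j with
  | inl i => Num.sqrt lam *: delta_mx 0 i
  | inr k => (col k S)^T
  end.

Lemma qf_delta n (H : 'M[R]_n) i : qf H (delta_mx 0 i) = H i i.
Proof. by rewrite /qf dotv_delta -rowE mxE. Qed.

Lemma sum_qf_Acol d l (lam : R) (S : 'M[R]_(d, l)) (H : 'M[R]_d) : 0 <= lam ->
  \sum_j qf H (Acol lam S j) = lam * \tr H + \tr (S *m S^T *m H).
Proof.
move=> lam0; rewrite big_sumType /=; congr (_ + _).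
  by rewrite mulr_sumr; apply: eq_bigr => i _; rewrite qfZ sqr_sqrtr // qf_delta.
rewrite -mulmxA mxtrace_mulC; apply: eq_bigr => k _.
rewrite [RHS]mxE; apply: eq_bigr => i _; rewrite !mxE; congr (_ * _).
by apply: eq_bigr => j _; rewrite !mxE.
Qed.

Lemma sum_dotv_Acol d l (lam : R) (S : 'M[R]_(d, l)) (v : 'rV[R]_d) : 0 <= lam ->
  \sum_j dotv v (Acol lam S j) ^+ 2 = lam * n2 v + n2 (v *m S).
Proof.
move=> lam0; rewrite big_sumType /=; congr (_ + _).
  rewrite mulr_sumr; apply: eq_bigr => i _.
  by rewrite dotvZr dotv_delta exprMn sqr_sqrtr // expr2.
apply: eq_bigr => k _; rewrite -expr2 mxE; congr (_ ^+ 2).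
by apply: eq_bigr => i _; rewrite !mxE.
Qed.

Lemma sum_n2_Acol d l (lam : R) (S : 'M[R]_(d, l)) : 0 <= lam ->
  \sum_j n2 (Acol lam S j) = lam * d%:R + enorm S ^+ 2.
Proof.
move=> lam0; rewrite big_sumType /=; congr (_ + _).
  rewrite (eq_bigr (fun=> lam)); last first.
    move=> i _; rewrite n2Z sqr_sqrtr // -[n2 _]mul1r -qf_scalar qf_delta mxE eqxx.
    by rewrite mulr1.
  by rewrite sumr_const card_ord mulr_natr.
rewrite /enorm sqr_sqrtr; last first.
  by apply: sumr_ge0 => i _; apply: sumr_ge0 => j _; rewrite sqr_ge0.
rewrite exchange_big; apply: eq_bigr => k _; apply: eq_bigr => i _.
by rewrite !mxE expr2.
Qed.

(** The equation is linear, so the supersolution property of u is this predicate for -u. Growth is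
    recorded with an integer power, to be matched by polynomial test functions. *)
Definition subsol d l (T lam : R) (Sigma : 'rV[R]_d -> 'M[R]_(d, l))
    (b : R -> 'rV[R]_d -> 'rV[R]_d) (u : R -> 'rV[R]_d -> R) :=
  [/\ cont_on [set p : R * 'rV[R]_d | 0 <= p.1 <= T] u,
      exists (C : R) N, forall (t : R) x, 0 <= t <= T -> `|u t x| <= C * (1 + n2 x) ^+ N &
      forall chi, C12 T chi -> forall (t0 : R) x0, 0 < t0 < T ->
        (forall (t : R) x, 0 < t < T -> u t x - chi t x <= u t0 x0 - chi t0 x0) ->
        pde_op lam Sigma b chi t0 x0 <= 0].

Section JetLemma.
Variables (d l : nat) (T lam : R) (Sigma : 'rV[R]_d -> 'M[R]_(d, l)).
Variables (b : R -> 'rV[R]_d -> 'rV[R]_d) (u : R -> 'rV[R]_d -> R).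
Hypothesis lam0 : 0 <= lam.
Hypothesis contS : forall i j, continuous (fun x => Sigma x i j).
Hypothesis contb : forall (t : R) x i, 0 < t ->
  {for (t, x), continuous (fun p : R * 'rV[R]_d => b p.1 p.2 0 i)}.
Hypothesis subu : subsol T lam Sigma b u.
Variables (t0 : R) (x0 : 'rV[R]_d).
Hypothesis t0T : 0 < t0 < T.

Ltac slra := clear - lam0 contS contb subu t0T; intros; lra.

(** The operator applied to the test function, without the term due to [C]. Its positivity near (t0,
    x0) therefore survives a later choice of a large [C]. *)
Definition opx p X B N tau (t : R) (x : 'rV[R]_d) : R :=
  tau - \sum_j qf (\matrix_(i, j) hpol x0 X B N i j x) (Acol lam (Sigma x) j)
  + \sum_i b t x 0 i * gpol x0 p X B N i x.

Lemma pde_op_test p X B N tau C t x :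
  pde_op lam Sigma b (test x0 p X B N t0 tau C) t x =
  opx p X B N tau t x + 2 * C * (t - t0).
Proof.
rewrite /pde_op /L0 dtime_test /opx sum_qf_Acol //.
have -> : hess (test x0 p X B N t0 tau C t) x =
    \matrix_(i, j) hpol x0 X B N i j x.
  by apply/matrixP => i j; rewrite !mxE pderiv_test (pderiv_gpol x0 p).
have -> : laplacian (test x0 p X B N t0 tau C t) x =
    \tr (\matrix_(i, j) hpol x0 X B N i j x).
  by apply: eq_bigr => i _; rewrite !mxE pderiv_test (pderiv_gpol x0 p).
have -> : dotv (b t x) (grad (test x0 p X B N t0 tau C t) x) =
    \sum_i b t x 0 i * gpol x0 p X B N i x.
  by apply: eq_bigr => i _; rewrite mxE pderiv_test.
ring.
Qed.

Lemma opx_center p X B N tau :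
  opx p X B N tau t0 x0 =
  tau - \sum_j qf X (Acol lam (Sigma x0) j) + dotv (b t0 x0) p.
Proof.
rewrite /opx; congr (_ - _ + _).
  apply: eq_bigr => j _.
  have -> : (\matrix_(i, j) hpol x0 X B N i j x0) = 2^-1 *: (X + X^T).
    apply/matrixP => i k; rewrite mxE /hpol subrr n20 !mxE exprS mul0r.
    by field.
  rewrite qfZX qfDX.
  have -> : qf X^T (Acol lam (Sigma x0) j) = qf X (Acol lam (Sigma x0) j).
    by rewrite /qf dotv_mulr trmxK dotvC.
  by field.
apply: eq_bigr => i _; rewrite /gpol subrr n20 mxE exprS !dotv0l.
by field.
Qed.

Lemma continuous_opx p X B N tau :
  {for (t0, x0), continuous (fun q : R * 'rV[R]_d => opx p X B N tau q.1 q.2)}.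
Proof.
have cont_snd (f : 'rV[R]_d -> R) : continuous f ->
    continuous (fun y : R * 'rV[R]_d => f y.2).
  by move=> cf y; apply: (@continuous_comp _ _ _ snd f); [exact: cvg_snd|exact: cf].
apply: cvgD.
  have c : continuous (fun x => tau -
      \sum_j qf (\matrix_(i, j) hpol x0 X B N i j x) (Acol lam (Sigma x) j)).
    have -> : (fun x => tau -
      \sum_j qf (\matrix_(i, j) hpol x0 X B N i j x) (Acol lam (Sigma x) j)) =
     (fun x => tau + -1 * \sum_j \sum_i \sum_k
        Acol lam (Sigma x) j 0 k * hpol x0 X B N k i x * Acol lam (Sigma x) j 0 i).
      apply/funext => x; rewrite mulN1r; congr (_ - _).
      apply: eq_bigr => j _; apply: eq_bigr => i _.
      by rewrite mxE mulr_suml; apply: eq_bigr => k _; rewrite !mxE.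
    have cA j i : continuous (fun x => Acol lam (Sigma x) j 0 i).
      case: j => j /=; first exact: cont_cst.
      have -> : (fun x => (col j (Sigma x))^T 0 i) = (fun x => Sigma x i j).
        by apply/funext => x; rewrite !mxE.
      exact: contS.
    apply: contD; first exact: cont_cst.
    apply: contM; first exact: cont_cst.
    apply: cont_sum => j; apply: cont_sum => i; apply: cont_sum => k.
    by apply: contM; [apply: contM; [|exact: continuous_hpol]|].
  exact: (cont_snd _ c (t0, x0)).
rewrite /=; elim: (index_enum _) => [|i s IH].
  by under eq_fun do rewrite big_nil; rewrite big_nil; exact: cvg_cst.
under eq_fun do rewrite big_cons.
rewrite big_cons; apply: cvgD; last exact: IH.
apply: cvgM; first by apply: contb; case/andP: t0T.
exact: (cont_snd _ (@continuous_gpol _ _ x0 p X B N i) (t0, x0)).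
Qed.

(** Away from the ball of radius [del], 1 + |xi|^2 is at most [c] |xi|^2, so each term is bounded by
    its coefficient times ([c] |xi|^2)^(N + 2); [S] adds up these coefficients. *)
Lemma jet_growth (del tau : R) p (X : 'M[R]_d) : 0 < del ->
  exists (B : R) N, 0 <= B /\ forall (t : R) xi, 0 <= t <= T -> del < enorm xi ->
    u t (x0 + xi) - tau * (t - t0) - dotv p xi - qf X xi / 2
      - B * n2 xi ^+ N.+2 < u t0 x0.
Proof.
move=> del0; case: subu => _ [C [N uC]] _.
pose a := 2 + 2 * n2 x0; pose c := 1 + (del ^+ 2)^-1.
pose S := `|C| * a ^+ N + `|tau| * T + (1 + n2 p) + enorm X + `|u t0 x0| + 1.
have T0 : 0 <= T by move: t0T => /andP[? ?]; lra.
have c0 : 0 <= c by rewrite /c addr_ge0 // invr_ge0 exprn_ge0 // ltW.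
have S0 : 0 <= S.
  rewrite /S !addr_ge0 ?mulr_ge0 ?exprn_ge0 ?enorm_ge0 ?n2_ge0 //.
  by rewrite /a; have := n2_ge0 x0; lra.
exists (S * c ^+ N.+2), N; split; first by rewrite mulr_ge0 ?exprn_ge0.
move=> t xi tT xid.
set y := n2 xi; pose Z := 1 + y.
have y0 : del ^+ 2 <= y by rewrite /y -enorm_sqr ler_pXn2r ?nnegrE ?enorm_ge0 // ltW.
have yp : 0 <= y by exact: n2_ge0.
have Z1 : 1 <= Z by rewrite /Z; lra.
have d2 : 0 < del ^+ 2 by rewrite exprn_gt0.
have Zc : Z <= c * y.
  rewrite /Z /c mulrDl mul1r addrC lerD2l.
  by rewrite mulrC ler_pdivlMr // mul1r.
have a1 : 1 <= a by rewrite /a; have := n2_ge0 x0; lra.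
have ZN k : (k <= N.+2)%N -> Z ^+ k <= Z ^+ N.+2 by move=> kN; exact: ler_weXn2l.
have Z1N : Z <= Z ^+ N.+2 by rewrite -{1}[Z]expr1; exact: ZN.
have h1 : u t (x0 + xi) <= `|C| * a ^+ N * Z ^+ N.+2.
  apply: (le_trans (ler_norm _)); apply: (le_trans (uC _ _ tT)).
  have C0 := ler_norm C.
  have X1 : (1 + n2 (x0 + xi)) ^+ N <= (a * Z) ^+ N.
    rewrite lerXn2r ?nnegrE //.
    - by have := n2_ge0 (x0 + xi); lra.
    - by rewrite mulr_ge0 //; lra.
    - have := n2D_le x0 xi; rewrite /a /Z -/y; have := n2_ge0 x0; nra.
  apply: (@le_trans _ _ (`|C| * (1 + n2 (x0 + xi)) ^+ N)).
    by rewrite ler_wpM2r // exprn_ge0 //; have := n2_ge0 (x0 + xi); lra.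
  rewrite -mulrA ler_wpM2l // (le_trans X1) // exprMn ler_wpM2l //.
    by rewrite exprn_ge0 //; lra.
  by apply: ZN; rewrite -addn2 leq_addr.
have h2 : - (tau * (t - t0)) <= `|tau| * T * Z.
  apply: (@le_trans _ _ (`|tau| * T)).
    apply: (le_trans (ler_norm _)); rewrite normrN normrM ler_wpM2l //.
    by rewrite ler_norml; move: tT t0T => /andP[? ?] /andP[? ?]; lra.
  by apply: ler_peMr => //; rewrite mulr_ge0 //; move: tT => /andP[? ?]; lra.
have h3 : - dotv p xi <= (1 + n2 p) * Z.
  have := n2_ge0 (p + xi); rewrite n2D -/y /Z; have := n2_ge0 p; nra.
have h4 : - (qf X xi / 2) <= enorm X * Z.
  have := qf_le X xi; rewrite ler_norml -/y => /andP[h _].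
  have := enorm_ge0 X; rewrite /Z; nra.
have h5 : - u t0 x0 <= `|u t0 x0| * Z.
  have := ler_norm (- u t0 x0); rewrite normrN; have := normr_ge0 (u t0 x0); nra.
have h6 : S * Z ^+ N.+2 <= S * c ^+ N.+2 * y ^+ N.+2.
  rewrite -mulrA -exprMn ler_wpM2l //.
  by apply: lerXn2r; rewrite ?nnegrE //; lra.
have tT0 : 0 <= `|tau| * T by rewrite mulr_ge0.
have hp := n2_ge0 p; have hX := enorm_ge0 X; have hu := normr_ge0 (u t0 x0).
set W := Z ^+ N.+2 in h1 Z1N h6; move: h6; rewrite {1}/S => h6.
have k2 := ler_wpM2l tT0 Z1N; have k3 := ler_wpM2l (addr_ge0 ler01 hp) Z1N.
have k4 := ler_wpM2l hX Z1N; have k5 := ler_wpM2l hu Z1N.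
lra.
Qed.

(** Nothing is assumed at times after t0, so the maximum of u minus the test function may move
    forward. The penalty C (t - t0)^2 makes this harmless: at a later time its derivative has the
    good sign, and at an earlier time it makes the maximum strictly smaller than the value at (t0,
    x0). *)
Lemma jet_strict (tau : R) p (X : 'M[R]_d) (del kap : R) : 0 < del -> 0 < kap ->
  (forall (s : R) xi, - del <= s <= 0 -> enorm xi <= del ->
    u (t0 + s) (x0 + xi) <=
      u t0 x0 + tau * s + dotv p xi + qf X xi / 2 - kap * n2 xi) ->
  tau + dotv (b t0 x0) p <= \sum_j qf X (Acol lam (Sigma x0) j).
Proof.
move=> del0 kap0 hyp; rewrite leNgt; apply/negP => contra.
have [cu0 _ visc] := subu; have [t00 t0lT] := andP t0T.
pose dl : R := Num.min del (Num.min (t0 / 2) ((T - t0) / 2)).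
have dl0 : 0 < dl.
  by rewrite /dl; move: del0 t00 t0lT; rewrite 2!lt_min => -> h1 h2 /=; apply/andP; split; lra.
have dle : [/\ dl <= del, dl <= t0 / 2 & dl <= (T - t0) / 2].
  exact: min3_le.
case: dle => dl1 dl2 dl3; clearbody dl.
have [B [N [B0 hB]]] := jet_growth tau p X dl0.
have op0 : 0 < opx p X B N tau t0 x0 by rewrite opx_center; lra.
have [mu0 mu00 hmu0] : exists2 m : R, 0 < m & forall (t : R) x, `|t - t0| <= m ->
    enorm (x - x0) <= m -> 0 < opx p X B N tau t x.
  have := @continuous_opx p X B N tau.
  move=> /cvgr_gt /(_ 0 op0) /nbhs_prodP[m m0 hm].
  by exists m => // t x h1 h2; exact: hm.
pose mu : R := Num.min mu0 dl.
have mu_gt0 : 0 < mu by rewrite lt_min mu00.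
have [mu1 mu2] : mu <= mu0 /\ mu <= dl by split; rewrite /mu ge_min lexx ?orbT.
clearbody mu.
have cu : cont_on (cyl (t0 - dl) (t0 + dl) x0 dl) u.
  apply: cont_onW cu0.
  by move=> [t x] [/= /andP[? ?] _]; apply/andP; split; lra.
have e0 : 0 < kap * mu ^+ 2 by rewrite mulr_gt0 ?exprn_gt0.
have [s0 s00 hs0] := cyl_unif cu (e := kap * mu ^+ 2 / 4) ltac:(lra).
have tau1 : 0 < 1 + `|tau| by rewrite ltr_pwDl.
(* Over a time [s1], both u and the term tau (t - t0) vary by at most a quarter of the spatial loss
   kap mu^2. *)
pose s1 : R := Num.min (Num.min s0 mu) (kap * mu ^+ 2 / 4 / (1 + `|tau|)).
have s1_gt0 : 0 < s1.
  rewrite 2!lt_min s00 mu_gt0 divr_gt0 //.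
  by move: e0; slra.
have [s11 s12 s13] : [/\ s1 <= s0, s1 <= mu & s1 <= kap * mu ^+ 2 / 4 / (1 + `|tau|)].
  by have [? ? ?] := min3_le s0 mu (kap * mu ^+ 2 / 4 / (1 + `|tau|)); rewrite /s1 -minA.
clearbody s1.
pose v t x := u t x - test x0 p X B N t0 tau 0 t x.
have vE t xi : v t (x0 + xi) = u t (x0 + xi) - tau * (t - t0) - dotv p xi
    - qf X xi / 2 - B * n2 xi ^+ N.+2.
  by rewrite /v /test /pol [x0 + _]addrC addrK; ring.
have cv : cont_on (cyl 0 T x0 dl) v.
  apply: cont_onB; first by apply: cont_onW cu0 => -[t x] [].
  by apply: cont_on_cts; exact: continuous_test.
have vD t x : v t x = u t x - test x0 p X B N t0 tau 0 t x by [].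
clearbody v; have [M M0 hM] := cyl_bounded cv.
pose C : R := (M + `|u t0 x0| + 1) / s1 ^+ 2.
have C0 : 0 < C by rewrite divr_gt0 ?exprn_gt0 // ltr_wpDl // addr_ge0.
have CE : C * s1 ^+ 2 = M + `|u t0 x0| + 1 by rewrite divfK // gt_eqF // exprn_gt0.
clearbody C.
pose D t x := u t x - test x0 p X B N t0 tau C t x.
have DE t x : D t x = v t x - C * (t - t0) ^+ 2 by rewrite /D vD /test; ring.
have Ddef t x : D t x = u t x - test x0 p X B N t0 tau C t x by [].
clearbody D.
have rng t : t0 - s1 <= t <= t0 + s1 ->
    [/\ t0 - dl <= t <= t0 + dl, 0 < t < T, 0 <= t <= T & - s1 <= t - t0 <= s1].
  move=> /andP[h1 h2].
  have h3 : 0 < t by move: h1 s12 mu2 dl2 t00; slra.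
  have h4 : t < T by move: h2 s12 mu2 dl3 t0lT; slra.
  split; apply/andP; split => //; try exact: ltW.
  - by move: h1 s12 mu2; slra.
  - by move: h2 s12 mu2; slra.
  - by move: h1; slra.
  - by move: h2; slra.
have rng0 : t0 - s1 <= t0 <= t0 + s1 by apply/andP; split; move: s1_gt0; slra.
have cD : cont_on (cyl (t0 - s1) (t0 + s1) x0 mu) D.
  have -> : D = (fun t x => u t x - test x0 p X B N t0 tau C t x).
    by apply/funext => t; apply/funext => x; exact: Ddef.
  apply: cont_onB; last by apply: cont_on_cts; exact: continuous_test.
  by apply: cont_onW cu0 => -[t x] [/= /rng[]].
have s1le : t0 - s1 <= t0 + s1 by move: s1_gt0; slra.
have [ts [xs [[/= tsI xsI] hmax]]] := cyl_max s1le (ltW mu_gt0) cD.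
have Dc : D t0 x0 = u t0 x0.
  rewrite DE -{1}[x0]addr0 vE addr0 dotv0r qf0 n20 exprS; ring.
have Dle : u t0 x0 <= D ts xs.
  by rewrite -Dc; apply: hmax; split=> //=; rewrite subrr enorm0 ltW.
have Bpos (xi : 'rV[R]_d) : 0 <= B * n2 xi ^+ N.+2.
  by rewrite mulr_ge0 // exprn_ge0 // n2_ge0.
have kpos (xi : 'rV[R]_d) : 0 <= kap * n2 xi by rewrite mulr_ge0 ?n2_ge0 // ltW.
have back (t : R) xi : t0 - s1 <= t <= t0 -> enorm xi <= dl ->
    v t (x0 + xi) <= u t0 x0 - kap * n2 xi.
  move=> /andP[h1 h2] h3; rewrite vE.
  have h4 : - del <= t - t0 <= 0.
    by apply/andP; split; [move: h1 s12 mu2 dl1; slra|rewrite subr_le0].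
  have := hyp (t - t0) xi h4 (le_trans h3 dl1).
  by rewrite [t0 + _]addrC subrK; move: (Bpos xi); slra.
have Cpos (t : R) : 0 <= C * (t - t0) ^+ 2 by rewrite mulr_ge0 ?sqr_ge0 // ltW.
(* Points farther than [dl] lose by [B], times at distance at least [s1] by [C], past times by
   [back]. At later times in the shell between [mu] and [dl], the loss kap mu^2 known at time t0
   outweighs the variation over [s1]. What remains is the compact cylinder where the maximum was
   taken. *)
have glob (t : R) x : 0 < t < T -> D t x <= D ts xs.
  move=> tT; have -> : x = x0 + (x - x0) by rewrite addrC subrK.
  have tT' : 0 <= t <= T by case/andP: tT => ? ?; rewrite !ltW.
  move: (x - x0) => xi; have n2p := n2_ge0 xi.
  have [xid|xid] := ltP dl (enorm xi).
    have := hB t xi tT' xid.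
    by rewrite -vE DE; move: (Cpos t) Dle; slra.
  have xic : enorm (x0 + xi - x0) <= dl by rewrite addrC addKr.
  have [ts1|ts1] := leP s1 `|t - t0|.
    have := hM t (x0 + xi) (conj tT' xic).
    have : C * s1 ^+ 2 <= C * (t - t0) ^+ 2.
      rewrite ler_pM2l // -[(t - t0) ^+ 2]real_normK ?num_real //.
      by rewrite ler_pXn2r ?nnegrE // ltW.
    rewrite CE DE ler_norml => h1 /andP[_ h2].
    by move: h1 h2 (ler_norm (- u t0 x0)) Dle; rewrite normrN; slra.
  have tI : t0 - s1 <= t <= t0 + s1.
    by move: ts1; rewrite ltr_norml => /andP[h1 h2]; apply/andP; split;
      move: h1 h2; slra.
  have [tt0|tt0] := leP t t0.
    have h : t0 - s1 <= t <= t0 by case/andP: tI => ->.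
    have := back t xi h xid.
    by rewrite DE; move: (Cpos t) (kpos xi) Dle; slra.
  have [xmu|xmu] := leP (enorm xi) mu.
    by apply: hmax; split => //=; rewrite addrC addKr.
  have kmu : kap * mu ^+ 2 <= kap * n2 xi.
    by rewrite ler_pM2l // -enorm_sqr ler_pXn2r ?nnegrE ?enorm_ge0 // ltW.
  have [tdl _ _ tts] := rng _ tI; have [t0dl _ _ _] := rng _ rng0.
  have tb : - (tau * (t - t0)) <= kap * mu ^+ 2 / 4.
    move: s13; rewrite ler_pdivlMr // => s13.
    apply: (le_trans (ler_norm _)); rewrite normrN normrM.
    have h1 : `|t - t0| <= s1 by rewrite ler_norml.
    apply: le_trans s13; rewrite mulrC.
    apply: (le_trans (ler_wpM2r (normr_ge0 _) h1)).
    by rewrite ler_pM2l // lerDr ler01.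
  have h0 : t0 - s1 <= t0 <= t0 by rewrite lexx andbT; case/andP: rng0.
  have bk := back t0 xi h0 xid.
  have ts0 : `|t - t0| <= s0 by exact: ltW (lt_le_trans ts1 s11).
  have z0 : enorm (x0 + xi - (x0 + xi)) <= s0 by rewrite subrr enorm0 ltW.
  have := hs0 t0 (x0 + xi) t (x0 + xi) (conj t0dl xic) (conj tdl xic) ts0 z0.
  move: bk; rewrite vE subrr mulr0 subr0 ler_norml => bk /andP[_ H].
  by rewrite DE vE; move: bk H tb kmu Dle e0 (Cpos t); slra.
have [_ tsT _ tsd] := rng _ tsI.
have glob' (t : R) x : 0 < t < T -> u t x - test x0 p X B N t0 tau C t x <=
    u ts xs - test x0 p X B N t0 tau C ts xs by rewrite -!Ddef; exact: glob.
have := visc _ (C12_test x0 p X B N t0 tau C T) ts xs tsT glob'.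
rewrite pde_op_test.
have H : 0 < opx p X B N tau ts xs.
  apply: hmu0; last exact: (le_trans xsI).
  rewrite ler_norml; case/andP: tsd => h1 h2; apply/andP; split.
    by move: h1 s12 mu1; slra.
  by move: h2 s12 mu1; slra.
(* Later contact times contradict the sign of the operator; earlier ones contradict the value at
   (t0, x0). *)
have [tst0|tst0] := leP t0 ts.
  have : 0 <= 2 * C * (ts - t0) by rewrite !mulr_ge0 ?subr_ge0 // ltW.
  by move: H; slra.
have xsE : xs = x0 + (xs - x0) by rewrite addrC subrK.
have h : t0 - s1 <= ts <= t0 by rewrite (ltW tst0) andbT; case/andP: tsI.
have := back ts (xs - x0) h (le_trans xsI mu2).
rewrite -xsE; move: Dle; rewrite DE.
have : 0 < C * (ts - t0) ^+ 2.
  rewrite mulr_gt0 // -[_ ^+ 2]real_normK ?num_real // exprn_gt0 // normr_gt0.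
  by rewrite subr_eq0 lt_eqF.
by move: (kpos (xs - x0)); slra.
Qed.

(** Lowering tau by [kap] and adding 4 [kap] I to X turns the tolerance of the jet into the strict
    margin of [jet_strict]; then [kap] tends to 0. *)
Lemma jet_subsol (tau : R) p (X : 'M[R]_d) : upper_jet u t0 x0 tau p X ->
  tau + dotv (b t0 x0) p <= \sum_j qf X (Acol lam (Sigma x0) j).
Proof.
move=> uj; pose L := \sum_j n2 (Acol lam (Sigma x0) j).
have L0 : 0 <= L by apply: sumr_ge0 => j _; exact: n2_ge0.
apply/ler_addgt0Pr => e e0.
pose kap := e / (1 + 4 * L).
have kap0 : 0 < kap by rewrite divr_gt0 //; lra.
have [del del0 h] := uj kap kap0.
have := @jet_strict (tau - kap) p (X + (4 * kap)%:M) del kap del0 kap0.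
have -> : \sum_j qf (X + (4 * kap)%:M) (Acol lam (Sigma x0) j) =
    \sum_j qf X (Acol lam (Sigma x0) j) + 4 * kap * L.
  by rewrite mulr_sumr -big_split; apply: eq_bigr => j _; rewrite qfDX qf_scalar.
have kE : kap + 4 * kap * L = e by rewrite /kap; field; lra.
move=> H; suff : tau - kap + dotv (b t0 x0) p <= 
  \sum_j qf X (Acol lam (Sigma x0) j) + 4 * kap * L by lra.
apply: H => s xi s0 xid; apply: (le_trans (h s xi s0 xid)).
rewrite qfDX qf_scalar; lra.
Qed.

End JetLemma.
End Jets.

(** * Averages along random walks *)

Section Walk.
Context {R : realType}.

Lemma MVT_between (f df : R -> R) (a b : R) :
  (forall x, is_derive x (1 : R) f (df x)) ->
  exists2 c, (Num.min a b <= c <= Num.max a b) & f b - f a = df c * (b - a).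
Proof.
move=> fd.
have cf : continuous f.
  move=> x; apply: differentiable_continuous; apply/derivable1_diffP.
  by case: (fd x).
have key (x y : R) : x <= y -> exists2 c, (x <= c <= y) & f y - f x = df c * (y - x).
  move=> xy; have [c cI E] := @MVT_segment _ f df x y xy (fun z _ => fd z)
    (continuous_subspaceT cf).
  by exists c => //; move: cI; rewrite in_itv.
case: (leP a b) => [ab|/ltW ba].
  by have [c cI E] := key a b ab; exists c.
have [c cI E] := key b a ba; exists c => //.
by rewrite -opprB E -mulrN opprB.
Qed.

Lemma expR_le4 (t : R) : `|t| <= 1 -> expR t <= 4.
Proof.
rewrite ler_norml => /andP[_ t1].
have h : expR (2^-1 : R) <= 2.
  have := expR_ge1Dx (- 2^-1 : R); rewrite expRN => h.
  have hp := expR_gt0 (2^-1 : R).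
  have h2 : 2^-1 <= (expR (2^-1 : R))^-1 by lra.
  by rewrite -[leRHS]invrK -[leLHS]invrK lef_pV2 ?posrE ?invr_gt0.
have -> : t = 2^-1 + (t - 2^-1) by ring.
rewrite expRD (_ : 4 = 2 * 2); last by ring.
apply: ler_pM => //; rewrite ?expR_ge0 //.
by apply: le_trans h; rewrite ler_expR; lra.
Qed.

(** The mean value theorem applied to the successive Taylor remainders gains a factor |t| each time;
    4 bounds the exponential on [-1, 1]. *)
Lemma expR_taylor3 (t : R) : `|t| <= 1 ->
  `|expR t - (1 + t + t ^+ 2 / 2)| <= 4 * `|t| ^+ 3.
Proof.
have within1 (s c : R) : `|s| <= 1 -> (Num.min 0 s <= c <= Num.max 0 s) ->
    `|c| <= `|s|.
  move=> s1; case: (leP 0 s) => s0 /andP[c1 c2].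
    by rewrite !ger0_norm.
  by rewrite !ler0_norm ?(ltW s0) // lerN2.
have h1 (s : R) : `|s| <= 1 -> `|expR s - 1| <= 4 * `|s|.
  move=> s1; have [c cI] := @MVT_between expR expR 0 s (fun x => is_derive_expR x).
  rewrite expR0 subr0 => ->; rewrite normrM ler_wpM2r //.
  rewrite ger0_norm ?expR_ge0 // expR_le4 //.
  exact: le_trans (within1 _ _ s1 cI) s1.
have h2 (s : R) : `|s| <= 1 -> `|expR s - (1 + s)| <= 4 * `|s| ^+ 2.
  move=> s1.
  have [|c cI] := @MVT_between (fun x => expR x - (1 + x)) (fun x => expR x - 1) 0 s.
    by move=> x; apply: is_derive_eq; rewrite add0r.
  rewrite expR0 addr0 subrr subr0 subr0 => ->.
  rewrite normrM exprS expr1 mulrA ler_wpM2r //.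
  have cs := within1 _ _ s1 cI.
  apply: (le_trans (h1 _ (le_trans cs s1))).
  by rewrite ler_pM2l.
move=> t1.
have [|c cI] := @MVT_between (fun x => expR x - (1 + x + x ^+ 2 / 2))
    (fun x => expR x - (1 + x)) 0 t.
  move=> x; apply: is_deriveB.
  apply: (@is_derive_quad _ _ _ _ _ _ 2^-1) => h.
  by rewrite /GRing.scale /=; field.
rewrite expR0 expr0n /= mul0r !addr0 subrr subr0 subr0 => ->.
rewrite normrM exprSr mulrA ler_wpM2r //.
have cs := within1 _ _ t1 cI.
apply: (le_trans (h2 _ (le_trans cs t1))).
by rewrite ler_pM2l // ler_pXn2r ?nnegrE.
Qed.

Lemma ln1D_bounds (x : R) : 0 <= x -> x - x ^+ 2 <= ln (1 + x) <= x.
Proof.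
move=> x0; have x1 : 0 < 1 + x by lra.
apply/andP; split; last by apply: le_ln1Dx; lra.
have := @le_ln1Dx R ((1 + x)^-1 - 1).
have -> : 1 + ((1 + x)^-1 - 1) = (1 + x)^-1 by ring.
rewrite lnV ?posrE // => h.
have {}h : - ln (1 + x) <= (1 + x)^-1 - 1.
  by apply: h; rewrite ltrBrDl subrr invr_gt0.
have E : x - x ^+ 2 <= 1 - (1 + x)^-1.
  have -> : 1 - (1 + x)^-1 = x / (1 + x) by field; lra.
  rewrite ler_pdivlMr //.
  have : 0 <= x ^+ 3 by rewrite exprn_ge0.
  have -> : (x - x ^+ 2) * (1 + x) = x - x ^+ 3 by ring.
  lra.
lra.
Qed.

(** Second-order cumulant expansion of a centred bounded variable, uniform in its law. With x the
    excess of the mean exponential over 1, the Taylor error is 4 B^3 and ln (1 + x) loses at most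
    x^2 <= 20.25 B^3, as B <= 1. *)
Lemma lse_taylor (I : finType) (w t : I -> R) (B : R) :
  (forall i, 0 <= w i) -> \sum_i w i = 1 -> \sum_i w i * t i = 0 ->
  0 <= B <= 1 -> (forall i, `|t i| <= B) ->
  `|ln (\sum_i w i * expR (t i)) - (\sum_i w i * t i ^+ 2) / 2| <= 25 * B ^+ 3.
Proof.
move=> w0 w1 wt /andP[B0 B1] tB.
set v := \sum_i w i * t i ^+ 2.
have avg_le (f : I -> R) c : (forall i, f i <= c) -> \sum_i w i * f i <= c.
  move=> fc; rewrite -[c]mul1r -w1 mulr_suml; apply: ler_sum => i _.
  exact: ler_wpM2l.
have v0 : 0 <= v by apply: sumr_ge0 => i _; rewrite mulr_ge0 ?sqr_ge0.
have vB : v <= B ^+ 2.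
  apply: avg_le => i; rewrite -[_ ^+ 2]real_normK ?num_real //.
  by rewrite ler_pXn2r ?nnegrE.
pose x := \sum_i w i * expR (t i) - 1.
have x0 : 0 <= x.
  rewrite /x subr_ge0; have -> : 1 = \sum_i w i * (1 + t i).
    under eq_bigr do rewrite mulrDr mulr1.
    by rewrite big_split /= w1 wt addr0.
  by apply: ler_sum => i _; rewrite ler_wpM2l // expR_ge1Dx.
have xE : `|x - v / 2| <= 4 * B ^+ 3.
  have -> : x - v / 2 = \sum_i w i * (expR (t i) - (1 + t i + t i ^+ 2 / 2)).
    transitivity (\sum_i w i * expR (t i) - (\sum_i w i + \sum_i w i * t i + v / 2)).
      by rewrite /x w1 wt addr0 opprD addrA.
    rewrite /v mulr_suml -!big_split -sumrB /=; apply: eq_bigr => i _; ring.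
  apply: (le_trans (ler_norm_sum _ _ _)).
  under eq_bigr do rewrite normrM (ger0_norm (w0 _)).
  apply: avg_le => i; apply: (le_trans (expR_taylor3 (le_trans (tB i) B1))).
  by rewrite ler_pM2l // ler_pXn2r ?nnegrE.
have SE : \sum_i w i * expR (t i) = 1 + x by rewrite /x addrC subrK.
have /andP[l1 l2] := ln1D_bounds x0.
have B3 : 0 <= B ^+ 3 by rewrite exprn_ge0.
have B4 : (B ^+ 3) ^+ 2 <= B ^+ 3.
  by rewrite expr2 ler_piMl // exprn_ile1.
have B24 : (B ^+ 2) ^+ 2 <= B ^+ 3.
  by rewrite -exprM; apply: ler_wiXn2l.
have B5 : B ^+ 2 * B ^+ 3 <= B ^+ 3 by rewrite ler_piMl // exprn_ile1.
have B2 : 0 <= B ^+ 2 by rewrite exprn_ge0.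
have xb : x <= B ^+ 2 / 2 + 4 * B ^+ 3.
  by move: xE; rewrite ler_norml => /andP[_]; lra.
have x2 : x ^+ 2 <= (B ^+ 2 / 2 + 4 * B ^+ 3) ^+ 2.
  by rewrite ler_pXn2r ?nnegrE //; lra.
have x2' : (B ^+ 2 / 2 + 4 * B ^+ 3) ^+ 2 =
    (B ^+ 2) ^+ 2 / 4 + 4 * (B ^+ 2 * B ^+ 3) + 16 * (B ^+ 3) ^+ 2 by field.
rewrite SE ler_norml; move: xE; rewrite ler_norml => /andP[e1 e2].
apply/andP; split; lra.
Qed.

(* Stand-in for positive semidefiniteness, stable under sums: it is exactly the
   comparison of traces that is needed, and requires no spectral theory. *)
Definition tmono n (Y : 'M[R]_n) :=
  forall (I J : finType) (A : I -> 'rV[R]_n) (B : J -> 'rV[R]_n) (c : R),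
    (forall v, \sum_i dotv v (A i) ^+ 2 <= c * \sum_j dotv v (B j) ^+ 2) ->
    \sum_i qf Y (A i) <= c * \sum_j qf Y (B j).

Lemma tmonoD n (Y Z : 'M[R]_n) : tmono Y -> tmono Z -> tmono (Y + Z).
Proof.
move=> hY hZ I J A B c h.
under eq_bigr do rewrite qfDX.
under [X in _ <= c * X]eq_bigr do rewrite qfDX.
by rewrite !big_split mulrDr lerD //; [exact: hY|exact: hZ].
Qed.

Lemma tmonoZ n (a : R) (Y : 'M[R]_n) : 0 <= a -> tmono Y -> tmono (a *: Y).
Proof.
move=> a0 hY I J A B c h.
under eq_bigr do rewrite qfZX.
under [X in _ <= c * X]eq_bigr do rewrite qfZX.
by rewrite -!mulr_sumr mulrCA ler_wpM2l //; exact: hY.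
Qed.

Lemma tmono_sum n (K : finType) (F : K -> 'M[R]_n) :
  (forall k, tmono (F k)) -> tmono (\sum_k F k).
Proof.
move=> hF; apply: (big_ind (@tmono n)) => //; last exact: tmonoD.
move=> I J A B c h.
rewrite big1 => [|i _]; last by rewrite qf0X.
by rewrite big1 ?mulr0 // => i _; rewrite qf0X.
Qed.

Lemma tmono_outer n (v : 'rV[R]_n) : tmono (v^T *m v).
Proof.
move=> I J A B c h.
under eq_bigr do rewrite qf_outer.
by under [X in _ <= c * X]eq_bigr do rewrite qf_outer.
Qed.

Lemma tmono_scalar n (a : R) : 0 <= a -> tmono (a%:M : 'M[R]_n).
Proof.
move=> a0; rewrite -scalemx1; apply: tmonoZ => // I J A B c h.
have E (K : finType) (C : K -> 'rV[R]_n) :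
    \sum_k qf (1%:M : 'M[R]_n) (C k) = \sum_i \sum_k dotv (delta_mx 0 i) (C k) ^+ 2.
  rewrite [RHS]exchange_big; apply: eq_bigr => k _; rewrite qf_scalar mul1r.
  by apply: eq_bigr => i _; rewrite dotvC dotv_delta expr2.
by rewrite !E mulr_sumr; apply: ler_sum.
Qed.

Section Step.
Variables (n : nat) (I : finType) (sg : I -> 'rV[R]_n).

Definition step (f : 'rV[R]_n -> R) (z : 'rV[R]_n) : R :=
  #|I|%:R^-1 * \sum_i f (z + sg i).

Lemma step_mono f g z : (forall y, f y <= g y) -> step f z <= step g z.
Proof. by move=> fg; rewrite ler_wpM2l ?invr_ge0 // ler_sum. Qed.

Lemma iter_step_mono k f g z : (forall y, f y <= g y) ->
  iter k step f z <= iter k step g z.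
Proof.
by move=> fg; elim: k z => [|k IH] z //=; apply: step_mono => y; exact: IH.
Qed.

Hypothesis I0 : (0 < #|I|)%N.
Hypothesis sg0 : \sum_i sg i = 0.

Lemma mulVcard : #|I|%:R^-1 * (#|I|%:R : R) = 1.
Proof. by rewrite mulVf // pnatr_eq0 -lt0n. Qed.

Lemma step_qf c (Q : 'M[R]_n) z : step (fun y => c + qf Q y) z =
  c + qf Q z + #|I|%:R^-1 * \sum_i qf Q (sg i).
Proof.
rewrite /step.
have -> : \sum_i (c + qf Q (z + sg i)) =
    #|I|%:R * (c + qf Q z) + \sum_i qf Q (sg i).
  transitivity (\sum_i ((c + qf Q z) + (dotv (sg i) (z *m Q) +
    dotv (sg i) (z *m Q^T)) + qf Q (sg i))).
    apply: eq_bigr => i _; rewrite qfD -dotv_mulr [dotv (z *m Q) _]dotvC; ring.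
  move: (qf Q z) => q.
  rewrite !big_split /= -!dotv_suml sg0 !dotv0l !addr0 !sumr_const.
  by rewrite mulrDr !mulr_natl.
by rewrite mulrDr mulrA mulVcard mul1r.
Qed.

(** Centred steps kill the cross terms, so a quadratic function gains the same constant at every
    step. This evaluates the walk exactly on the quadratic jet in [sums]. *)
Lemma iter_step_qf k c (Q : 'M[R]_n) z : iter k step (fun y => c + qf Q y) z =
  c + qf Q z + k%:R * (#|I|%:R^-1 * \sum_i qf Q (sg i)).
Proof.
elim: k z => [|k IH] z /=; first by rewrite mul0r addr0.
have -> : iter k step (fun y => c + qf Q y) =
    (fun y => (c + k%:R * (#|I|%:R^-1 * \sum_i qf Q (sg i))) + qf Q y).
  by apply/funext => y; rewrite IH; ring.
by rewrite step_qf -[k.+1]addn1 natrD; ring.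
Qed.

End Step.

(** Both components are driven by the same index, yet a sum of functions of one component each sees
    only the marginal walks: the coupling stays invisible to the single equations. *)
Lemma iter_step_pair n m (I : finType) (sg : I -> 'rV[R]_(n + m)) k f g z :
  iter k (step sg) (fun y => f (lsubmx y) + g (rsubmx y)) z =
  iter k (step (fun i => lsubmx (sg i))) f (lsubmx z) +
  iter k (step (fun i => rsubmx (sg i))) g (rsubmx z).
Proof.
elim: k z => [|k IH] z //=; rewrite /step -mulrDr -big_split.
by congr (_ * _); apply: eq_bigr => i _; rewrite IH !linearD.
Qed.

End Walk.

(** * Semiconvex smoothing *)

Section Softmax.
Context {R : realType}.

Lemma enorm_sum n (I : finType) (F : I -> 'rV[R]_n) :
  enorm (\sum_i F i) <= \sum_i enorm (F i).
Proof.
apply: (big_ind2 (fun a b => enorm a <= b)) => [|a b c e h1 h2|//].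
  by rewrite enorm0.
exact: le_trans (enormD _ _) (lerD h1 h2).
Qed.

Lemma mean_cst (I : finType) (c : R) : (0 < #|I|)%N ->
  #|I|%:R^-1 * \sum_(i : I) c = c.
Proof.
by move=> I0; rewrite sumr_const -[X in _ * X]mulr_natl mulrA mulVcard // mul1r.
Qed.

Lemma mean_le (I : finType) (F : I -> R) c : (0 < #|I|)%N ->
  (forall i, F i <= c) -> #|I|%:R^-1 * \sum_i F i <= c.
Proof.
move=> I0 Fc; rewrite -[leRHS](mean_cst _ I0).
by rewrite ler_wpM2l ?invr_ge0 // ler_sum.
Qed.

(* [Y z - K I] plays the role of the Hessian of [f] at [z]; with [Y z] monotone for
   traces, [f] is semiconvex. *)
Definition taylor n (K C del : R) (f : 'rV[R]_n -> R) (P : 'rV[R]_n -> 'rV[R]_n)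
    (Y : 'rV[R]_n -> 'M[R]_n) :=
  forall z ze, enorm ze <= del ->
    `|f (z + ze) - (f z + dotv (P z) ze + qf (Y z) ze / 2 - K / 2 * n2 ze)|
      <= C * enorm ze ^+ 3.

(** The bounds are allowed to grow like [K] |z|^2 so that averaging over a centred walk preserves
    them, with only the constants [A] and [D] shifted by the variance. *)
Definition sclass n (K C del A D : R) (f : 'rV[R]_n -> R) :=
  exists P Y, taylor K C del f P Y /\
    (forall z, [/\ tmono (Y z), enorm (P z) <= A + K * n2 z & D - K * n2 z <= f z]).

Definition stepv (V : lmodType R) n (I : finType) (sg : I -> 'rV[R]_n)
    (P : 'rV[R]_n -> V) z : V := #|I|%:R^-1 *: \sum_i P (z + sg i).

(** The expansion is uniform in z, so averaging leaves [K], [C] and [del] unchanged and can be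
    repeated any number of times. *)
Lemma taylor_step n (I : finType) (sg : I -> 'rV[R]_n) K C del f P Y :
  (0 < #|I|)%N -> taylor K C del f P Y ->
  taylor K C del (step sg f) (stepv sg P) (stepv sg Y).
Proof.
move=> I0 tf z ze zed.
have -> : step sg f (z + ze) - (step sg f z + dotv (stepv sg P z) ze +
    qf (stepv sg Y z) ze / 2 - K / 2 * n2 ze) =
  #|I|%:R^-1 * \sum_i (f (z + sg i + ze) - (f (z + sg i) +
    dotv (P (z + sg i)) ze + qf (Y (z + sg i)) ze / 2 - K / 2 * n2 ze)).
  rewrite /step /stepv dotvZl qfZX dotv_suml qf_sumX.
  rewrite -{1}(mean_cst (K / 2 * n2 ze) I0).
  rewrite -mulrA mulr_suml -!mulrDr -mulrBr -mulrBr -!big_split -!sumrB /=.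
  by congr (_ * _); apply: eq_bigr => i _; rewrite [z + ze + _]addrAC.
rewrite normrM ger0_norm ?invr_ge0 //.
apply: (@le_trans _ _ (#|I|%:R^-1 * \sum_(i : I) C * enorm ze ^+ 3)).
  rewrite ler_wpM2l ?invr_ge0 //; apply: (le_trans (ler_norm_sum _ _ _)).
  by apply: ler_sum => i _; exact: tf.
by rewrite mean_cst.
Qed.

Lemma sclass_step n (I : finType) (sg : I -> 'rV[R]_n) K C del A D f :
  (0 < #|I|)%N -> \sum_i sg i = 0 -> sclass K C del A D f ->
  let m := #|I|%:R^-1 * \sum_i n2 (sg i) in
  sclass K C del (A + K * m) (D - K * m) (step sg f).
Proof.
move=> I0 sg0 [P [Y [tf h]]] m.
have mE c a z : step sg (fun y => c + a * n2 y) z = c + a * n2 z + a * m.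
  have := step_qf I0 sg0 c a%:M z; rewrite /step.
  under eq_bigr do rewrite qf_scalar.
  rewrite qf_scalar => ->; congr (_ + _).
  by under eq_bigr do rewrite qf_scalar; rewrite -mulr_sumr mulrCA.
exists (stepv sg P), (stepv sg Y); split=> [|z].
  exact: taylor_step.
split.
- by apply: tmonoZ; rewrite ?invr_ge0 //; apply: tmono_sum => i; case: (h (z + sg i)).
- rewrite /stepv enormZ ger0_norm ?invr_ge0 // addrAC -mE.
  rewrite ler_wpM2l ?invr_ge0 //; apply: (le_trans (enorm_sum _)).
  by apply: ler_sum => i _; case: (h (z + sg i)).
- have -> : D - K * m - K * n2 z = D + - K * n2 z + - K * m by ring.
  rewrite -mE; apply: step_mono => y; rewrite mulNr; by case: (h y).
Qed.

(** The second difference of f at z + sg is computed once by expanding there and once by expanding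
    at z. The cubic errors are 1 + 1 and 8 + 8 + 2 times C |sg|^3, whence 20. *)
Lemma taylor_lip n K C del f P (Y : 'rV[R]_n -> 'M[R]_n) z sg S : 0 <= C ->
  taylor K C del f P Y -> 2 * enorm sg <= del ->
  `|qf (Y (z + sg)) S - qf (Y z) S| <= 20 * C * enorm sg * n2 S.
Proof.
move=> C0 tf sgd.
have [sE|sn0] := eqVneq (enorm sg) 0.
  by move: sE => /enorm0_eq0 ->; rewrite addr0 subrr normr0 enorm0 !(mulr0, mul0r).
have [S0|Sn0] := eqVneq (n2 S) 0.
  by rewrite (n2_eq0 S0) !qf0 subrr normr0 n20 mulr0.
have sgp : 0 < enorm sg by rewrite lt0r sn0 enorm_ge0.
have Sp : 0 < enorm S.
  by rewrite lt0r enorm_ge0 andbT; apply: contra Sn0; rewrite -enorm_sqr => /eqP->;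
    rewrite expr0n.
(* Both sides are quadratic in [S], which is rescaled to the length of the shift so that all cubic
   remainders are comparable. *)
set a := enorm sg / enorm S.
have ap : 0 < a by rewrite divr_gt0.
pose w := a *: S.
have wn : enorm w = enorm sg by rewrite enormZ gtr0_norm // divfK // gt_eqF.
have main : `|qf (Y (z + sg)) w - qf (Y z) w| <= 20 * C * enorm sg ^+ 3.
  set r := enorm sg in wn sgd sgp *.
  have r0 : 0 <= r by rewrite ltW.
  have h1 := tf (z + sg) w ltac:(rewrite wn; lra).
  have h2 := tf (z + sg) (- w) ltac:(rewrite enormN wn; lra).
  have sw : enorm (sg + w) <= 2 * r by have := enormD sg w; rewrite wn -/r; lra.
  have sw' : enorm (sg - w) <= 2 * r by have := enormB sg w; rewrite wn -/r; lra.
  have h3 := tf z (sg + w) ltac:(lra).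
  have h4 := tf z (sg - w) ltac:(lra).
  have h5 := tf z sg ltac:(rewrite -/r; lra).
  have cub x : 0 <= x <= 2 * r -> C * x ^+ 3 <= 8 * C * r ^+ 3.
    move=> /andP[x0 xr]; have -> : 8 * C * r ^+ 3 = C * (2 * r) ^+ 3 by ring.
    by rewrite ler_wpM2l // ler_pXn2r ?nnegrE // mulr_ge0.
  have h3' := le_trans h3 (cub _ (introT andP (conj (enorm_ge0 _) sw))).
  have h4' := le_trans h4 (cub _ (introT andP (conj (enorm_ge0 _) sw'))).
  rewrite enormN in h2; rewrite wn in h1 h2; rewrite -/r in h5.
  rewrite !addrA in h3' h4'.
  move: h1 h2 h3' h4' h5; rewrite !ler_norml !n2N !qfN !dotvNr.
  rewrite !dotvDr !dotvNr !n2D !qfD !n2N !qfN !dotvNr !mulNmx !dotvNl.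
  move=> /andP[a1 b1] /andP[a2 b2] /andP[a3 b3] /andP[a4 b4] /andP[a5 b5].
  clear - a1 b1 a2 b2 a3 b3 a4 b4 a5 b5.
  apply/andP; split; lra.
move: main; rewrite !qfZ -mulrBr normrM ger0_norm ?sqr_ge0 // => main.
rewrite -(ler_pM2l (exprn_gt0 2 ap)); apply: (le_trans main).
rewrite -enorm_sqr /a exprMn exprVn.
rewrite le_eqVlt; apply/orP; left; apply/eqP; field.
by rewrite gt_eqF.
Qed.

Lemma taylor_cont n K C del f P (Y : 'rV[R]_n -> 'M[R]_n) z :
  0 < del -> 0 <= C -> taylor K C del f P Y ->
  forall e : R, 0 < e -> exists2 d : R, 0 < d &
    forall ze, enorm ze <= d -> `|f (z + ze) - f z| <= e.
Proof.
move=> del0 C0 tf e e0.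
pose M := 1 + C + enorm (P z) + enorm (Y z) + `|K|.
have M0 : 0 < M.
  have := enorm_ge0 (P z); have := enorm_ge0 (Y z); have := normr_ge0 K.
  rewrite /M; lra.
exists (Num.min del (Num.min 1 (e / M))).
  by rewrite !lt_min del0 ltr01 divr_gt0.
move=> ze zd; have [d1 d2 d3] := min3_le del 1 (e / M).
set x := enorm ze in zd *.
have x0 : 0 <= x := enorm_ge0 ze.
have x1 : x <= 1 by exact: le_trans d2.
have xM : x * M <= e by rewrite -ler_pdivlMr //; exact: le_trans d3.
have n2x : n2 ze = x ^+ 2 by rewrite -enorm_sqr.
have h := tf z ze (le_trans zd d1).
have h1 := dotv_le (P z) ze; have h2 := qf_le (Y z) ze.
have x2 : x ^+ 2 <= x by rewrite expr2 ler_piMl.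
have x3 : x ^+ 3 <= x by rewrite exprS ler_piMr // exprn_ile1.
move: h h1 h2; rewrite n2x -/x => h h1 h2.
have k1 : C * x ^+ 3 <= C * x by rewrite ler_wpM2l.
have k2 : enorm (Y z) * x ^+ 2 <= enorm (Y z) * x by rewrite ler_wpM2l ?enorm_ge0.
have k3 : `|K / 2 * x ^+ 2| <= `|K| * x.
  rewrite -mulrA normrM ler_wpM2l //.
  have x20 : 0 <= x ^+ 2 by rewrite exprn_ge0.
  rewrite ger0_norm; last by rewrite mulr_ge0.
  by apply: le_trans x2; move: x20; clear; lra.
have k4 : 0 <= enorm (Y z) * x by rewrite mulr_ge0 ?enorm_ge0.
move: xM; rewrite /M !mulrDr mulr1 => xM.
move: h h1 h2 k3 k1 k2 xM x0 k4; clear; rewrite !ler_norml.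
move=> /andP[? ?] /andP[? ?] /andP[? ?] /andP[? ?] ? ? ? ? ?.
by apply/andP; split; lra.
Qed.

Section LogSumExp.
Variables (n : nat) (I : finType) (y : I -> 'rV[R]_n) (a : I -> R) (K rho : R).

(* Smoothing of the sup-convolution max_i (a i - K |z - y i|^2 / 2). *)
Definition softmax (z : 'rV[R]_n) : R :=
  rho * ln (\sum_i expR ((a i - K / 2 * n2 (z - y i)) / rho)).

Lemma softmax_ge i z : 0 < rho -> a i - K / 2 * n2 (z - y i) <= softmax z.
Proof.
move=> rho0; rewrite /softmax [leRHS]mulrC -ler_pdivrMr //.
rewrite -[leLHS]expRK ler_ln ?posrE ?expR_gt0 //.
  by rewrite (bigD1 i) //= lerDl sumr_ge0 // => j _; rewrite expR_ge0.
by rewrite (bigD1 i) //= ltr_pwDl ?expR_gt0 // sumr_ge0 // => j _; rewrite expR_ge0.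
Qed.

Lemma softmax_le z : 0 < rho -> (0 < #|I|)%N -> exists i,
  softmax z <= a i - K / 2 * n2 (z - y i) + rho * ln #|I|%:R.
Proof.
move=> rho0 I0; have [i0 _] := card_gt0P I0.
pose g i := a i - K / 2 * n2 (z - y i).
have [i _ imax] := @arg_maxP _ _ I i0 xpredT g isT.
exists i; rewrite -/(g i) /softmax.
have -> : g i + rho * ln #|I|%:R = rho * (g i / rho + ln #|I|%:R).
  by rewrite mulrDr mulrCA divff ?mulr1 // gt_eqF.
rewrite ler_pM2l // -[X in X + _]expRK -lnM ?posrE ?expR_gt0 ?ltr0n //.
have sp : 0 < \sum_i expR (g i / rho).
  by rewrite (bigD1 i) //= ltr_pwDl ?expR_gt0 // sumr_ge0 // => j _; rewrite expR_ge0.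
rewrite ler_ln ?posrE ?mulr_gt0 ?expR_gt0 ?ltr0n // mulr_natr.
rewrite -sumr_const; apply: ler_sum => j _; rewrite ler_expR.
by rewrite ler_pM2r ?invr_gt0 //; exact: imax.
Qed.

(** With the Gibbs weights [w] and their barycentre [yb], the gradient is K (yb - z) and the Hessian
    is K^2 / rho times the covariance of the [y i], minus K I. A covariance is a sum of outer
    products, hence monotone for traces. *)
Lemma softmax_class (D : R) : (0 < #|I|)%N -> 0 <= K -> 0 < rho ->
  (forall i, enorm (y i) <= 1) -> (forall i, D <= a i) ->
  exists C del : R, [/\ 0 < del, 0 <= C & sclass K C del (2 * K) (D - K) softmax].
Proof.
move=> I0 K0 rho0 y1 aD; have [i0 _] := card_gt0P I0.
pose E i z := (a i - K / 2 * n2 (z - y i)) / rho.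
pose S z := \sum_i expR (E i z).
have S0 z : 0 < S z.
  rewrite /S (bigD1 i0) //= ltr_pwDl ?expR_gt0 //.
  by apply: sumr_ge0 => j _; exact: expR_ge0.
pose w z i := expR (E i z) / S z.
have w0 z i : 0 <= w z i by rewrite divr_ge0 ?expR_ge0 // ltW.
have w1 z : \sum_i w z i = 1.
  by rewrite /w -mulr_suml -/(S z) divff // gt_eqF.
pose yb z := \sum_i w z i *: y i.
have yb1 z : enorm (yb z) <= 1.
  apply: (le_trans (enorm_sum _)); rewrite -(w1 z); apply: ler_sum => i _.
  by rewrite enormZ ger0_norm // ler_piMr.
(* Since |y i - yb| <= 2, the centred exponents are at most [A] |ze|; the radius 1 / (A + 1) keeps
   this below 1, as [lse_taylor] requires. *)
pose A := 2 * K / rho.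
have A0 : 0 <= A by rewrite divr_ge0 ?mulr_ge0 // ltW.
have A1 : 0 < A + 1 by rewrite ltr_wpDl.
exists (25 * rho * A ^+ 3), (A + 1)^-1; split.
- by rewrite invr_gt0.
- by rewrite mulr_ge0 ?exprn_ge0 // mulr_ge0 // ltW.
exists (fun z => K *: (yb z - z)).
exists (fun z => \sum_i (K ^+ 2 / rho * w z i) *: ((y i - yb z)^T *m (y i - yb z))).
split.
- move=> z ze zed.
  pose t i := K / rho * dotv (y i - yb z) ze.
  pose c := K / rho * dotv (yb z - z) ze - K / 2 / rho * n2 ze.
  have EE i : E i (z + ze) = c + (E i z + t i).
    rewrite /E /c /t addrAC n2D !dotvBl; field.
    by rewrite gt_eqF.
  have SE : S (z + ze) = expR c * S z * \sum_i w z i * expR (t i).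
    rewrite {1}/S mulr_sumr; apply: eq_bigr => i _.
    rewrite EE !expRD /w; field.
    by rewrite gt_eqF //; exact: (S0 z).
  have wt : \sum_i w z i * t i = 0.
    transitivity (K / rho * dotv (\sum_i w z i *: (y i - yb z)) ze).
      rewrite dotv_suml mulr_sumr; apply: eq_bigr => i _.
      by rewrite dotvZl mulrCA.
    under eq_bigr do rewrite scalerBr.
    by rewrite sumrB -/(yb z) -scaler_suml w1 scale1r subrr dotv0l mulr0.
  have B01 : 0 <= A * enorm ze <= 1.
    rewrite mulr_ge0 ?enorm_ge0 //=.
    apply: (@le_trans _ _ ((A + 1) * (A + 1)^-1)); last by rewrite divff // gt_eqF.
    by apply: ler_pM; rewrite ?enorm_ge0 // lerDl.
  have tB i : `|t i| <= A * enorm ze.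
    rewrite /t normrM ger0_norm ?divr_ge0 // ?(ltW rho0) //.
    have h1 := dotv_le (y i - yb z) ze.
    have h2 : enorm (y i - yb z) <= 2.
      by have := enormB (y i) (yb z); have := y1 i; have := yb1 z; clear; lra.
    apply: (@le_trans _ _ (K / rho * (2 * enorm ze))).
      rewrite ler_wpM2l ?divr_ge0 // ?(ltW rho0) //.
      by apply: (le_trans h1); rewrite ler_wpM2r ?enorm_ge0.
    by rewrite /A le_eqVlt; apply/orP; left; apply/eqP; ring.
  have := lse_taylor (w0 z) (w1 z) wt B01 tB.
  set L := ln _; set V := \sum_i _ => LV.
  have wp : 0 < \sum_i w z i * expR (t i).
    have := S0 (z + ze); rewrite SE pmulr_rgt0 // mulr_gt0 ?expR_gt0 //.
  have -> : softmax (z + ze) = softmax z + rho * c + rho * L.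
    rewrite /softmax -/(S (z + ze)) -/(S z) SE lnM ?posrE ?mulr_gt0 ?expR_gt0 //.
    by rewrite lnM ?posrE ?expR_gt0 // expRK -/L; ring.
  have -> : qf (\sum_i (K ^+ 2 / rho * w z i) *: ((y i - yb z)^T *m (y i - yb z))) ze
      = rho * V.
    rewrite qf_sumX /V mulr_sumr; apply: eq_bigr => i _.
    rewrite qfZX qf_outer /t; field.
    by rewrite gt_eqF.
  have -> : softmax z + rho * c + rho * L - (softmax z +
      dotv (K *: (yb z - z)) ze + rho * V / 2 - K / 2 * n2 ze) = rho * (L - V / 2).
    rewrite /c dotvZl; field.
    by rewrite gt_eqF.
  rewrite normrM gtr0_norm //.
  have -> : 25 * rho * A ^+ 3 * enorm ze ^+ 3 = rho * (25 * (A * enorm ze) ^+ 3) by ring.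
  by rewrite ler_pM2l.
- move=> z; split.
  + apply: tmono_sum => i; apply: tmonoZ; last exact: tmono_outer.
    by rewrite mulr_ge0 // divr_ge0 ?exprn_ge0 // ltW.
  + rewrite enormZ ger0_norm //.
    have h : enorm (yb z - z) <= 2 + n2 z.
      have h1 := enormB (yb z) z; have h2 := yb1 z.
      have h3 : 0 <= (enorm z - 1) ^+ 2 by rewrite sqr_ge0.
      have -> : n2 z = enorm z ^+ 2 by rewrite enorm_sqr.
      have -> : enorm z ^+ 2 = (enorm z - 1) ^+ 2 + 2 * enorm z - 1 by ring.
      have h4 := enorm_ge0 z.
      by move: h1 h2 h3 h4; clear; lra.
    by apply: (le_trans (ler_wpM2l K0 h)); rewrite mulrDr mulrC.
  + apply: le_trans (softmax_ge i0 z rho0).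
    have h1 := n2D_le z (- y i0); rewrite n2N in h1.
    have h2 : n2 (y i0) <= 1.
      by rewrite -enorm_sqr expr_le1 // enorm_ge0.
    have h3 : n2 (z - y i0) <= 2 * n2 z + 2 by move: h1 h2; clear; lra.
    have h4 : K / 2 * n2 (z - y i0) <= K / 2 * (2 * n2 z + 2).
      by rewrite ler_wpM2l // divr_ge0.
    have h5 : K / 2 * (2 * n2 z + 2) = K * n2 z + K by field.
    by move: h4 h5 (aD i0); clear; lra.
Qed.

End LogSumExp.

End Softmax.

(** * Calculus of superjets *)

Section JetCalculus.
Context {R : realType}.
Variable n : nat.
Implicit Types (g h : R -> 'rV[R]_n -> R) (z p : 'rV[R]_n) (Q : 'M[R]_n).

Lemma uj_add g h t z tau1 tau2 p1 p2 Q1 Q2 :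
  upper_jet g t z tau1 p1 Q1 -> upper_jet h t z tau2 p2 Q2 ->
  upper_jet (fun t z => g t z + h t z) t z (tau1 + tau2) (p1 + p2) (Q1 + Q2).
Proof.
move=> hg hh kap kap0; have k2 : 0 < kap / 2 by rewrite divr_gt0.
have [d1 d10 h1] := hg _ k2; have [d2 d20 h2] := hh _ k2.
exists (Num.min d1 d2) => [|s ze /andP[s1 s2] zd]; first by rewrite lt_min d10.
have [le1 le2] : Num.min d1 d2 <= d1 /\ Num.min d1 d2 <= d2.
  by split; rewrite ge_min lexx ?orbT.
have {}h1 := h1 s ze ltac:(apply/andP; split=> //; move: s1 le1; clear; lra)
  (le_trans zd le1).
have {}h2 := h2 s ze ltac:(apply/andP; split=> //; move: s1 le2; clear; lra)
  (le_trans zd le2).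
rewrite dotvDl qfDX; move: h1 h2; clear; lra.
Qed.

Lemma uj_scale a g t z tau p Q : 0 <= a -> upper_jet g t z tau p Q ->
  upper_jet (fun t z => a * g t z) t z (a * tau) (a *: p) (a *: Q).
Proof.
move=> a0 hg kap kap0.
have a1 : 0 < 1 + a by rewrite ltr_pwDl.
have [d d0 h] := hg (kap / (1 + a)) (divr_gt0 kap0 a1).
exists d => // s ze sI zd; have {}h := ler_wpM2l a0 (h s ze sI zd).
rewrite dotvZl qfZX; apply: (le_trans h).
have E : 0 <= n2 ze - s by rewrite subr_ge0 (le_trans _ (n2_ge0 ze)); case/andP: sI.
have : a * (kap / (1 + a) * (n2 ze - s)) <= kap * (n2 ze - s).
  rewrite mulrA ler_wpM2r // mulrCA ger_pMr // ler_pdivrMr // mul1r.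
  by rewrite lerDr.
clear; move=> ?; lra.
Qed.

Lemma uj_touch (d : R) g h t z tau p Q : 0 < d ->
  (forall s ze, - d <= s <= 0 -> enorm ze <= d ->
    g (t + s) (z + ze) - g t z <= h (t + s) (z + ze) - h t z) ->
  upper_jet h t z tau p Q -> upper_jet g t z tau p Q.
Proof.
move=> d0 gh hh kap kap0; have [e e0 he] := hh kap kap0.
exists (Num.min d e) => [|s ze /andP[s1 s2] zd]; first by rewrite lt_min d0.
have [le1 le2] : Num.min d e <= d /\ Num.min d e <= e.
  by split; rewrite ge_min lexx ?orbT.
have {}gh := gh s ze ltac:(apply/andP; split=> //; move: s1 le1; clear; lra)
  (le_trans zd le1).
have {}he := he s ze ltac:(apply/andP; split=> //; move: s1 le2; clear; lra)
  (le_trans zd le2).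
move: gh he; clear; lra.
Qed.

Lemma uj_eq g t z tau tau' p p' Q Q' : upper_jet g t z tau p Q ->
  tau = tau' -> p = p' -> Q = Q' -> upper_jet g t z tau' p' Q'.
Proof. by move=> ? <- <- <-. Qed.

Lemma uj_taylor K C del f P (Y : 'rV[R]_n -> 'M[R]_n) t z :
  0 < del -> 0 <= C -> taylor K C del f P Y ->
  upper_jet (fun _ => f) t z 0 (P z) (Y z - K%:M).
Proof.
move=> del0 C0 tf kap kap0.
have C1 : 0 < 1 + C by rewrite ltr_pwDl.
exists (Num.min del (kap / (1 + C))) => [|s ze /andP[_ s0] zd].
  by rewrite lt_min del0 divr_gt0.
have zd1 : enorm ze <= del by apply: (le_trans zd); rewrite ge_min lexx.
have zd2 : enorm ze * (1 + C) <= kap.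
  by rewrite -ler_pdivlMr //; apply: (le_trans zd); rewrite ge_min lexx orbT.
have := tf z ze zd1; rewrite ler_norml => /andP[_ h].
rewrite qfDX qfNX qf_scalar.
have e0 := enorm_ge0 ze.
have h3 : C * enorm ze ^+ 3 <= kap * n2 ze.
  rewrite -enorm_sqr exprS mulrA ler_wpM2r ?exprn_ge0 //.
  by apply: le_trans zd2; rewrite mulrDr mulr1 mulrC lerDr.
have h4 : 0 <= - (kap * s) by rewrite -mulrN mulr_ge0 ?oppr_ge0 // ltW.
move: h h3 h4; clear; lra.
Qed.

(** The factor s - t vanishes at the base time, so the variation of f enters only multiplied by s -
    t: continuity of f suffices. *)
Lemma uj_tlin (f : 'rV[R]_n -> R) t z :
  (forall e : R, 0 < e -> exists2 d : R, 0 < d &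
    forall ze, enorm ze <= d -> `|f (z + ze) - f z| <= e) ->
  upper_jet (fun s y => (s - t) * f y) t z (f z) 0 0.
Proof.
move=> cf kap kap0; have [d d0 h] := cf kap kap0; exists d => // s ze /andP[_ s0] zd.
rewrite subrr mul0r dotv0l qf0X addrAC subrr add0r.
have := h ze zd; rewrite ler_norml => /andP[h1 _].
have h2 : 0 <= kap * n2 ze by rewrite mulr_ge0 ?n2_ge0 // ltW.
have h3 : s * f (z + ze) <= s * f z - s * kap.
  rewrite -mulrBr ler_wnM2l //; move: h1; clear; lra.
move: h2 h3; clear; lra.
Qed.

(** The square is expanded around q = |z|^2 + c t. The terms outside the jet all contain a factor
    |ze|^2 + c s, at most (1 + c) (|ze|^2 - s) in absolute value, times a small quantity. *)
Lemma uj_barrier (c : R) t z : 0 <= c -> 0 <= t ->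
  upper_jet (fun s y => (n2 y + c * s) ^+ 2) t z (2 * (n2 z + c * t) * c)
    ((4 * (n2 z + c * t)) *: z) ((4 * (n2 z + c * t))%:M + 8 *: (z^T *m z)).
Proof.
move=> c0 t0 kap kap0.
set q := n2 z + c * t.
pose M := 4 * enorm z * (1 + c) + 2 * (1 + c) ^+ 2 + 1.
have z0 := enorm_ge0 z.
have M1 : 0 < M.
  by rewrite /M ltr_wpDl // addr_ge0 // ?mulr_ge0 ?exprn_ge0 //; move: c0; clear; lra.
exists (Num.min 1 (kap / M)) => [|s ze /andP[s1 s0] zd].
  by rewrite lt_min ltr01 divr_gt0.
set m := Num.min 1 (kap / M) in zd s1.
have [m1 m2] : m <= 1 /\ m <= kap / M by split; rewrite /m ge_min lexx ?orbT.
set e := enorm ze in zd; have e0 : 0 <= e := enorm_ge0 ze.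
have n2e : n2 ze = e ^+ 2 by rewrite -enorm_sqr.
pose w := e ^+ 2 - s.
have ee : 0 <= e ^+ 2 by rewrite exprn_ge0.
have w0 : 0 <= w by rewrite /w; move: s0 ee; clear; lra.
have em : e ^+ 2 <= m.
  apply: (@le_trans _ _ e) => //; rewrite expr2 ler_piMl //; exact: le_trans m1.
have wm : w <= 2 * m by rewrite /w; move: em s1; clear; lra.
have r1 : `|e ^+ 2 + c * s| <= (1 + c) * w.
  have cs : c * s <= 0 by rewrite mulr_ge0_le0.
  have ce : 0 <= c * e ^+ 2 by rewrite mulr_ge0.
  by rewrite /w ler_norml; move: cs ce ee s0; clear => ? ? ? ?; apply/andP; split; lra.
have r2 : `|dotv z ze| <= enorm z * e by exact: dotv_le.
have mM : m * M <= kap by rewrite -ler_pdivlMr.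
have hprod : `|4 * dotv z ze * (e ^+ 2 + c * s)| <= 4 * (enorm z * m) * ((1 + c) * w).
  rewrite normrM normrM (ger0_norm (ler0n _ 4)).
  apply: ler_pM => //; rewrite ler_pM2l //.
  by apply: (le_trans r2); rewrite ler_wpM2l.
have hsq : (e ^+ 2 + c * s) ^+ 2 <= (1 + c) ^+ 2 * (2 * m * w).
  rewrite -real_normK ?num_real //.
  apply: (@le_trans _ _ (((1 + c) * w) ^+ 2)).
    rewrite ler_pXn2r ?nnegrE //; rewrite mulr_ge0 //; move: c0; clear; lra.
  by rewrite exprMn ler_wpM2l ?sqr_ge0 // expr2 ler_wpM2r.
have key : 4 * dotv z ze * (e ^+ 2 + c * s) + (e ^+ 2 + c * s) ^+ 2 <= kap * w.
  have h1 := le_trans (ler_norm _) hprod.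
  have h2 : m * M * w <= kap * w by rewrite ler_wpM2r.
  have h3 : 0 <= m * w.
    by rewrite mulr_ge0 // ltW // lt_min ltr01 divr_gt0.
  move: h1 hsq h2 h3; rewrite /M; clear => h1 h2 h3 h4; lra.
rewrite n2D n2e qfDX qf_scalar qfZX qf_outer dotvZl n2e -/w.
have -> : n2 z + 2 * dotv z ze + e ^+ 2 + c * (t + s) =
  q + (2 * dotv z ze + (e ^+ 2 + c * s)) by rewrite /q; ring.
move: key; set dd := dotv z ze; clearbody q dd w.
clear; move=> key; have -> : (q + (2 * dd + (e ^+ 2 + c * s))) ^+ 2 =
  q ^+ 2 + 2 * q * c * s + 4 * q * dd + (4 * q * e ^+ 2 + 8 * dd ^+ 2) / 2
  + (4 * dd * (e ^+ 2 + c * s) + (e ^+ 2 + c * s) ^+ 2) by field.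
by rewrite lerD2l.
Qed.

Lemma uj_time (T : R -> R) t z tau :
  (forall kap : R, 0 < kap -> exists2 d : R, 0 < d & forall s : R, - d <= s <= 0 ->
    T (t + s) <= T t + tau * s - kap * s) ->
  upper_jet (fun t _ => T t) t z tau 0 0.
Proof.
move=> hT kap kap0; have [d d0 h] := hT kap kap0; exists d => // s ze sI _.
rewrite dotv0l qf0X; have := h s sI.
have : 0 <= kap * n2 ze by rewrite mulr_ge0 ?n2_ge0 // ltW.
clear; lra.
Qed.

End JetCalculus.

Lemma uj_pull (R : realType) m n (M : 'M[R]_(m, n)) (g : R -> 'rV[R]_n -> R) t z
    tau p Q : upper_jet g t (z *m M) tau p Q ->
  upper_jet (fun t z => g t (z *m M)) t z tau (p *m M^T) (M *m Q *m M^T).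
Proof.
move=> hg kap kap0; have e0 := enorm_ge0 M.
have M1 : 0 < 1 + enorm M by rewrite ltr_pwDl.
have M2 : 0 < 1 + enorm M ^+ 2 by rewrite ltr_pwDl // exprn_ge0.
have [d d0 h] := hg (kap / (1 + enorm M ^+ 2)) (divr_gt0 kap0 M2).
exists (Num.min d (d / (1 + enorm M))) => [|s ze /andP[s1 s0] zd].
  by rewrite lt_min d0 divr_gt0.
have sI : - d <= s <= 0.
  rewrite s0 andbT; apply: le_trans s1; rewrite lerN2 ge_min lexx //.
have zM : enorm (ze *m M) <= d.
  apply: (le_trans (enorm_mul_le _ _)).
  have zd2 : enorm ze <= d / (1 + enorm M).
    by apply: (le_trans zd); rewrite ge_min lexx orbT.
  move: zd2; rewrite ler_pdivlMr //; apply: le_trans.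
  by rewrite mulrDr mulr1 mulrC lerDr enorm_ge0.
rewrite mulmxDl qf_mul; apply: (le_trans (h s _ sI zM)).
rewrite dotvC dotv_mulr [dotv ze _]dotvC lerD2l.
rewrite -mulrA ler_wpM2l ?(ltW kap0) // mulrC ler_pdivrMr //.
have h1 := n2_mul_le ze M; have h2 := n2_ge0 ze.
have h3 : 0 <= enorm M ^+ 2 * - s by rewrite mulr_ge0 ?exprn_ge0 ?oppr_ge0.
have h4 : 0 <= enorm M ^+ 2 * n2 ze by rewrite mulr_ge0 ?exprn_ge0.
rewrite mulrBl !mulrDr !mulr1; move: h1 h2 h3 h4; clear; lra.
Qed.

(** * Doubling of variables *)

Section Walks.
Context {R : realType}.

Lemma uj_shift n (h : R -> 'rV[R]_n -> R) (a t : R) z tau p Q :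
  upper_jet h (t + a) z tau p Q -> upper_jet (fun t z => h (t + a) z) t z tau p Q.
Proof.
move=> hh kap kap0; have [d d0 H] := hh kap kap0; exists d => // s ze sI zd.
by rewrite addrAC; exact: H.
Qed.

(** A step draws an index and a sign uniformly: it is centred, and its covariance is eta^2 / #|J|
    times the sum of the (S j)^T (S j). *)
Definition pm n (J : finType) (S : J -> 'rV[R]_n) (eta : R) (i : J * bool) : 'rV[R]_n :=
  (if i.2 then eta else - eta) *: S i.1.

Lemma pm_sum (V : nmodType) n (J : finType) (S : J -> 'rV[R]_n) eta (F : 'rV[R]_n -> V) :
  \sum_i F (pm S eta i) = \sum_j (F (eta *: S j) + F (- eta *: S j)).
Proof.
rewrite -(pair_big xpredT xpredT (fun j b => F (pm S eta (j, b)))) /=.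
by apply: eq_bigr => j _; rewrite big_bool.
Qed.

Lemma pm_sum0 n (J : finType) (S : J -> 'rV[R]_n) eta : \sum_i pm S eta i = 0.
Proof.
rewrite (pm_sum S eta id) big1 // => j _.
by rewrite -scalerDl subrr scale0r.
Qed.

Lemma card_pm (J : finType) : (#|{: J * bool}| = #|J| * 2)%N.
Proof. by rewrite card_prod card_bool. Qed.

Lemma pm_mean_qf n (J : finType) (S : J -> 'rV[R]_n) eta Q : (0 < #|J|)%N ->
  #|{: J * bool}|%:R^-1 * \sum_i qf Q (pm S eta i) =
  eta ^+ 2 / #|J|%:R * \sum_j qf Q (S j).
Proof.
move=> J0; rewrite (pm_sum S eta (qf Q)) card_pm natrM.
have -> : \sum_j (qf Q (eta *: S j) + qf Q (- eta *: S j)) =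
    2 * eta ^+ 2 * \sum_j qf Q (S j).
  by rewrite mulr_sumr; apply: eq_bigr => j _; rewrite scaleNr qfN qfZ; ring.
by field; rewrite pnatr_eq0 -lt0n.
Qed.

Lemma pm_enorm n (J : finType) (S : J -> 'rV[R]_n) eta i : 0 <= eta ->
  enorm (pm S eta i) = eta * enorm (S i.1).
Proof.
by move=> e0; rewrite enormZ; case: i.2; rewrite ?normrN ger0_norm.
Qed.

Lemma enorm_le_sum n (J : finType) (S : J -> 'rV[R]_n) j :
  enorm (S j) <= \sum_i enorm (S i).
Proof. by rewrite (bigD1 j) //= lerDl sumr_ge0 // => i _; exact: enorm_ge0. Qed.

Lemma walk_gain n (J : finType) (S : J -> 'rV[R]_n) (eta K C del : R) f P
    (Y : 'rV[R]_n -> 'M[R]_n) z :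
  (0 < #|J|)%N -> 0 <= eta -> 0 <= C -> taylor K C del f P Y ->
  eta * \sum_j enorm (S j) <= del ->
  eta ^+ 2 / #|J|%:R / 2 * (\sum_j qf (Y z - K%:M) (S j)
     - 2 * C * eta * (\sum_j enorm (S j)) * \sum_j n2 (S j))
  <= step (pm S eta) f z - f z.
Proof.
move=> J0 eta0 C0 tf sd; set sb := \sum_j enorm (S j) in sd *.
set Lam := \sum_j n2 (S j).
have I0 : (0 < #|{: J * bool}|)%N by rewrite card_pm muln_gt0 J0.
have inv0 : 0 <= #|{: J * bool}|%:R^-1 :> R by rewrite invr_ge0.
rewrite -{1}(mean_cst (f z) I0) /step -mulrBr -sumrB.
apply: (@le_trans _ _ (#|{: J * bool}|%:R^-1 * \sum_i (dotv (P z) (pm S eta i) +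
   (qf (Y z - K%:M) (pm S eta i)) / 2 - C * (eta ^+ 3 * (sb * n2 (S i.1)))))).
  rewrite big_split /= big_split /=.
  have -> : \sum_i dotv (P z) (pm S eta i) = 0.
    by under eq_bigr do rewrite dotvC; rewrite -dotv_suml pm_sum0 dotv0l.
  have -> : \sum_i qf (Y z - K%:M) (pm S eta i) / 2 =
      (\sum_i qf (Y z - K%:M) (pm S eta i)) / 2 by rewrite mulr_suml.
  rewrite add0r [leRHS]mulrDr [X in _ <= X + _]mulrA pm_mean_qf // sumrN mulrN.
  have -> : \sum_(i : J * bool) C * (eta ^+ 3 * (sb * n2 (S i.1))) =
      2 * C * eta ^+ 3 * sb * Lam.
    rewrite -(pair_big xpredT xpredT (fun (j : J) (b : bool) =>
      C * (eta ^+ 3 * (sb * n2 (S j))))) /= mulr_sumr.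
    by apply: eq_bigr => j _; rewrite big_bool /=; ring.
  rewrite card_pm natrM le_eqVlt; apply/orP; left; apply/eqP; field.
  by rewrite pnatr_eq0 -lt0n.
rewrite ler_wpM2l //; apply: ler_sum => i _.
have en := pm_enorm S i eta0.
have le1 : enorm (S i.1) <= sb by exact: enorm_le_sum.
have h0 : enorm (pm S eta i) <= del.
  by rewrite en; apply: le_trans sd; rewrite ler_wpM2l.
have := tf z _ h0; rewrite ler_norml en => /andP[h _].
rewrite qfDX qfNX qf_scalar.
have h2 : C * (eta * enorm (S i.1)) ^+ 3 <= C * (eta ^+ 3 * (sb * n2 (S i.1))).
  rewrite ler_wpM2l // exprMn ler_wpM2l ?exprn_ge0 // exprS enorm_sqr.
  by rewrite ler_wpM2r ?n2_ge0.
move: h h2; clear; lra.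
Qed.

(** Each shifted Hessian is close to the one at z by [taylor_lip]. At a contact point in [mv_step],
    where f and its mean both contribute, everything is thus compared with the Hessian of f
    alone. *)
Lemma walk_mix n (J : finType) (S : J -> 'rV[R]_n) (eta K C del : R) f P
    (Y : 'rV[R]_n -> 'M[R]_n) z v :
  (0 < #|J|)%N -> 0 <= eta -> 0 <= C -> taylor K C del f P Y ->
  2 * (eta * \sum_j enorm (S j)) <= del ->
  qf (stepv (pm S eta) Y z) v <=
    qf (Y z) v + 20 * C * (eta * \sum_j enorm (S j)) * n2 v.
Proof.
move=> J0 eta0 C0 tf sd; set sb := \sum_j enorm (S j) in sd *.
have I0 : (0 < #|{: J * bool}|)%N by rewrite card_pm muln_gt0 J0.
rewrite /stepv qfZX qf_sumX; apply: mean_le => // i.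
have le1 : enorm (pm S eta i) <= eta * sb.
  by rewrite pm_enorm // ler_wpM2l //; exact: enorm_le_sum.
have h1 : 2 * enorm (pm S eta i) <= del by apply: le_trans sd; rewrite ler_pM2l.
have := taylor_lip z v C0 tf h1; rewrite ler_norml => /andP[_ h].
have h2 : 20 * C * enorm (pm S eta i) * n2 v <= 20 * C * (eta * sb) * n2 v.
  by rewrite ler_wpM2r ?n2_ge0 // ler_wpM2l // mulr_ge0.
move: h h2; clear; lra.
Qed.

(* The inequality d_t U <= sum_j D^2 U (S j, S j), tested only with Hessians bounded
   below by -K: the error [om L (1 + K)] accounts for the variation of the
   coefficients around the point where they are frozen. *)
Definition hj n (J : finType) (S : J -> 'rV[R]_n) (L om r : R)
    (U : R -> 'rV[R]_n -> R) :=
  forall sg z, - r <= sg <= 0 -> enorm z <= r -> forall tau p Y K,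
    0 <= K -> tmono Y -> upper_jet U sg z tau p (Y - K%:M) ->
    tau <= (1 + om) * (\sum_j qf (Y - K%:M) (S j)) + om * L * (1 + K + enorm p).

Lemma cont_on_space n (A : set (R * 'rV[R]_n)) (f : 'rV[R]_n -> R) :
  (forall z (e : R), 0 < e -> exists2 d : R, 0 < d &
    forall ze, enorm ze <= d -> `|f (z + ze) - f z| <= e) ->
  cont_on A (fun _ => f).
Proof.
move=> cf; apply/cont_onP => t z _ e e0; have [d d0 h] := cf z e e0.
exists d => // t' z' _ _ zd.
by have := h (z' - z) zd; rewrite [z + _]addrC subrK.
Qed.

(* Comparison of U with the linear interpolation in time between [f] and its mean
   [g] over the walk, of time step [th]; the quartic term keeps the maximum inside
   the ball. *)
Lemma mv_step n (J : finType) (S : J -> 'rV[R]_n) (U : R -> 'rV[R]_n -> R)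
    (L om r K G D B E c eta sg0 s0 C del Lam sb th : R) f P Y g :
  Lam = \sum_j n2 (S j) -> sb = \sum_j enorm (S j) ->
  th = eta ^+ 2 / (2 * #|J|%:R * (1 + om)) -> g = step (pm S eta) f ->
  c = 12 * Lam + 2 -> E = om * L * (1 + K + G) + 2 * om ->
  (0 < #|J|)%N -> 0 < om <= 1 -> om * L <= 1 -> 0 <= L -> 0 < r <= 1 -> 0 <= K ->
  0 <= G -> 0 <= B -> 0 <= s0 -> 0 < eta -> 0 < del -> 0 <= C ->
  hj S L om r U -> - r <= sg0 -> sg0 + th <= 0 ->
  cont_on (cyl (- r) 0 0 r) U ->
  taylor K C del f P Y -> (forall z, tmono (Y z)) ->
  (forall z, enorm z <= r -> enorm (P z) <= G /\ enorm (stepv (pm S eta) P z) <= G) ->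
  (forall z, enorm z <= r -> D <= f z /\ D <= g z) ->
  (forall sg z, - r <= sg <= 0 -> enorm z = r -> U sg z < D + B * r ^+ 4) ->
  2 * (eta * sb) <= del -> 44 * C * eta * sb * Lam <= om ->
  (forall z, enorm z <= r -> U sg0 z <= f z + B * (n2 z + c * s0) ^+ 2 + E * s0) ->
  forall z, enorm z <= r ->
    U (sg0 + th) z <= g z + B * (n2 z + c * (s0 + th)) ^+ 2 + E * (s0 + th).
Proof.
move=> LamE sbE thE gE cE EE J0 /andP[om0 om1] omL L0 /andP[r0 r1] K0 G0 B0 s00 eta0
  del0 C0 HJ sgr sgth cU tf tY PG Dfg lat sbd Cd start z1 z1r.
rewrite leNgt; apply/negP => bad.
have Jp : 0 < #|J|%:R :> R by rewrite ltr0n.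
have th0 : 0 < th by rewrite thE divr_gt0 ?exprn_gt0 // !mulr_gt0 // addr_gt0.
have I0 : (0 < #|{: J * bool}|)%N by rewrite card_pm muln_gt0 J0.
have tg : taylor K C del g (stepv (pm S eta) P) (stepv (pm S eta) Y).
  by rewrite gE; exact: taylor_step.
have cf z := taylor_cont z del0 C0 tf.
have cg z := taylor_cont z del0 C0 tg.
have Lam0 : 0 <= Lam by rewrite LamE sumr_ge0 // => j _; exact: n2_ge0.
have c0 : 0 <= c by rewrite cE; move: Lam0; clear; lra.
have E0 : 0 <= E.
  rewrite EE addr_ge0 // ?mulr_ge0 ?(ltW om0) //; move: K0 G0; clear; lra.
pose Phi t y := f y + th^-1 * ((t - sg0) * (g y - f y)) +
  B * (n2 y + c * (t + (s0 - sg0))) ^+ 2 + E * (t + (s0 - sg0)).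
have cPhi (A : set (R * 'rV[R]_n)) : cont_on A Phi.
  have ct (a : R) : cont_on A (fun t _ => t + a).
    apply: cont_on_cts => p; apply: cvgD; [exact: cvg_fst|exact: cvg_cst].
  have cn : cont_on A (fun _ y => n2 y).
    apply: cont_on_cts => p.
    have := @continuous_comp _ _ _ snd (fun y : 'rV[R]_n => n2 y) p.
    apply; first exact: cvg_snd.
    have := @continuous_n2 _ n 0 p.2.
    by under [X in continuous_at _ X]eq_fun do rewrite subr0.
  have cq : cont_on A (fun t y => n2 y + c * (t + (s0 - sg0))).
    by apply: cont_onD => //; apply: cont_onM => //; exact: cont_on_cst.
  apply: cont_onD; last by apply: cont_onM => //; exact: cont_on_cst.
  apply: cont_onD; last first.
    by apply: cont_onM; [exact: cont_on_cst|exact: (cont_onM cq cq)].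
  apply: cont_onD; first exact: cont_on_space.
  apply: cont_onM; first exact: cont_on_cst.
  by apply: cont_onM => //; apply: cont_onB; exact: cont_on_space.
have sub : cyl sg0 (sg0 + th) 0 r `<=` cyl (- r) 0 (0 : 'rV[R]_n) r.
  move=> [t y] [/= /andP[a1 a2] a3]; split=> //=; apply/andP; split.
    exact: le_trans a1.
  exact: le_trans a2 sgth.
have cD : cont_on (cyl sg0 (sg0 + th) 0 r) (fun t y => U t y - Phi t y).
  by apply: cont_onB; [exact: cont_onW sub cU|exact: cPhi].
have [ts [zs [[/= tsI zsr] hmax]]] := cyl_max (ler_wpDr (ltW th0) (lexx sg0)) (ltW r0) cD.
rewrite subr0 in zsr.
have thE' : sg0 + th + (s0 - sg0) = s0 + th by ring.
have valp : 0 < U ts zs - Phi ts zs.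
  have := hmax (sg0 + th) z1; rewrite /cyl /= subr0 lexx lerDl (ltW th0).
  move=> /(_ (conj isT z1r)); apply: lt_le_trans.
  rewrite /Phi thE' [sg0 + th]addrC addrK mulrA mulVf ?gt_eqF // mul1r.
  move: bad; rewrite [th + sg0]addrC; clear; lra.
have /andP[ts1 ts2] := tsI.
pose mu := (ts - sg0) / th.
have mu0 : 0 <= mu by rewrite divr_ge0 ?subr_ge0 // ltW.
have mu1 : mu <= 1 by rewrite ler_pdivrMr // mul1r lerBlDl.
(* The interpolation is recentred at the contact time, so that its linear part in time is covered by
   [uj_tlin]. *)
have PhiE t y : Phi t y = (1 - mu) * f y + mu * g y
    + th^-1 * ((t - ts) * (g y - f y))
    + B * (n2 y + c * (t + (s0 - sg0))) ^+ 2 + E * (t + (s0 - sg0)).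
  rewrite /Phi /mu; field.
  by rewrite gt_eqF.
have ss0 : 0 <= ts + (s0 - sg0) by move: ts1 s00; clear; lra.
have tslt : sg0 < ts.
  rewrite lt_neqAle ts1 andbT; apply/eqP => tsE.
  have := start zs zsr; move: valp; rewrite /Phi -tsE subrr mul0r mulr0 addr0.
  by rewrite addrCA subrr addr0; clear; lra.
have tsr : - r <= ts <= 0.
  by apply/andP; split; [exact: le_trans sgr ts1|exact: le_trans ts2 sgth].
have zslt : enorm zs < r.
  rewrite lt_neqAle zsr andbT; apply/eqP => zsE.
  have := lat ts zs tsr zsE; have [Df Dg] := Dfg zs zsr.
  move: valp; rewrite PhiE subrr mul0r mulr0 addr0.
  set q := n2 zs + c * (ts + (s0 - sg0)).
  have q1 : r ^+ 2 <= q.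
    by rewrite /q -zsE enorm_sqr lerDl mulr_ge0.
  have q2 : B * r ^+ 4 <= B * q ^+ 2.
    rewrite ler_wpM2l // (_ : r ^+ 4 = (r ^+ 2) ^+ 2); last by rewrite -exprM.
    by rewrite ler_pXn2r ?nnegrE ?sqr_ge0 // (le_trans _ q1) // sqr_ge0.
  have q3 : 0 <= E * (ts + (s0 - sg0)) by rewrite mulr_ge0.
  have q4 : (1 - mu) * D <= (1 - mu) * f zs by rewrite ler_wpM2l // subr_ge0.
  have q5 : mu * D <= mu * g zs by rewrite ler_wpM2l.
  move: q2 q3 q4 q5; clear; lra.
set q := n2 zs + c * (ts + (s0 - sg0)).
have q0 : 0 <= q by rewrite /q addr_ge0 ?n2_ge0 ?mulr_ge0.
have cgf : forall e : R, 0 < e -> exists2 d : R, 0 < d &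
    forall ze, enorm ze <= d -> `|(g (zs + ze) - f (zs + ze)) - (g zs - f zs)| <= e.
  move=> e e0; have [|d1 d10 h1] := cf zs (e / 2); first by rewrite divr_gt0.
  have [|d2 d20 h2] := cg zs (e / 2); first by rewrite divr_gt0.
  exists (Num.min d1 d2) => [|ze zd]; first by rewrite lt_min d10.
  have {}h1 := h1 ze ltac:(by apply: (le_trans zd); rewrite ge_min lexx).
  have {}h2 := h2 ze ltac:(by apply: (le_trans zd); rewrite ge_min lexx orbT).
  move: h1 h2; clear; rewrite !ler_norml => /andP[? ?] /andP[? ?].
  by apply/andP; split; lra.
pose Pm := (1 - mu) *: P zs + mu *: stepv (pm S eta) P zs.
pose Ym := (1 - mu) *: Y zs + mu *: stepv (pm S eta) Y zs.
have mu1' : 0 <= 1 - mu by rewrite subr_ge0.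
have jet : upper_jet U ts zs (th^-1 * (g zs - f zs) + B * (2 * q * c) + E)
    (Pm + B *: ((4 * q) *: zs))
    ((Ym + B *: ((4 * q)%:M + 8 *: (zs^T *m zs))) - K%:M).
  pose d := Num.min (ts - sg0) (r - enorm zs).
  have d0 : 0 < d by rewrite lt_min !subr_gt0 tslt.
  have [d1 d2] : d <= ts - sg0 /\ d <= r - enorm zs.
    by split; rewrite /d ge_min lexx ?orbT.
  apply: (@uj_touch _ _ d _ Phi) => //.
    move=> s ze /andP[sd1 sd2] zd.
    have : cyl sg0 (sg0 + th) 0 r (ts + s, zs + ze).
      split; rewrite /= ?subr0.
        by apply/andP; split; move: sd1 sd2 d1 ts2; clear; lra.
      by have := enormD zs ze; move: zd d2; clear; lra.
    by move=> /hmax; clear; lra.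
  have -> : Phi = (fun t y => (1 - mu) * f y + mu * g y
    + th^-1 * ((t - ts) * (g y - f y))
    + B * (n2 y + c * (t + (s0 - sg0))) ^+ 2 + E * (t + (s0 - sg0))).
    by apply/funext => t; apply/funext => y; exact: PhiE.
  apply: uj_eq.
  - apply: uj_add; last first.
      apply: (@uj_time _ _ _ _ _ E) => kap kap0; exists 1 => // s /andP[_ sn].
      have : 0 <= - (kap * s) by rewrite -mulrN mulr_ge0 ?oppr_ge0 // ltW.
      clear; lra.
    apply: uj_add; last first.
      apply: (uj_scale B0).
      exact: (uj_shift (uj_barrier zs c0 ss0)).
    apply: uj_add; last first.
      apply: uj_scale; first by rewrite invr_ge0 ltW.
      exact: uj_tlin cgf.
    apply: uj_add.
      apply: (uj_scale mu1'); exact: uj_taylor del0 C0 tf.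
    apply: (uj_scale mu0); exact: uj_taylor del0 C0 tg.
  - by rewrite -/q !mulr0 !add0r.
  - by rewrite -/q scaler0 !addr0.
  - rewrite -/q scaler0 !addr0 /Ym; apply/matrixP => i j; rewrite !mxE; ring.
have tYm : tmono (Ym + B *: ((4 * q)%:M + 8 *: (zs^T *m zs))).
  apply: tmonoD; last first.
    apply: tmonoZ => //; apply: tmonoD; first by apply: tmono_scalar; rewrite mulr_ge0.
    by apply: tmonoZ => //; exact: tmono_outer.
  apply: tmonoD; apply: tmonoZ => //.
  by rewrite /stepv; apply: tmonoZ; rewrite ?invr_ge0 //; apply: tmono_sum.
have := HJ ts zs tsr zsr _ _ _ _ K0 tYm jet.
set p := Pm + _; set X := _ - K%:M; move=> hjet.
have pG : enorm p <= G + 4 * B * q.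
  rewrite /p; apply: (le_trans (enormD _ _)); apply: lerD.
    rewrite /Pm; apply: (le_trans (enormD _ _)).
    rewrite (enormZ (1 - mu)) (enormZ mu) !ger0_norm //; have [p1 p2] := PG zs zsr.
    have -> : G = (1 - mu) * G + mu * G by ring.
    by apply: lerD; apply: ler_wpM2l.
  rewrite !enormZ !ger0_norm // ?mulr_ge0 // mulrA [4 * B]mulrC -mulrA.
  by rewrite -[leRHS]mulr1 -!mulrA !ler_wpM2l // ltW // (lt_le_trans zslt).
have SX : \sum_j qf X (S j) <= \sum_j qf (Y zs - K%:M) (S j)
    + 20 * C * (eta * sb) * Lam + 12 * B * q * Lam.
  rewrite LamE !mulr_sumr -!big_split /=; apply: ler_sum => j _.
  have hm := @walk_mix _ _ S _ _ _ _ _ _ _ zs (S j) J0 (ltW eta0) C0 tf; rewrite -sbE in hm.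
  have {}hm := ler_wpM2l mu0 (hm sbd); move: hm.
  rewrite /X /Ym; move: (stepv _ Y zs) => Y1 hm.
  rewrite !(qfDX, qfNX, qfZX, qf_scalar, qf_outer).
  have h1 : dotv zs (S j) ^+ 2 <= q * n2 (S j).
    apply: (le_trans (dotv_sqr_le _ _)); rewrite ler_wpM2r ?n2_ge0 //.
    by rewrite /q lerDl mulr_ge0.
  have {}h1 := ler_wpM2l B0 h1.
  have h2 : mu * (20 * C * (eta * sb) * n2 (S j)) <= 20 * C * (eta * sb) * n2 (S j).
    apply: ler_piMl mu1; rewrite !mulr_ge0 ?n2_ge0 //; first exact: ltW.
    by rewrite sbE sumr_ge0 // => i _; exact: enorm_ge0.
  move: hm h1 h2; clear; lra.
have gain := @walk_gain _ _ S _ _ _ _ _ _ _ zs J0 (ltW eta0) C0 tf.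
rewrite -sbE -LamE -gE in gain.
have sb0 : 0 <= sb by rewrite sbE sumr_ge0 // => i _; exact: enorm_ge0.
have {}gain := gain ltac:(move: sbd (mulr_ge0 (ltW eta0) sb0); clear; lra).
(* One step gains eta^2 / (2 #|J|) times the trace; dividing by [th] produces exactly the factor 1 +
   om of [hj]. *)
have gain2 : (1 + om) * (\sum_j qf (Y zs - K%:M) (S j) - 2 * C * eta * sb * Lam) <=
    th^-1 * (g zs - f zs).
  rewrite [leRHS]mulrC ler_pdivlMr //; apply: le_trans gain.
  rewrite le_eqVlt; apply/orP; left; apply/eqP; rewrite thE; field.
  by rewrite !gt_eqF // addr_gt0.
have X1 := ler_wpM2l (ltW (addr_gt0 ltr01 om0)) SX.
have omL0 : 0 <= om * L by rewrite mulr_ge0 // ltW.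
have X2 := ler_wpM2l omL0 pG.
have Bq : 0 <= B * q by rewrite mulr_ge0.
have X3 : om * L * (4 * B * q) <= 4 * B * q by rewrite ler_piMl // -mulrA mulr_ge0.
have X4 : om * (12 * B * q * Lam) <= 12 * B * q * Lam.
  by rewrite ler_piMl // -[12 * B * q]mulrA !mulr_ge0.
have W0 : 0 <= C * eta * sb * Lam by rewrite !mulr_ge0 // ltW.
have X5 : om * (C * eta * sb * Lam) <= C * eta * sb * Lam by rewrite ler_piMl.
(* The quartic term grows in time at rate 2 B q c = 24 B q Lam + 4 B q, which pays for its own trace
   (factor 1 + om <= 2) and gradient. One [om] of [E] covers the discretisation errors, the other
   makes the contradiction strict. *)
move: hjet gain2 X1 X2 X3 X4 X5 Cd W0 om0; rewrite EE cE.
set Z := \sum_j qf _ _; set ZX := \sum_j qf _ _; set gf := th^-1 * _.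
set e1 := enorm p; clearbody Z ZX gf e1 q.
clear; move=> h1 h2 h3 h4 h5 h6 h7 h8 h9 h10.
lra.
Qed.

End Walks.

(** * Domination by averages along a walk *)

Section MeanValue.
Context {R : realType}.

(** [mv_step] is iterated from time -h to 0. At the origin the quartic term has accumulated only B
    (c h)^2, at most om h for h <= h0. As [h0] does not depend on f, the function f may be built
    afterwards from U at time -h. *)
Lemma mean_value n (J : finType) (S : J -> 'rV[R]_n) (U : R -> 'rV[R]_n -> R)
    (L om r K D : R) :
  (0 < #|J|)%N -> 0 < om <= 1 -> om * L <= 1 -> 0 <= L -> 0 < r <= 1 -> 0 <= K ->
  hj S L om r U -> cont_on (cyl (- r) 0 0 r) U ->
  exists2 h0 : R, 0 < h0 & forall h : R, 0 < h <= h0 -> forall f (C del : R),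
    0 < del -> 0 <= C -> sclass K C del (2 * K) (D - K) f ->
    (forall z, enorm z <= r -> U (- h) z <= f z) ->
    exists2 eta0 : R, 0 < eta0 & forall (eta : R) (N : nat), 0 < eta <= eta0 ->
      N%:R * (eta ^+ 2 / (2 * #|J|%:R * (1 + om))) = h ->
      U 0 0 <= iter N (step (pm S eta)) f 0 +
        (om * L * (1 + 5 * K) + 3 * om) * h.
Proof.
move=> J0 om01 omL L0 r01 K0 HJ cU.
have [om0 om1] := andP om01; have [r0 r1] := andP r01.
have [CU CU0 hCU] := cyl_bounded cU.
pose Lam := \sum_j n2 (S j); pose sb := \sum_j enorm (S j).
have Lam0 : 0 <= Lam by apply: sumr_ge0 => j _; exact: n2_ge0.
have sb0 : 0 <= sb by apply: sumr_ge0 => j _; exact: enorm_ge0.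
(* Along the walk f stays above D - 3 K on the ball, so this [B] puts the barrier above the bound
   [CU] of U on the sphere of radius r. *)
pose c := 12 * Lam + 2; pose B := (CU + `|D| + 3 * K + 1) / r ^+ 4.
have c0 : 0 < c by rewrite /c; move: Lam0; clear; lra.
have r40 : 0 < r ^+ 4 by rewrite exprn_gt0.
have BE : B * r ^+ 4 = CU + `|D| + 3 * K + 1 by rewrite /B divfK // gt_eqF.
have B0 : 0 <= B.
  rewrite divr_ge0 ?(ltW r40) //; have := normr_ge0 D; move: CU0 K0; clear; lra.
pose E := om * L * (1 + K + 4 * K) + 2 * om.
have Bc : 0 < B * c ^+ 2 + 1 by rewrite ltr_wpDl // mulr_ge0 ?sqr_ge0.
have L4 : 0 < 4 * Lam + 1 by move: Lam0; clear; lra.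
exists (Num.min r (Num.min (4 * Lam + 1)^-1 (om / (B * c ^+ 2 + 1)))).
  by rewrite lt_min r0 lt_min invr_gt0 L4 divr_gt0.
move=> h /andP[h0 hle] f C del del0 C0 cf fU.
have [m1 m2 m3] := min3_le r (4 * Lam + 1)^-1 (om / (B * c ^+ 2 + 1)).
have hr := le_trans hle m1.
have hL : h * (4 * Lam + 1) <= 1 by rewrite -ler_pdivlMr // mul1r; exact: le_trans m2.
have hB : h * (B * c ^+ 2 + 1) <= om by rewrite -ler_pdivlMr //; exact: le_trans m3.
pose e0 := Num.min (del / (2 * (sb + 1))) (om / (44 * C * sb * Lam + 1)).
have C4 : 0 < 44 * C * sb * Lam + 1 by rewrite ltr_wpDl // !mulr_ge0.
have sb2 : 0 < 2 * (sb + 1) by move: sb0; clear; lra.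
exists e0; first by rewrite lt_min !divr_gt0.
move=> eta N /andP[eta0 etale] Nh.
have Jp : 0 < #|J|%:R :> R by rewrite ltr0n.
set th := eta ^+ 2 / _ in Nh.
have th0 : 0 < th by rewrite divr_gt0 ?exprn_gt0 // !mulr_gt0 // addr_gt0.
have I0 : (0 < #|{: J * bool}|)%N by rewrite card_pm muln_gt0 J0.
have eta1 : eta * (2 * (sb + 1)) <= del.
  by rewrite -ler_pdivlMr //; apply: (le_trans etale); rewrite ge_min lexx.
have eta2 : eta * (44 * C * sb * Lam + 1) <= om.
  by rewrite -ler_pdivlMr //; apply: (le_trans etale); rewrite ge_min lexx orbT.
pose m := #|{: J * bool}|%:R^-1 * \sum_i n2 (pm S eta i).
have mE : m = 2 * (1 + om) * Lam * th.
  rewrite /m; transitivity (#|{: J * bool}|%:R^-1 * \sum_i qf 1%:M (pm S eta i)).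
    by congr (_ * _); apply: eq_bigr => i _; rewrite qf_scalar mul1r.
  rewrite pm_mean_qf //.
  have -> : \sum_j qf 1%:M (S j) = Lam.
    by apply: eq_bigr => j _; rewrite qf_scalar mul1r.
  rewrite /th; field.
  by apply/andP; split; rewrite gt_eqF ?addr_gt0.
have om2 : 0 <= 1 + om by rewrite addr_ge0 // ltW.
have m0 : 0 <= m.
  by rewrite mE; apply: mulr_ge0; [rewrite !mulr_ge0|exact: ltW].
(* The total variance is at most 4 Lam h <= 1, so the constants of [sclass] drift by at most [K]
   along the whole walk; this gives the gradient bound 4 K. *)
have kth (k : nat) : (k <= N)%N -> k%:R * th <= h /\ k%:R * m <= 1.
  move=> kN; have kh : k%:R * th <= h by rewrite -Nh ler_wpM2r ?(ltW th0) // ler_nat.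
  split=> //; apply: le_trans hL; rewrite mE.
  have -> : k%:R * (2 * (1 + om) * Lam * th) = 2 * (1 + om) * Lam * (k%:R * th) by ring.
  have h1 : 2 * (1 + om) * Lam * (k%:R * th) <= 2 * (1 + om) * Lam * h.
    by rewrite ler_wpM2l // !mulr_ge0.
  apply: (le_trans h1).
  have h2 : om * (Lam * h) <= Lam * h by rewrite ler_piMl // mulr_ge0 // ltW.
  move: h2 h0; clear; lra.
have cls k : sclass K C del (2 * K + K * (k%:R * m)) (D - K - K * (k%:R * m))
    (iter k (step (pm S eta)) f).
  elim: k => [|k IH] /=; first by rewrite !mul0r !mulr0 addr0 subr0.
  have := sclass_step I0 (pm_sum0 S eta) IH; rewrite /= -/m.
  rewrite -[k.+1]addn1 natrD.
  have -> : 2 * K + K * (k%:R * m) + K * m = 2 * K + K * ((k%:R + 1) * m) by ring.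
  by have -> : D - K - K * (k%:R * m) - K * m = D - K - K * ((k%:R + 1) * m) by ring.
have Kk (k : nat) : (k <= N)%N -> K * (k%:R * m) <= K.
  by move=> /kth[_ km]; rewrite ler_piMr.
have n2r z : enorm z <= r -> K * n2 (z : 'rV[R]_n) <= K.
  move=> zr; rewrite ler_piMr // -enorm_sqr expr_le1 ?enorm_ge0 //.
  exact: le_trans r1.
have main k : (k <= N)%N -> forall z, enorm z <= r ->
    U (- h + k%:R * th) z <= iter k (step (pm S eta)) f z
      + B * (n2 z + c * (k%:R * th)) ^+ 2 + E * (k%:R * th).
  elim: k => [_ z zr|k IH kN z zr].
    rewrite mul0r !mulr0 !addr0 /=; apply: (le_trans (fU z zr)).
    by rewrite lerDl mulr_ge0 ?sqr_ge0.
  have [P [Y [tf hP]]] := cls k; have [P' [Y' [_ hP']]] := cls k.+1.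
  have kN' := ltnW kN.
  have [kh1 _] := kth _ kN.
  have stepE : - h + k.+1%:R * th = - h + k%:R * th + th.
    by rewrite -[k.+1]addn1 natrD; ring.
  have stepE2 : k.+1%:R * th = k%:R * th + th by rewrite -[k.+1]addn1 natrD; ring.
  rewrite stepE stepE2.
  apply: (@mv_step _ n J S U L om r K (4 * K) (D - 3 * K) B E c eta
    (- h + k%:R * th) (k%:R * th) C del Lam sb th (iter k (step (pm S eta)) f) P Y) => //.
  - by rewrite mulr_ge0.
  - by rewrite mulr_ge0 // ltW.
  - have : 0 <= k%:R * th by rewrite mulr_ge0 // ltW.
    by move: hr; clear; lra.
  - by move: kh1; rewrite stepE2; clear; lra.
  - by move=> z'; case: (hP z').
  - move=> z' zr'; have n2z := n2r _ zr'; split.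
      have [_ h1 _] := hP z'; have := Kk _ kN'; move: h1 n2z; clear; lra.
    have mE2 (a : R) : step (pm S eta) (fun y => a + K * n2 y) z' = a + K * n2 z' + K * m.
      have := step_qf I0 (pm_sum0 S eta) a K%:M z'; rewrite /step.
      under eq_bigr do rewrite qf_scalar.
      rewrite qf_scalar => ->; congr (_ + _).
      by under eq_bigr do rewrite qf_scalar; rewrite -mulr_sumr mulrCA.
    have : enorm (stepv (pm S eta) P z') <=
        step (pm S eta) (fun y => (2 * K + K * (k%:R * m)) + K * n2 y) z'.
      rewrite /stepv enormZ ger0_norm ?invr_ge0 // ler_wpM2l ?invr_ge0 //.
      apply: (le_trans (enorm_sum _)); apply: ler_sum => i _.
      by case: (hP (z' + pm S eta i)).
    rewrite mE2; have := Kk _ kN; rewrite -[k.+1]addn1 natrD mulrDl mul1r mulrDr.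
    move: n2z; clear; lra.
  - move=> z' zr'; have n2z := n2r _ zr'; split.
      have [_ _ h1] := hP z'; have := Kk _ kN'; move: h1 n2z; clear; lra.
    have [_ _ h1] := hP' z'; have := Kk _ kN; move: h1 n2z; clear; lra.
  - move=> s z' sI zr'; rewrite BE.
    have := hCU s z' (conj sI _); rewrite subr0 zr' lexx => /(_ isT).
    have := ler_norm (U s z'); have := ler_norm (- D); rewrite normrN; clear; lra.
  - by move: eta1 eta0; clear; lra.
  - move: eta2 eta0; clear; lra.
  - by move=> z' zr'; exact: IH.
have := main N (leqnn _) 0; rewrite enorm0 => /(_ (ltW r0)).
rewrite Nh addNr n20 add0r => /le_trans; apply.
rewrite -addrA lerD2l.
have h5 : h * (B * c ^+ 2 + 1) * h <= om * h by rewrite ler_wpM2r // ltW.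
rewrite /E; have : 0 <= h * h by rewrite mulr_ge0 // ltW.
move: h5; clear; lra.
Qed.

(** The sup-convolution of U at time -h over a finite net, raised by [sl] to make up for the mesh
    and then smoothed; the mesh is fine enough for the modulus of U and the quadratic penalty to
    cost at most sl / 2 each. *)
Lemma softmax_net n (U : R -> 'rV[R]_n -> R) (r h K sl CU : R) :
  0 < r <= 1 -> 0 <= h <= r -> 0 <= K -> 0 < sl ->
  cont_on (cyl (- r) 0 0 r) U ->
  (forall t z, cyl (- r) 0 0 r (t, z) -> `|U t z| <= CU) ->
  exists f (C del : R), [/\ 0 < del, 0 <= C, sclass K C del (2 * K) (- CU - K) f,
    forall z, enorm z <= r -> U (- h) z <= f z &
    forall z, exists2 y, enorm y <= r &
      f z <= U (- h) y - K / 2 * n2 (z - y) + 2 * sl].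
Proof.
move=> /andP[r0 r1] /andP[h0 hr] K0 sl0 cU hCU.
have [d d0 hd] := cyl_unif cU (e := sl / 2) ltac:(by rewrite divr_gt0).
pose d1 := Num.min d (Num.min 1 (sl / (K + 1))).
have K1 : 0 < K + 1 by rewrite ltr_wpDl.
have d10 : 0 < d1 by rewrite !lt_min d0 ltr01 divr_gt0.
have [e1 e2 e3] := min3_le d 1 (sl / (K + 1)); rewrite -/d1 in e1 e2 e3.
have [s [sr snet]] := @eball_net R n 0 r d1 d10.
have [y0 y0s _] : exists2 y, y \in s & enorm (0 - y) <= d1.
  by apply: snet; rewrite subr0 enorm0 ltW.
pose y (i : 'I_(size s)) := tnth (in_tuple s) i.
have ys i : y i \in s by apply: mem_tnth.
have yr i : enorm (y i) <= r by have := sr _ (ys i); rewrite subr0.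
have I0 : (0 < #|'I_(size s)|)%N.
  by rewrite card_ord; move: y0s; case: (s).
have hm : - r <= - h <= 0 by rewrite lerN2 hr oppr_le0.
have cy (z : 'rV[R]_n) : enorm z <= r -> cyl (- r) 0 0 r (- h, z) by move=> zr; split; rewrite //= subr0.
pose N : R := #|'I_(size s)|%:R.
have N1 : 1 <= N by rewrite ler1n.
have lN : 0 <= ln N by exact: ln_ge0.
pose rho := sl / (1 + ln N).
have lN1 : 0 < 1 + ln N by rewrite ltr_pwDl.
have rho0 : 0 < rho by rewrite divr_gt0.
have rhoN : rho * ln N <= sl.
  by rewrite /rho mulrAC ler_pdivrMr // ler_wpM2l ?(ltW sl0) // lerDr.
pose a i := U (- h) (y i) + sl.
have aD i : - CU <= a i.
  have := hCU _ _ (cy _ (yr i)); rewrite ler_norml => /andP[h1 _].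
  by rewrite /a; move: h1 sl0; clear; lra.
have y1 i : enorm (y i) <= 1 by exact: le_trans (yr i) r1.
have [C [del [del0 C0 cls]]] := softmax_class I0 K0 rho0 y1 aD.
exists (softmax y a K rho), C, del; split=> // [z zr|z].
- have [y' y's zy] : exists2 y, y \in s & enorm (z - y) <= d1.
    by apply: snet; rewrite subr0.
  have [i yE] : exists i, y' = y i.
    by have /tnthP[i ->] : y' \in in_tuple s by []; exists i.
  have yr' : enorm y' <= r by rewrite yE.
  apply: le_trans (softmax_ge y a K i z rho0).
  have := hd _ _ _ _ (cy _ yr') (cy _ zr).
  rewrite subrr normr0 => /(_ (ltW d0) (le_trans zy e1)).
  rewrite ler_norml => /andP[_ h1].
  have h2 : K / 2 * n2 (z - y i) <= sl / 2.
    have n2d : n2 (z - y i) <= d1.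
      rewrite -yE -enorm_sqr; apply: (le_trans _ zy).
      by rewrite expr2 ler_piMl ?enorm_ge0 // (le_trans zy).
    have h3 : K * n2 (z - y i) <= (K + 1) * d1.
      by apply: ler_pM => //; [exact: n2_ge0|rewrite lerDl].
    have h4 : d1 * (K + 1) <= sl by rewrite -ler_pdivlMr.
    move: h3 h4; clear; lra.
  by rewrite /a -yE; rewrite -yE in h2; move: h1 h2; clear; lra.
- have [i hi] := softmax_le y a K z rho0 I0; exists (y i) => //.
  apply: (le_trans hi); move: rhoN; rewrite -/N /a; clear; lra.
Qed.

Lemma hj_le n (J : finType) (S : J -> 'rV[R]_n) (L om r r' : R) U : r' <= r ->
  hj S L om r U -> hj S L om r' U.
Proof.
move=> rr H sg z /andP[s1 s2] zr; apply: H; last exact: le_trans rr.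
by rewrite s2 andbT (le_trans _ s1) // lerN2.
Qed.

End MeanValue.

(** * The inequality at a maximum of the doubled function *)

Section Sums.
Context {R : realType}.

(** A strong enough penalty barely changes a quadratic form under sup-convolution. With y = z + w,
    the three terms of [K] pay in turn for the cross terms (by Young), for Q on w, and for the w
    part of kap |z + w|^2. *)
Lemma quad_sup n (Q : 'M[R]_n) (kap K : R) (y z : 'rV[R]_n) : 0 < kap ->
  K = 2 * (enorm Q ^+ 2 / (4 * kap) + enorm Q / 2 + 2 * kap) ->
  qf Q y / 2 + kap * n2 y - K / 2 * n2 (z - y) <= qf Q z / 2 + 3 * kap * n2 z.
Proof.
move=> kap0 KE.
have [w yE] : exists w, y = z + w by exists (y - z); rewrite addrC subrK.
rewrite yE opprD addrA subrr add0r n2N qfD.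
set x := enorm z; set v := enorm w; set NQ := enorm Q in KE *.
have nz : n2 z = x ^+ 2 by rewrite enorm_sqr.
have nw : n2 w = v ^+ 2 by rewrite enorm_sqr.
have h1 := ler_normlW (dotv_mul_le z Q w).
have h2 := ler_normlW (dotv_mul_le w Q z).
have h3 := ler_normlW (qf_le Q w).
have h4 := n2D_le z w.
rewrite -/x -/v -/NQ in h1 h2 h3; rewrite nz nw in h3 h4 *.
have h5 : NQ * x * v <= kap * x ^+ 2 + NQ ^+ 2 / (4 * kap) * v ^+ 2.
  rewrite -subr_ge0.
  have -> : kap * x ^+ 2 + NQ ^+ 2 / (4 * kap) * v ^+ 2 - NQ * x * v =
      kap * (x - NQ / (2 * kap) * v) ^+ 2 by field; rewrite gt_eqF.
  by rewrite mulr_ge0 ?sqr_ge0 // ltW.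
have h6 := ler_wpM2l (ltW kap0) h4.
have h2' : dotv (w *m Q) z <= NQ * x * v by rewrite mulrAC.
have KE2 : K / 2 * v ^+ 2 = NQ ^+ 2 / (4 * kap) * v ^+ 2 + NQ / 2 * v ^+ 2
    + 2 * kap * v ^+ 2 by rewrite KE; field; rewrite gt_eqF.
rewrite KE2; move: h1 h2' h3 h5 h6; clear; lra.
Qed.

(* Run from the sup-convolutions of U1 and U2 two walks driven by the same signs:
   together they form a walk on the product with steps [row_mx (S1 j) (S2 j)], along
   which the mean of the quadratic jet grows by half the right-hand side per unit of
   squared step. This replaces the Crandall-Ishii lemma. *)
Lemma sums n m (J : finType) (S1 : J -> 'rV[R]_n) (S2 : J -> 'rV[R]_m)
    (U1 : R -> 'rV[R]_n -> R) (U2 : R -> 'rV[R]_m -> R) (L r0 tau : R) Q :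
  (0 < #|J|)%N -> 0 <= L -> 0 < r0 ->
  cont_on (cyl (- r0) 0 0 r0) U1 -> cont_on (cyl (- r0) 0 0 r0) U2 ->
  (forall om : R, 0 < om -> exists2 r : R, 0 < r & hj S1 L om r U1) ->
  (forall om : R, 0 < om -> exists2 r : R, 0 < r & hj S2 L om r U2) ->
  upper_jet (fun t z => U1 t (lsubmx z) + U2 t (rsubmx z)) 0 0 tau 0 Q ->
  tau <= \sum_j qf Q (row_mx (S1 j) (S2 j)).
Proof.
move=> J0 L0 r00 cU1 cU2 H1 H2 uj.
pose Sp j := row_mx (S1 j) (S2 j); rewrite -/(Sp _).
set SQ := \sum_j _; pose Lp := \sum_j n2 (Sp j).
have Lp0 : 0 <= Lp by apply: sumr_ge0 => j _; exact: n2_ge0.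
apply/ler_addgt0Pr => e e0.
have L12 : 0 < 1 + 12 * Lp by move: Lp0; clear; lra.
pose kap := e / 2 / (1 + 12 * Lp).
have kap0 : 0 < kap by rewrite !divr_gt0.
have kapE : kap * (1 + 12 * Lp) = e / 2 by rewrite /kap divfK // gt_eqF.
clearbody kap.
pose K := 2 * (enorm Q ^+ 2 / (4 * kap) + enorm Q / 2 + 2 * kap).
have K0 : 0 <= K.
  rewrite /K mulr_ge0 // addr_ge0 ?addr_ge0 //.
  - by rewrite divr_ge0 ?sqr_ge0 // mulr_ge0 // ltW.
  - by rewrite divr_ge0 // enorm_ge0.
  - by rewrite mulr_ge0 // ltW.
have KE : K = 2 * (enorm Q ^+ 2 / (4 * kap) + enorm Q / 2 + 2 * kap) by [].
clearbody K.
pose Xi := `|SQ| + 4 + 2 * (L * (1 + 5 * K) + 3).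
have Xi0 : 0 < Xi.
  have : 0 <= L * (1 + 5 * K) by rewrite mulr_ge0 // addr_ge0 // mulr_ge0.
  rewrite /Xi; move: (normr_ge0 SQ); clear; lra.
have L1 : 0 < L + 1 by rewrite ltr_wpDl.
(* [Xi] contains [K], which is already fixed by [Q] and [kap]: the choice of [om] is not
   circular. *)
pose om := Num.min 1 (Num.min (L + 1)^-1 (e / 2 / Xi)).
have om0 : 0 < om by rewrite !lt_min ltr01 invr_gt0 L1 !divr_gt0.
have [om1 omL' omXi'] := min3_le 1 (L + 1)^-1 (e / 2 / Xi).
rewrite -/om in om1 omL' omXi'; clearbody om.
have omL : om * L <= 1.
  have : om * (L + 1) <= 1 by rewrite -ler_pdivlMr // mul1r.
  by rewrite mulrDr mulr1; move: om0; clear; lra.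
have omXi : om * Xi <= e / 2 by rewrite -ler_pdivlMr.
have om01 : 0 < om <= 1 by rewrite om0.
have [del del0 jet] := uj kap kap0.
have [r1 r10 HJ1] := H1 om om0; have [r2 r20 HJ2] := H2 om om0.
pose r := Num.min (Num.min r1 r2) (Num.min r0 (Num.min 1 (del / 2))).
have r_gt0 : 0 < r by rewrite !lt_min r10 r20 r00 ltr01 divr_gt0.
have rle : [/\ r <= r1, r <= r2, r <= r0, r <= 1 & r <= del / 2].
  by split; rewrite /r !ge_min lexx ?orbT.
case: rle => rr1 rr2 rr0 r_le1 rdel; clearbody r.
have r01 : 0 < r <= 1 by rewrite r_gt0.
have sub k : cyl (- r) 0 (0 : 'rV[R]_k) r `<=` cyl (- r0) 0 0 r0.
  move=> [t z] [/= /andP[a1 a2] a3]; split => /=; last exact: le_trans rr0.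
  by rewrite a2 andbT (le_trans _ a1) // lerN2.
have {}cU1 := cont_onW (@sub n) cU1; have {}cU2 := cont_onW (@sub m) cU2.
have {}HJ1 := hj_le rr1 HJ1; have {}HJ2 := hj_le rr2 HJ2.
have [CU1 CU10 hC1] := cyl_bounded cU1; have [CU2 CU20 hC2] := cyl_bounded cU2.
have [h1 h10 MV1] := mean_value (- CU1) J0 om01 omL L0 r01 K0 HJ1 cU1.
have [h2 h20 MV2] := mean_value (- CU2) J0 om01 omL L0 r01 K0 HJ2 cU2.
pose h := Num.min (Num.min h1 h2) (Num.min r del).
have h0 : 0 < h by rewrite !lt_min h10 h20 r_gt0.
have hle : [/\ h <= h1, h <= h2, h <= r & h <= del].
  by split; rewrite /h !ge_min lexx ?orbT.
case: hle => hh1 hh2 hr hdel; clearbody h.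
have hr0 : 0 <= h <= r by rewrite ltW.
have sl0 : 0 < om * h by rewrite mulr_gt0.
have [f [C1 [d1 [d10 C10 cf fU fle]]]] := softmax_net r01 hr0 K0 sl0 cU1 hC1.
have [g [C2 [d2 [d20 C20 cg gU gle]]]] := softmax_net r01 hr0 K0 sl0 cU2 hC2.
have hI1 : 0 < h <= h1 by rewrite h0.
have hI2 : 0 < h <= h2 by rewrite h0.
have [e1 e10 M1] := MV1 h hI1 f C1 d1 d10 C10 cf fU.
have [e2 e20 M2] := MV2 h hI2 g C2 d2 d20 C20 cg gU.
have Jp : 0 < #|J|%:R :> R by rewrite ltr0n.
have om2 : 0 < 1 + om by rewrite addr_gt0.
pose ee := Num.min e1 e2; have ee0 : 0 < ee by rewrite lt_min e10.
pose X := 2 * #|J|%:R * (1 + om) * h.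
have X0 : 0 < X by rewrite !mulr_gt0.
(* The number of steps comes first and [eta] is adjusted to it, so that N time steps fill h
   exactly. *)
pose N := (Num.bound (X / ee ^+ 2)).+1.
have Np : 0 < N%:R :> R by rewrite ltr0n.
have XN : X / ee ^+ 2 <= N%:R.
  apply: (le_trans (ler_norm _)); apply: ltW; apply: (lt_le_trans (archi_boundP _)).
    by rewrite ?normr_ge0.
  rewrite ger0_norm; last by rewrite divr_ge0 ?sqr_ge0 // ltW.
  by rewrite ler_nat.
pose eta := Num.sqrt (X / N%:R).
have eta0 : 0 < eta by rewrite sqrtr_gt0 divr_gt0.
have eta2 : eta ^+ 2 = X / N%:R by rewrite sqr_sqrtr // divr_ge0 // ltW.
have etae : eta <= ee.
  rewrite -(@ler_pXn2r _ 2) ?nnegrE ?(ltW eta0) ?(ltW ee0) // eta2 ler_pdivrMr // [leRHS]mulrC.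
  by rewrite -ler_pdivrMr // exprn_gt0.
have Nh : N%:R * (eta ^+ 2 / (2 * #|J|%:R * (1 + om))) = h.
  rewrite eta2 /X; field.
  by rewrite !gt_eqF.
have eI1 : 0 < eta <= e1 by rewrite eta0 (le_trans etae) // ge_min lexx.
have eI2 : 0 < eta <= e2 by rewrite eta0 (le_trans etae) // ge_min lexx orbT.
have {M1} M1 := M1 eta N eI1 Nh; have {M2} M2 := M2 eta N eI2 Nh.
clearbody eta N.
pose c0 := U1 0 0 + U2 0 0 - tau * h + kap * h + 4 * om * h.
pose Q3 := 2^-1 *: Q + (3 * kap)%:M.
(* The nearly optimal points lie in balls of radius r <= del / 2, so the jet applies to the pair at
   time -h; [quad_sup] then removes the penalties, for every z. *)
have Hle (z : 'rV[R]_(n + m)) : f (lsubmx z) + g (rsubmx z) <= c0 + qf Q3 z.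
  have [y1 y1r fy] := fle (lsubmx z); have [y2 y2r gy] := gle (rsubmx z).
  pose y := row_mx y1 y2.
  have ydel : enorm y <= del.
    rewrite -(@ler_pXn2r _ 2) ?nnegrE ?enorm_ge0 ?(ltW del0) // enorm_sqr n2_row.
    rewrite -!enorm_sqr.
    have a1 : enorm y1 ^+ 2 <= r ^+ 2 by rewrite ler_pXn2r ?nnegrE ?enorm_ge0 // ltW.
    have a2 : enorm y2 ^+ 2 <= r ^+ 2 by rewrite ler_pXn2r ?nnegrE ?enorm_ge0 // ltW.
    have a3 : r ^+ 2 <= (del / 2) ^+ 2.
      by rewrite ler_pXn2r ?nnegrE // ltW // divr_gt0.
    have a4 : (del / 2) ^+ 2 = del ^+ 2 / 4 by field.
    have a5 : 0 <= del ^+ 2 by rewrite sqr_ge0.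
    move: a1 a2 a3 a4 a5; clear; lra.
  have hI : - del <= - h <= 0 by rewrite lerN2 hdel oppr_le0 ltW.
  have := jet (- h) y hI ydel.
  rewrite !add0r dotv0l row_mxKl row_mxKr !linear0 => hj.
  have hq := quad_sup y z kap0 KE.
  have n2s : n2 (z - y) = n2 (lsubmx z - y1) + n2 (rsubmx z - y2).
    by rewrite n2_pair !linearB /= row_mxKl row_mxKr.
  rewrite n2s in hq.
  rewrite /c0 /Q3 qfDX qfZX qf_scalar.
  move: fy gy hj hq; clear; lra.
have key : U1 0 0 + U2 0 0 <= c0 + (1 + om) * h * (SQ + 6 * kap * Lp) +
    2 * ((om * L * (1 + 5 * K) + 3 * om) * h).
  have I0 : (0 < #|{: J * bool}|)%N by rewrite card_pm muln_gt0 J0.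
  have := iter_step_mono (pm Sp eta) N (0 : 'rV[R]_(n + m)) Hle.
  rewrite (iter_step_qf I0 (pm_sum0 Sp eta)) pm_mean_qf // qf0 addr0.
  rewrite iter_step_pair !linear0.
  have -> : (fun i => lsubmx (pm Sp eta i)) = pm S1 eta.
    by apply/funext => i; rewrite /pm linearZ /= row_mxKl.
  have -> : (fun i => rsubmx (pm Sp eta i)) = pm S2 eta.
    by apply/funext => i; rewrite /pm linearZ /= row_mxKr.
  have -> : \sum_j qf Q3 (Sp j) = SQ / 2 + 3 * kap * Lp.
    rewrite /SQ /Lp mulr_suml mulr_sumr -big_split; apply: eq_bigr => j _.
    by rewrite /Q3 qfDX qfZX qf_scalar mulrC.
  have -> : N%:R * (eta ^+ 2 / #|J|%:R * (SQ / 2 + 3 * kap * Lp)) =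
     (1 + om) * h * (SQ + 6 * kap * Lp).
    by rewrite -Nh; field; rewrite !gt_eqF.
  move: M1 M2; clear; lra.
(* The values at the origin cancel and every remaining term is proportional to h, including the
   smoothing error om h. *)
have keyh : (tau - kap - 4 * om) * h <= ((1 + om) * (SQ + 6 * kap * Lp) +
    2 * (om * L * (1 + 5 * K) + 3 * om)) * h.
  move: key; rewrite /c0; clear; lra.
rewrite ler_pM2r // in keyh.
have b1 : om * SQ <= om * `|SQ| by rewrite ler_wpM2l ?ler_norm // ltW.
have b2 : om * (kap * Lp) <= kap * Lp.
  by rewrite ler_piMl // mulr_ge0 // ltW.
move: keyh b1 b2 kapE omXi; rewrite /Xi; clear; lra.
Qed.

End Sums.

(** * Frames moving with the drift *)

Section Frames.
Context {R : realType}.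

Lemma uj_frame n (g : R -> 'rV[R]_n -> R) (be : 'rV[R]_n) (t : R) z tau p Q :
  upper_jet g t z tau p Q ->
  upper_jet (fun s y => g s (y + (s - t) *: be)) t z (tau + dotv p be) p Q.
Proof.
move=> hg kap kap0.
have [d d0 h] := hg (kap / 4) (divr_gt0 kap0 (ltr0n _ 4)).
set nb := enorm be; have nb0 : 0 <= nb := enorm_ge0 be.
set NQ := enorm Q; have NQ0 : 0 <= NQ := enorm_ge0 Q.
have b1 : 0 < 1 + nb by rewrite ltr_pwDl.
pose M := 4 * NQ * nb + (2 * NQ + kap) * nb ^+ 2 + 1.
have Mge : 0 <= 4 * NQ * nb + (2 * NQ + kap) * nb ^+ 2.
  rewrite addr_ge0 ?mulr_ge0 ?exprn_ge0 // addr_ge0 ?mulr_ge0 //; exact: ltW.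
have M0 : 0 < M by rewrite /M ltr_wpDl.
exists (Num.min (d / (1 + nb)) (kap / (2 * M))).
  by rewrite lt_min !divr_gt0 // mulr_gt0.
move=> s ze /andP[s1 s0] zd; set m := Num.min _ _ in s1 zd.
have m1 : m * (1 + nb) <= d by rewrite -ler_pdivlMr // /m ge_min lexx.
have m2 : m * (2 * M) <= kap.
  by rewrite -ler_pdivlMr ?mulr_gt0 // /m ge_min lexx orbT.
set e := enorm ze in zd; have e0 : 0 <= e := enorm_ge0 ze.
have sb : enorm (s *: be) = - s * nb by rewrite enormZ ler0_norm.
have smb : - s * nb <= m * nb by rewrite ler_wpM2r // lerNl.
have zs : enorm (ze + s *: be) <= d.
  have h1 := enormD ze (s *: be); rewrite sb -/e in h1.
  move: h1 zd m1 smb; clear; lra.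
have nm : m <= d by apply: le_trans m1; rewrite ler_peMr ?lerDl // (le_trans e0).
have sI : - d <= s <= 0 by rewrite s0 andbT (le_trans _ s1) // lerN2.
have := h s _ sI zs.
rewrite addrA [t + s]addrC addrK subrr scale0r addr0 [s + t]addrC.
rewrite dotvDr dotvZr qfD => hh.
have q1 := ler_normlW (dotv_mul_le ze Q (s *: be)).
have q2 := ler_normlW (dotv_mul_le (s *: be) Q ze).
have q3 := ler_normlW (qf_le Q (s *: be)).
have q4 := n2D_le ze (s *: be).
rewrite sb -/e -/NQ in q1 q2; rewrite -enorm_sqr sb -/NQ in q3.
rewrite -[n2 (s *: be)]enorm_sqr sb in q4.
have sm : - s <= m by rewrite lerNl.
have s0' : 0 <= - s by rewrite oppr_ge0.
have r1 : NQ * e * (- s * nb) <= NQ * nb * m * - s.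
  have -> : NQ * e * (- s * nb) = NQ * nb * e * - s by ring.
  by rewrite ler_wpM2r // ler_wpM2l // mulr_ge0.
have r2 : (- s * nb) ^+ 2 <= nb ^+ 2 * m * - s.
  have -> : (- s * nb) ^+ 2 = nb ^+ 2 * (- s) * (- s) by ring.
  by rewrite ler_wpM2r // ler_wpM2l // exprn_ge0.
have r3 : NQ * (- s * nb) ^+ 2 <= NQ * (nb ^+ 2 * m * - s) by rewrite ler_wpM2l.
have r4 : kap * (- s * nb) ^+ 2 <= kap * (nb ^+ 2 * m * - s).
  by rewrite ler_wpM2l // ltW.
have r5 : m * (2 * M) * - s <= kap * - s by rewrite ler_wpM2r.
have q4' := ler_wpM2l (ltW kap0) q4.
have r6 : 0 <= m * - s by rewrite mulr_ge0 // (le_trans e0).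
have r7 : 0 <= kap * n2 ze by rewrite mulr_ge0 ?n2_ge0 // ltW.
have q2' : dotv (s *: be *m Q) ze <= NQ * e * (- s * nb) by rewrite mulrAC.
have t1 : 0 <= NQ * nb * (m * - s) by rewrite mulr_ge0 // mulr_ge0.
have t2 : 0 <= NQ * nb ^+ 2 * (m * - s).
  by rewrite mulr_ge0 // mulr_ge0 // exprn_ge0.
have t3 : 0 <= kap * nb ^+ 2 * (m * - s).
  by rewrite mulr_ge0 // mulr_ge0 ?exprn_ge0 // ltW.
apply: (le_trans hh); move: q1 q2' q3 q4' r1 r3 r4 r5 r6 r7 t1 t2 t3; rewrite /M.
clear; lra.
Qed.

Lemma young_n2 n (a c : 'rV[R]_n) (om : R) : 0 < om ->
  n2 (a + c) <= (1 + om) * n2 a + (1 + om^-1) * n2 c.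
Proof.
move=> om0; rewrite n2D.
have om0' : om != 0 by rewrite gt_eqF.
have := n2_ge0 (om *: a - c); rewrite n2B n2Z dotvZl => h.
have h2 : 0 <= om^-1 * (om ^+ 2 * n2 a - 2 * (om * dotv a c) + n2 c).
  by rewrite mulr_ge0 // invr_ge0 ltW.
have E : om^-1 * (om ^+ 2 * n2 a - 2 * (om * dotv a c) + n2 c) =
  om * n2 a - 2 * dotv a c + om^-1 * n2 c by field.
move: h2; rewrite E; clear; lra.
Qed.

Section VelocityField.
Variables (d : nat) (b : R -> 'rV[R]_d -> 'rV[R]_d).
Hypothesis contb : {within [set p : R * 'rV[R]_d | 0 < p.1],
  continuous (fun p => b p.1 p.2)}.

Lemma field_continuous (t : R) x : 0 < t ->
  {for (t, x), continuous (fun p : R * 'rV[R]_d => b p.1 p.2)}.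
Proof.
move=> t0 A hA.
move/subspace_continuousP: contb => /(_ (t, x) t0) /(_ A hA).
move=> /(@nbhs_prodP R d (t, x))[e e0 he]; apply/nbhs_prodP.
exists (Num.min e (t / 2)); first by rewrite lt_min e0 divr_gt0.
move=> s y st yx; apply: he => /=.
- by apply: (le_trans st); rewrite ge_min lexx.
- by apply: (le_trans yx); rewrite ge_min lexx.
- have : `|s - t| <= t / 2 by apply: (le_trans st); rewrite ge_min lexx orbT.
  by rewrite ler_norml => /andP[]; move: t0; clear; lra.
Qed.

Lemma field_coord_continuous (t : R) x i : 0 < t ->
  {for (t, x), continuous (fun p : R * 'rV[R]_d => b p.1 p.2 0 i)}.
Proof.
move=> t0; apply: (@continuous_comp _ _ _ (fun p : R * 'rV[R]_d => b p.1 p.2)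
  (fun v : 'rV[R]_d => v 0 i)); first exact: field_continuous.
exact: coord_continuous.
Qed.

Lemma field_near (t : R) x (e : R) : 0 < t -> 0 < e -> exists2 r : R, 0 < r &
  forall s y, `|s - t| <= r -> enorm (y - x) <= r -> enorm (b s y - b t x) <= e.
Proof.
move=> t0 e0.
have := @field_continuous t x t0.
move=> /(_ [set v | enorm (v - b t x) <= e]) h.
have /nbhs_prodP[r r0 hr] := h ltac:(by apply/nbhs_rVP; exists e).
by exists r => // s y; exact: hr.
Qed.

End VelocityField.

Lemma lip_coord_continuous d l (Sigma : 'rV[R]_d -> 'M[R]_(d, l)) (s1 : R) :
  (forall x y, enorm (Sigma x - Sigma y) <= s1 * enorm (x - y)) ->
  forall i j, continuous (fun x => Sigma x i j).
Proof.
move=> lip i j x A /nbhs_ballP[e /= e0 eA]; apply/nbhs_rVP.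
have s10 : 0 < 1 + `|s1| by rewrite ltr_pwDl.
exists (e / 2 / (1 + `|s1|)) => [|y yx]; first by rewrite !divr_gt0.
apply: eA; rewrite /ball /=; apply: (@le_lt_trans _ _ (e / 2)); last first.
  by rewrite ltr_pdivrMr // ltr_pMr // ltr1n.
have h : `|Sigma x i j - Sigma y i j| <= enorm (Sigma x - Sigma y).
  have -> : Sigma x i j - Sigma y i j = (Sigma x - Sigma y) i j by rewrite !mxE.
  rewrite -(@ler_pXn2r _ 2) ?nnegrE ?enorm_ge0 // real_normK ?num_real //.
  rewrite /enorm sqr_sqrtr; last first.
    by apply: sumr_ge0 => k _; apply: sumr_ge0 => k' _; rewrite sqr_ge0.
  rewrite (bigD1 i) //= (bigD1 j) //= -addrA lerDl addr_ge0 //.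
    by apply: sumr_ge0 => k _; rewrite sqr_ge0.
  by apply: sumr_ge0 => k _; apply: sumr_ge0 => k' _; rewrite sqr_ge0.
apply: (le_trans h); apply: (le_trans (lip x y)).
rewrite enormBC in yx; move: yx; rewrite ler_pdivlMr // => yx.
apply: le_trans yx; rewrite mulrC ler_wpM2l ?enorm_ge0 //.
by apply: (le_trans (ler_norm s1)); rewrite lerDr.
Qed.

(* Following the velocity b(t0, x0) removes the drift up to an error which is small
   near (t0, x0). *)
Lemma subsol_hj d l (T lam s1 : R) (Sigma : 'rV[R]_d -> 'M[R]_(d, l))
    (b : R -> 'rV[R]_d -> 'rV[R]_d) (u : R -> 'rV[R]_d -> R) (t0 : R) x0 p0
    (J : finType) (S : J -> 'rV[R]_d) :
  0 < lam -> (forall x y, enorm (Sigma x - Sigma y) <= s1 * enorm (x - y)) ->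
  {within [set p : R * 'rV[R]_d | 0 < p.1], continuous (fun p => b p.1 p.2)} ->
  subsol T lam Sigma b u -> 0 < t0 < T ->
  (forall v, \sum_j dotv v (S j) ^+ 2 = lam * n2 v + n2 (v *m Sigma x0)) ->
  exists2 L : R, 0 <= L & forall om : R, 0 < om -> exists2 r : R, 0 < r &
    hj S L om r (fun sg z => u (t0 + sg) (x0 + z + sg *: b t0 x0) - dotv p0 z).
Proof.
move=> lam0 lip contb subu t0T hS.
have /andP[t00 t0lT] := t0T.
pose Lam := \sum_j n2 (S j).
have Lam0 : 0 <= Lam by apply: sumr_ge0 => j _; exact: n2_ge0.
have LamE : Lam = \sum_j n2 (Acol lam (Sigma x0) j).
  have E (I : finType) (F : I -> 'rV[R]_d) :
      \sum_i n2 (F i) = \sum_k \sum_i dotv (delta_mx 0 k) (F i) ^+ 2.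
    rewrite [RHS]exchange_big; apply: eq_bigr => i _.
    by apply: eq_bigr => k _; rewrite dotvC dotv_delta expr2.
  rewrite /Lam !E; apply: eq_bigr => k _.
  by rewrite hS sum_dotv_Acol // ltW.
pose L := 2 * Lam + lam + enorm p0 + 1.
have L0 : 0 <= L by rewrite /L !addr_ge0 ?mulr_ge0 ?enorm_ge0 // ltW.
exists L => // om om0.
set be := b t0 x0.
have [rb rb0 hb] := field_near contb x0 t00 om0.
have om1 : 0 < 1 + om^-1 by rewrite addr_gt0 // invr_gt0.
(* A bound on the variation of Sigma whose cost (1 + 1 / om) |Sigma x - Sigma x0|^2 is at most om
   lam. *)
pose de := Num.min 1 (om * lam / (1 + om^-1)).
have de0 : 0 < de by rewrite lt_min ltr01 divr_gt0 // mulr_gt0.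
have s10 : 0 < 1 + `|s1| by rewrite ltr_pwDl.
have nb0 : 0 < 1 + enorm be by rewrite ltr_pwDl // enorm_ge0.
pose rr := Num.min rb (Num.min (t0 / 2) (de / (1 + `|s1|))).
have rr0 : 0 < rr by rewrite !lt_min rb0 !divr_gt0.
have [k1 k2 k3] := min3_le rb (t0 / 2) (de / (1 + `|s1|)); rewrite -/rr in k1 k2 k3.
exists (rr / (1 + enorm be)); first by rewrite divr_gt0.
move=> sg z /andP[sg1 sg0] zr tau p Y K K0 tY jU.
have rE : rr / (1 + enorm be) * (1 + enorm be) = rr by rewrite divfK // gt_eqF.
have rle : rr / (1 + enorm be) <= rr.
  by rewrite ler_pdivrMr // ler_peMr ?(ltW rr0) // lerDl enorm_ge0.
set r := rr / _ in sg1 zr rE rle; have sgr : - sg <= r by rewrite lerNl.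
have sga : `|sg| <= rr by rewrite ler0_norm //; exact: le_trans rle.
pose x := x0 + z + sg *: be; pose t := t0 + sg.
have xx0 : enorm (x - x0) <= rr.
  have -> : x - x0 = z + sg *: be by rewrite /x -[x0 + z + _]addrA [x0 + _]addrC addrK.
  apply: (le_trans (enormD _ _)); rewrite enormZ ler0_norm // -rE mulrDr mulr1.
  by apply: lerD => //; rewrite ler_wpM2r ?enorm_ge0.
have tT : 0 < t < T.
  rewrite /t; move: sga; rewrite ler0_norm // => sga.
  by apply/andP; split; move: sga k2 sg0 t00 t0lT; clear; lra.
(* The tilt by [p0] and the moving frame are undone to return to a jet of u itself. *)
have ju : upper_jet u t x (tau - dotv (p + p0) be) (p + p0) (Y - K%:M).
  pose V s y := u s (y + (s - t) *: be).
  have jV : upper_jet V t x tau (p + p0) (Y - K%:M).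
    have jU' : upper_jet (fun s y => (u (t0 + s) (x0 + y + s *: be) - dotv p0 y)
        + dotv p0 y) sg z (tau + 0) (p + p0) (Y - K%:M + 0).
      apply: uj_add => // kap kap0; exists 1 => // s ze /andP[_ s0] _.
      rewrite dotvDr qf0X mul0r mul0r !addr0 lerDl mulr_ge0 ?(ltW kap0) //.
      by rewrite subr_ge0 (le_trans s0) // n2_ge0.
    rewrite !addr0 in jU'.
    move=> kap kap0; have [del del0 h] := jU' kap kap0; exists del => // s ze sI zd.
    have := h s ze sI zd; rewrite !subrK /V /t subrr scale0r addr0.
    have -> : x + ze + (t0 + sg + s - (t0 + sg)) *: be =
        x0 + (z + ze) + (sg + s) *: be.
      rewrite [t0 + sg + s]addrC addrK /x scalerDl !addrA; congr (_ + _).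
      by rewrite addrAC.
    by rewrite addrA /x.
  have := uj_frame (- be) jV; rewrite dotvNr.
  have -> // : (fun s y => V s (y + (s - t) *: - be)) = u.
  by apply/funext => s; apply/funext => y; rewrite /V scalerN subrK.
have := jet_subsol (ltW lam0) (lip_coord_continuous lip)
  (fun t x i => @field_coord_continuous _ b contb t x i) subu tT ju.
set D := Sigma x - Sigma x0.
have De : enorm D ^+ 2 * (1 + om^-1) <= om * lam.
  have h1 : enorm D <= de.
    apply: (le_trans (lip _ _)).
    apply: (@le_trans _ _ ((1 + `|s1|) * rr)).
      apply: (@le_trans _ _ ((1 + `|s1|) * enorm (x - x0))).
        rewrite ler_wpM2r ?enorm_ge0 //; apply: (le_trans (ler_norm s1)).
        by rewrite lerDr.
      by rewrite ler_wpM2l // ltW.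
    by rewrite mulrC -ler_pdivlMr.
  have [de1 de2] : de <= 1 /\ de <= om * lam / (1 + om^-1).
    by split; rewrite /de ge_min lexx ?orbT.
  rewrite -ler_pdivlMr //; apply: (le_trans _ de2); apply: (le_trans _ h1).
  by rewrite expr2 ler_piMl ?enorm_ge0 // (le_trans h1).
(* Young's inequality splits Sigma x around Sigma x0, and the nondegenerate part lam |v|^2 absorbs
   the remainder; [tmono] then compares the traces. *)
have dom : forall v, \sum_i dotv v (Acol lam (Sigma x) i) ^+ 2 <=
    (1 + om) * \sum_j dotv v (S j) ^+ 2.
  move=> v; rewrite hS sum_dotv_Acol ?(ltW lam0) //.
  have -> : v *m Sigma x = v *m Sigma x0 + v *m D by rewrite -mulmxDr addrC subrK.
  have h1 := young_n2 (v *m Sigma x0) (v *m D) om0.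
  have h2 := ler_wpM2l (ltW om1) (n2_mul_le v D).
  have h3 := ler_wpM2r (n2_ge0 v) De.
  move: h1 h2 h3; clear; lra.
have tYl := tY _ _ (Acol lam (Sigma x)) S (1 + om) dom.
(* The part -K I of the Hessian has the opposite sign and needs the reverse comparison of
   variances. *)
have LamX : Lam <= (1 + om) * (\sum_j n2 (Acol lam (Sigma x) j)) + om * lam.
  have h1 : Lam <= (1 + om) * (\sum_j n2 (Acol lam (Sigma x) j)) +
      (1 + om^-1) * enorm D ^+ 2.
    have -> : enorm D ^+ 2 =
        \sum_j n2 (Acol lam (Sigma x0) j - Acol lam (Sigma x) j).
      rewrite big_sumType /= big1 ?add0r => [|i _]; last by rewrite subrr n20.
      rewrite /enorm sqr_sqrtr; last first.
        by apply: sumr_ge0 => k _; apply: sumr_ge0 => k' _; rewrite sqr_ge0.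
      rewrite exchange_big; apply: eq_bigr => k _; apply: eq_bigr => i _.
      by rewrite !mxE; ring.
    rewrite LamE !mulr_sumr -big_split; apply: ler_sum => j _ /=.
    have := young_n2 (Acol lam (Sigma x) j)
      (Acol lam (Sigma x0) j - Acol lam (Sigma x) j) om0.
    by rewrite [Acol lam (Sigma x) j + _]addrC subrK.
  by apply: (le_trans h1); rewrite lerD2l mulrC.
have -> : \sum_j qf (Y - K%:M) (Acol lam (Sigma x) j) =
    \sum_j qf Y (Acol lam (Sigma x) j) - K * \sum_j n2 (Acol lam (Sigma x) j).
  by rewrite mulr_sumr -sumrB; apply: eq_bigr => j _; rewrite qfDX qfNX qf_scalar.
have -> : \sum_j qf (Y - K%:M) (S j) = \sum_j qf Y (S j) - K * Lam.
  by rewrite mulr_sumr -sumrB; apply: eq_bigr => j _; rewrite qfDX qfNX qf_scalar.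
have hbt : enorm (b t x - be) <= om.
  apply: hb; last exact: le_trans k1.
  by rewrite /t addrC addKr; exact: le_trans k1.
have hd : - dotv (b t x - be) (p + p0) <= om * (enorm p + enorm p0).
  apply: (le_trans (ler_norm _)); rewrite normrN; apply: (le_trans (dotv_le _ _)).
  by apply: ler_pM; rewrite ?enorm_ge0 // enormD.
rewrite dotvBl [dotv be _]dotvC in hd.
set LX := \sum_j n2 (Acol lam (Sigma x) j) in LamX *.
set SY := \sum_j qf Y (S j) in tYl *; set AY := \sum_j _ in tYl *.
have LX0 : 0 <= LX by apply: sumr_ge0 => j _; exact: n2_ge0.
have fa1 : (1 - om) * Lam - om * lam <= LX.
  have [om_ge1|om_lt1] := leP 1 om.
    have : (1 - om) * Lam <= 0 by rewrite mulr_le0_ge0 // subr_le0.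
    have : 0 <= om * lam by rewrite mulr_ge0 // ltW.
    by move: LX0; clear; lra.
  have g1 : (1 - om) * Lam <= (1 - om) * ((1 + om) * LX + om * lam).
    by rewrite ler_wpM2l // subr_ge0 ltW.
  have g2 : 0 <= om * om * LX by rewrite !mulr_ge0 // ltW.
  have g3 : 0 <= om * om * lam by rewrite !mulr_ge0 // ltW.
  move: g1 g2 g3; clear; lra.
have fa2 := ler_wpM2l K0 fa1.
have fa3 : 0 <= om * Lam * enorm p by rewrite !mulr_ge0 ?enorm_ge0 // ltW.
have fa4 : 0 <= om * lam * enorm p by rewrite !mulr_ge0 ?enorm_ge0 // ltW.
have fa5 : 0 <= om * enorm p0 * enorm p by rewrite !mulr_ge0 ?enorm_ge0 // ltW.
have fa6 : 0 <= om * enorm p0 * K by rewrite !mulr_ge0 ?enorm_ge0 // ltW.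
have fa7 : 0 <= om * Lam by rewrite !mulr_ge0 // ltW.
have fa8 : 0 <= om * lam by rewrite !mulr_ge0 // ltW.
have fa9 : 0 <= om * K by rewrite !mulr_ge0 // ltW.
move: tYl hd fa2 fa3 fa4 fa5 fa6 fa7 fa8 fa9 om0; rewrite /L; clear => *.
lra.
Qed.

End Frames.

(** * The doubled inequality for viscosity solutions *)

Section ViscositySums.
Context {R : realType}.

Lemma hj_leL n (J : finType) (S : J -> 'rV[R]_n) (L L' om r : R) U :
  0 <= om -> L <= L' -> hj S L om r U -> hj S L' om r U.
Proof.
move=> om0 LL H sg z sgI zr tau p Y K K0 tY jU.
apply: (le_trans (H sg z sgI zr tau p Y K K0 tY jU)); rewrite lerD2l.
by rewrite ler_wpM2r ?ler_wpM2l // !addr_ge0 // enorm_ge0.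
Qed.

Lemma cont_on_frame d (T t0 : R) (u : R -> 'rV[R]_d -> R) x0 be p : 0 < t0 < T ->
  cont_on [set q : R * 'rV[R]_d | 0 <= q.1 <= T] u ->
  cont_on (cyl (- t0) 0 0 t0)
    (fun sg z => u (t0 + sg) (x0 + z + sg *: be) - dotv p z).
Proof.
move=> /andP[t00 t0T] cu; apply: cont_onB; last first.
  apply: cont_on_space => z e e0; have p1 : 0 < 1 + enorm p.
    by rewrite ltr_pwDl // enorm_ge0.
  exists (e / (1 + enorm p)) => [|ze]; first by rewrite divr_gt0.
  rewrite ler_pdivlMr // mulrDr mulr1 => h.
  rewrite dotvDr addrC addKr; apply: (le_trans (dotv_le _ _)).
  by move: h (enorm_ge0 ze); clear; lra.
apply/cont_onP => s z [/= /andP[s1 s2] _] e e0.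
have m0 : 0 <= t0 + s <= T.
  by apply/andP; split; [rewrite -lerBlDl sub0r|apply: le_trans (ltW t0T); rewrite gerDl].
move/cont_onP: cu => /(_ (t0 + s) (x0 + z + s *: be) m0 e e0)[d1 d10 hd].
have b1 : 0 < 1 + enorm be by rewrite ltr_pwDl // enorm_ge0.
set nb := enorm be in b1 *; have nb0 : 0 <= nb := enorm_ge0 be.
exists (d1 / (1 + nb)) => [|s' z' [/= /andP[s1' s2'] _] h1 h2].
  by rewrite divr_gt0.
have dE : d1 / (1 + nb) * (1 + nb) = d1 by rewrite divfK // gt_eqF.
have dp : 0 < d1 / (1 + nb) by rewrite divr_gt0.
set dd := d1 / (1 + nb) in h1 h2 dE dp.
have m0' : 0 <= t0 + s' <= T.
  by apply/andP; split; [rewrite -lerBlDl sub0r|apply: le_trans (ltW t0T); rewrite gerDl].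
apply: hd => //.
  have -> : t0 + s' - (t0 + s) = s' - s by ring.
  by move: h1 (mulr_ge0 (ltW dp) nb0) dE; clear; lra.
have -> : x0 + z' + s' *: be - (x0 + z + s *: be) = (z' - z) + (s' - s) *: be.
  by rewrite scalerBl; apply/matrixP => i j; rewrite !mxE; ring.
apply: (le_trans (enormD _ _)); rewrite enormZ -/nb -dE mulrDr mulr1.
by apply: lerD => //; rewrite ler_wpM2r.
Qed.

(** Each variable moves with its own frozen drift and is tilted by its half of [p], which reduces
    the jet to one with zero gradient. [S1] and [S2] are constrained only by their own covariances,
    while the right-hand side sees the pairs: any coupling may be inserted. *)
Lemma visc_sums d l (T lam s1 : R) (Sigma : 'rV[R]_d -> 'M[R]_(d, l))
    (b : R -> 'rV[R]_d -> 'rV[R]_d) (u : R -> 'rV[R]_d -> R) (t0 tau : R)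
    (x0 y0 : 'rV[R]_d) p Q (J : finType) (S1 S2 : J -> 'rV[R]_d) :
  0 < lam -> (forall x y, enorm (Sigma x - Sigma y) <= s1 * enorm (x - y)) ->
  {within [set p : R * 'rV[R]_d | 0 < p.1], continuous (fun p => b p.1 p.2)} ->
  subsol T lam Sigma b u -> subsol T lam Sigma b (fun t x => - u t x) ->
  0 < t0 < T -> (0 < #|J|)%N ->
  (forall v, \sum_j dotv v (S1 j) ^+ 2 = lam * n2 v + n2 (v *m Sigma x0)) ->
  (forall v, \sum_j dotv v (S2 j) ^+ 2 = lam * n2 v + n2 (v *m Sigma y0)) ->
  upper_jet (fun t z => u t (lsubmx z) - u t (rsubmx z)) t0 (row_mx x0 y0) tau p Q ->
  tau + dotv p (row_mx (b t0 x0) (b t0 y0)) <= \sum_j qf Q (row_mx (S1 j) (S2 j)).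
Proof.
move=> lam0 lip contb su sNu t0T J0 hS1 hS2 jw; have /andP[t00 t0lT] := t0T.
have [L1 L10 H1] := subsol_hj (lsubmx p) lam0 lip contb su t0T hS1.
have [L2 L20 H2] := subsol_hj (rsubmx p) lam0 lip contb sNu t0T hS2.
set be := row_mx _ _.
have [cu _ _] := su; have [cNu _ _] := sNu.
apply: (@sums _ _ _ J S1 S2 _ _ (L1 + L2) t0 _ Q J0 (addr_ge0 L10 L20) t00
  (@cont_on_frame _ T t0 _ x0 (b t0 x0) (lsubmx p) t0T cu)
  (@cont_on_frame _ T t0 _ y0 (b t0 y0) (rsubmx p) t0T cNu)).
- move=> om om0; have [r r0 h] := H1 om om0; exists r => //.
  by apply: hj_leL h; [exact: ltW|rewrite lerDl].
- move=> om om0; have [r r0 h] := H2 om om0; exists r => //.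
  by apply: hj_leL h; [exact: ltW|rewrite lerDr].
move=> kap kap0; have [del del0 h] := uj_frame be jw kap0; exists del => // s ze sI zd.
have {h} := h s ze sI zd.
rewrite !subrr !scale0r !addr0 !add0r [t0 + s]addrC addrK [s + t0]addrC.
rewrite !linearD !linearZ !linear0 /= !row_mxKl !row_mxKr !addr0.
have -> : dotv p ze = dotv (lsubmx p) (lsubmx ze) + dotv (rsubmx p) (rsubmx ze).
  by rewrite -dotv_row !hsubmxK.
rewrite !dotv0r dotv0l; clear; lra.
Qed.

(** Converts test functions for -u into test functions for u. The operator is odd only for times in
    (0, T), where the derivatives are known to exist. *)
Lemma C12N d (T : R) (chi : R -> 'rV[R]_d -> R) : C12 T chi ->
  C12 T (fun t x => - chi t x) /\ forall l lam (Sigma : 'rV[R]_d -> 'M[R]_(d, l)) b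
    (t : R) x, 0 < t < T ->
    pde_op lam Sigma b (fun t x => - chi t x) t x = - pde_op lam Sigma b chi t x.
Proof.
case=> [dchi c0 c1 c2 c3].
have dt t x : 0 < t < T -> dtime (fun t x => - chi t x) t x = - dtime chi t x.
  move=> tT; have [h _ _] := dchi t x tT.
  by rewrite /dtime !derive1E; exact: (deriveN h).
have d1 (t : R) i : 0 < t < T ->
    pderiv i (fun x => - chi t x) = (fun x => - pderiv i (chi t) x).
  move=> tT; apply/funext => x; have [_ h _] := dchi t x tT.
  exact: (deriveN (h i)).
have d2 (t : R) i j x : 0 < t < T -> pderiv i (pderiv j (fun x => - chi t x)) x =
    - pderiv i (pderiv j (chi t)) x.
  move=> tT; have [_ _ h] := dchi t x tT.
  by rewrite d1 //; exact: (deriveN (h i j)).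
have withinN (f g : R * 'rV[R]_d -> R) : {within cylinder T, continuous f} ->
    (forall q, cylinder T q -> g q = - f q) -> {within cylinder T, continuous g}.
  move=> cf fg; apply: (@subspace_eq_continuous _ _ _ (fun q => - f q)).
    by move=> q /set_mem /fg.
  by move=> q; apply: cvgN; exact: cf.
split.
  split.
  - move=> t x tT; have [h1 h2 h3] := dchi t x tT; split.
    + exact: (derivableN h1).
    + by move=> i; exact: (derivableN (h2 i)).
    + by move=> i j; rewrite d1 //; exact: (derivableN (h3 i j)).
  - exact: withinN c0 _.
  - by apply: withinN c1 _ => -[t x] /= tT; rewrite dt.
  - by move=> i; apply: withinN (c2 i) _ => -[t x] /= tT; rewrite d1.
  - by move=> i j; apply: withinN (c3 i j) _ => -[t x] /= tT; rewrite d2.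
move=> l lam Sigma b t x tT; rewrite /pde_op /L0 dt //.
have -> : laplacian (fun x => - chi t x) x = - laplacian (chi t) x.
  by rewrite /laplacian -sumrN; apply: eq_bigr => i _; rewrite d2.
have -> : hess (fun x => - chi t x) x = - hess (chi t) x.
  by apply/matrixP => i j; rewrite !mxE d2.
have -> : grad (fun x => - chi t x) x = - grad (chi t) x.
  by apply/rowP => i; rewrite !mxE d1.
rewrite mulmxN dotvNr raddfN /=; ring.
Qed.

Lemma growth_pow d (u : R -> 'rV[R]_d -> R) (T m C : R) :
  (forall t x, 0 <= t <= T -> `|u t x| <= C * (1 + enorm x) `^ m) ->
  exists (C' : R) N, forall (t : R) x, 0 <= t <= T -> `|u t x| <= C' * (1 + n2 x) ^+ N.
Proof.
move=> hu; pose N := Num.bound `|m|; exists (`|C| * 2 ^+ N), N => t x tT.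
have e0 := enorm_ge0 x.
have mN : m <= N%:R.
  by apply: (le_trans (ler_norm m)); apply: ltW; apply: archi_boundP.
have h1 : (1 + enorm x) `^ m <= (1 + enorm x) ^+ N.
  by rewrite -powR_mulrn ?addr_ge0 // ler_powR // lerDl.
have h2 : 1 + enorm x <= 2 * (1 + n2 x).
  rewrite -enorm_sqr; have : 0 <= (enorm x - 1) ^+ 2 by rewrite sqr_ge0.
  have -> : (enorm x - 1) ^+ 2 = enorm x ^+ 2 - 2 * enorm x + 1 by ring.
  have : 0 <= enorm x ^+ 2 by rewrite sqr_ge0.
  clear; lra.
apply: (le_trans (hu t x tT)); rewrite -mulrA -exprMn.
apply: (@le_trans _ _ (`|C| * (1 + enorm x) `^ m)).
  by rewrite ler_wpM2r ?powR_ge0 // ler_norm.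
rewrite ler_wpM2l //; apply: (le_trans h1).
apply: lerXn2r => //; rewrite nnegrE ?addr_ge0 //.
by rewrite mulr_ge0 // addr_ge0 // n2_ge0.
Qed.

Lemma viscosity_subsol d l (T lam : R) (Sigma : 'rV[R]_d -> 'M[R]_(d, l)) b u0 u :
  viscosity_solution T lam Sigma b u0 u ->
  (exists m C : R, [/\ 0 < m, 0 < C &
      forall t x, 0 <= t <= T -> `|u t x| <= C * (1 + enorm x) `^ m]) ->
  subsol T lam Sigma b u /\ subsol T lam Sigma b (fun t x => - u t x).
Proof.
move=> [cu _ hsub hsup] [m [C [_ _ /growth_pow[C' [N hg]]]]]; split.
  by split=> //; exists C', N.
split.
- by move=> q; apply: cvgN; exact: cu.
- by exists C', N => t x tT; rewrite normrN; exact: hg.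
- move=> chi cchi t0 x0 t0T hmax; have [cN pN] := C12N cchi.
  rewrite -oppr_ge0 -pN //; apply: hsup => // t x tT.
  by have := hmax t x tT; clear; lra.
Qed.

End ViscositySums.

(** * Weights and the Lyapunov estimate *)

Section Weights.
Context {R : realType}.

Lemma expR_le_taylor2 (X : R) : expR X <= 1 + X + X ^+ 2 * expR `|X|.
Proof.
have [|c cI] := @MVT_between R (fun x => expR x - (1 + x)) (fun x => expR x - 1) 0 X.
  by move=> x; apply: is_derive_eq; rewrite add0r.
rewrite expR0 addr0 subrr !subr0.
have [c' cI'] := @MVT_between R expR expR 0 c (fun x => is_derive_expR x).
rewrite expR0 subr0 => -> E.
suff : expR c' * c * X <= expR `|X| * X ^+ 2 by move: E; clear; lra.
rewrite -mulrA expr2.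
have cX : 0 <= c * X <= X * X.
  move: cI; case: (leP 0 X) => X0 /andP[c1 c2]; apply/andP; split.
  - exact: mulr_ge0.
  - by rewrite ler_wpM2r.
  - by rewrite -mulrNN mulr_ge0 // oppr_ge0 // ltW.
  - by rewrite ler_wnM2r // ltW.
have cc : c' <= `|X|.
  have hc : c <= `|X|.
    move: cI; case: (leP 0 X) => X0 /andP[c1 c2]; first by rewrite ger0_norm.
    by rewrite (le_trans c2).
  by move: cI'; case: (leP 0 c) => c0 /andP[c1 c2]; apply: (le_trans c2).
have /andP[h1 h2] := cX.
by apply: ler_pM => //; rewrite ?expR_ge0 ?ler_expR.
Qed.

(** The sign of [a] decides which bound on ln (1 + y) is used; both occur later, positive powers for
    the weights and -q for the decay. *)
Lemma powR_taylor (a : R) : exists2 C : R, 0 <= C & forall y : R, `|y| <= 2^-1 ->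
  (1 + y) `^ a <= 1 + a * y + C * y ^+ 2.
Proof.
have a0 := normr_ge0 a.
exists (2 * `|a| + 4 * `|a| ^+ 2 * expR `|a|).
  by rewrite addr_ge0 ?mulr_ge0 ?expR_ge0 ?sqr_ge0.
move=> y yh; have /andP[y1 y2] : - 2^-1 <= y <= 2^-1 by rewrite -ler_norml.
have yp : 0 < 1 + y by lra.
rewrite /powR gt_eqF //.
have hln1 : ln (1 + y) <= y by apply: le_ln1Dx; lra.
have hln2 : y - 2 * y ^+ 2 <= ln (1 + y).
  have : ln (1 + - (y / (1 + y))) <= - (y / (1 + y)).
    apply: le_ln1Dx; rewrite ltrN2 ltr_pdivrMr //; lra.
  have -> : 1 + - (y / (1 + y)) = (1 + y)^-1 by field; rewrite gt_eqF.
  rewrite lnV ?posrE // lerN2; apply: le_trans.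
  rewrite ler_pdivlMr //.
  have : 0 <= y ^+ 2 * (1 + 2 * y) by rewrite mulr_ge0 ?sqr_ge0 //; lra.
  have -> : (y - 2 * y ^+ 2) * (1 + y) = y - y ^+ 2 * (1 + 2 * y) by ring.
  lra.
have y20 : 0 <= y ^+ 2 := sqr_ge0 y.
pose X := a * y + 2 * `|a| * y ^+ 2.
have hX : a * ln (1 + y) <= X.
  rewrite /X; case: (leP 0 a) => a0'; rewrite ?(ger0_norm a0') ?(ltr0_norm a0').
    have := ler_wpM2l a0' hln1; have := mulr_ge0 a0' y20; lra.
  have := ler_wnM2l (ltW a0') hln2; lra.
have ny2 : y ^+ 2 = `|y| ^+ 2 by rewrite real_normK // num_real.
have X1 : `|X| <= 2 * `|a| * `|y|.
  rewrite /X (le_trans (ler_normD _ _)) //.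
  rewrite (ger0_norm (mulr_ge0 (mulr_ge0 (ler0n R 2) a0) y20)) normrM.
  have := ler_wpM2l (mulr_ge0 a0 (normr_ge0 y)) yh.
  move: ny2; rewrite expr2 => ->; move: (`|a|) (`|y|); clear => *; lra.
have X2 : `|X| <= `|a|.
  by apply: (le_trans X1); have := ler_wpM2l a0 yh; lra.
apply: (@le_trans _ _ (expR X)); first by rewrite ler_expR.
apply: (le_trans (expR_le_taylor2 X)).
have : X ^+ 2 * expR `|X| <= (2 * `|a| * `|y|) ^+ 2 * expR `|a|.
  apply: ler_pM; rewrite ?sqr_ge0 ?expR_ge0 ?ler_expR //.
  rewrite -[X ^+ 2]real_normK ?num_real //.
  by apply: lerXn2r => //; rewrite nnegrE ?mulr_ge0.
rewrite /X ny2 !exprMn; lra.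
Qed.

Variable n : nat.
Implicit Types x z : 'rV[R]_n.

(* Constant on the ball of radius [R0], where the radial part of the drift is not
   controlled. *)
Definition excess (R0 : R) x : R := Num.max 0 (n2 x - R0 ^+ 2).
Definition weight (R0 : R) x : R := 1 + excess R0 x ^+ 2.

Lemma excess_ge0 R0 x : 0 <= excess R0 x.
Proof. by rewrite le_max lexx. Qed.

Lemma excess_ge R0 x : n2 x - R0 ^+ 2 <= excess R0 x.
Proof. by rewrite le_max lexx orbT. Qed.

Lemma weight_ge1 R0 x : 1 <= weight R0 x.
Proof. by rewrite lerDl sqr_ge0. Qed.

Lemma weight_gt0 R0 x : 0 < weight R0 x.
Proof. exact: lt_le_trans (weight_ge1 R0 x). Qed.

Lemma excess_le_weight R0 x : excess R0 x <= weight R0 x `^ 2^-1.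
Proof.
rewrite powR12_sqrt ?(ltW (weight_gt0 _ _)) //.
rewrite -[leLHS]ger0_norm ?excess_ge0 // -sqrtr_sqr.
by rewrite ler_wsqrtr // lerDr.
Qed.

(** The square of max (0, s + dl) is at most the square of max (0, s) + dl, even across s = 0. This
    one-sided bound stands in for a second derivative at |x| = R0. *)
Lemma weight_local R0 x z (dl : R) : dl = 2 * dotv x z + n2 z ->
  weight R0 (x + z) <= weight R0 x + (2 * excess R0 x * dl + dl ^+ 2).
Proof.
move=> dlE; rewrite /weight -addrA lerD2l.
have -> : excess R0 x ^+ 2 + (2 * excess R0 x * dl + dl ^+ 2) = (excess R0 x + dl) ^+ 2.
  by ring.
rewrite /excess n2D; case: (leP 0 (n2 x - R0 ^+ 2)) => h.
  have -> : n2 x + 2 * dotv x z + n2 z - R0 ^+ 2 = n2 x - R0 ^+ 2 + dl by rewrite dlE; ring.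
  case: (leP 0 _) => // h2; by rewrite expr0n sqr_ge0.
rewrite add0r; case: (leP 0 _) => h2; last by rewrite expr0n sqr_ge0.
apply: lerXn2r; rewrite ?nnegrE //; rewrite dlE; lra.
Qed.

(** The weight grows like |x|^4, so second derivatives of its power a are of size |x|^(4 a - 2),
    that is weight^(a - 1/2). *)
Lemma weight_pow_local (a R0 : R) : 0 <= a -> exists2 Z : R, 0 <= Z & forall x,
  exists2 r : R, 0 < r & forall z, enorm z <= r ->
  weight R0 (x + z) `^ a <= weight R0 x `^ a
    + dotv ((4 * a * excess R0 x * weight R0 x `^ (a - 1)) *: x) z
    + Z * weight R0 x `^ (a - 2^-1) * n2 z.
Proof.
move=> a0; have [Ca Ca0 hCa] := powR_taylor a.
have R20 : 0 <= R0 ^+ 2 := sqr_ge0 R0.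
exists (a * (2 + (8 * (R0 ^+ 2 + 1) + 2)) + 10 * Ca * (8 * (R0 ^+ 2 + 1) + 2)).
  by rewrite addr_ge0 ?mulr_ge0 //; move: R20; clear; lra.
move=> x; pose P := weight R0 x; pose pp := excess R0 x; pose nx := enorm x.
have P1 : 1 <= P := weight_ge1 R0 x.
have PE : P = 1 + pp ^+ 2 by [].
have pp0 : 0 <= pp := excess_ge0 R0 x.
have nx0 : 0 <= nx := enorm_ge0 x.
have hP : pp <= P `^ 2^-1 := excess_le_weight R0 x.
have hn2 : n2 x - R0 ^+ 2 <= pp := excess_ge R0 x.
have hn2' : n2 x = nx ^+ 2 by rewrite enorm_sqr.
have loc := @weight_local R0 x.
rewrite -/P -/pp in loc *; clearbody P pp.
have c1 : 0 < 2 * (2 * pp + 1) * (2 * nx + 1) by rewrite !mulr_gt0 //; lra.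
exists (Num.min 1 (2 * (2 * pp + 1) * (2 * nx + 1))^-1).
  by rewrite lt_min ltr01 invr_gt0.
move=> z; rewrite le_min => /andP[z1 z2].
have nz0 := enorm_ge0 z.
have n2z : n2 z = enorm z ^+ 2 by rewrite enorm_sqr.
set dl := 2 * dotv x z + n2 z.
have {}loc := loc z dl erefl.
have hd : `|dl| <= (2 * nx + 1) * enorm z.
  have h1 : `|dotv x z| <= nx * enorm z := dotv_le x z.
  have h2 : enorm z ^+ 2 <= enorm z by rewrite expr2 ler_piMl.
  have h3 : `|dl| <= 2 * `|dotv x z| + enorm z ^+ 2.
    rewrite /dl n2z (le_trans (ler_normD _ _)) // normrM (ger0_norm (ler0n R 2)).
    by rewrite (ger0_norm (exprn_ge0 2 nz0)).
  by move: h1 h2 h3; clear; lra.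
have hd2 : 2 * (2 * pp + 1) * `|dl| <= 1.
  apply: (le_trans (ler_wpM2l _ hd)); first by rewrite mulr_ge0 //; move: pp0; clear; lra.
  by rewrite mulrA -ler_pdivlMl // mulr1.
have d0 := normr_ge0 dl.
have hd1 : `|dl| <= 1 by have := mulr_ge0 pp0 d0; move: hd2 d0; clear; lra.
have dE : dl ^+ 2 = `|dl| ^+ 2 by rewrite real_normK // num_real.
have hdd : `|dl| ^+ 2 <= `|dl| by rewrite expr2 ler_piMl.
have hD2 : dl ^+ 2 <= (8 * n2 x + 2) * n2 z.
  have h1 := dotv_sqr_le x z.
  have h2 : n2 z ^+ 2 <= n2 z by rewrite expr2 ler_piMl ?n2_ge0 // n2z exprn_ile1.
  have : 0 <= (2 * dotv x z - n2 z) ^+ 2 by rewrite sqr_ge0.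
  rewrite /dl; move: h1 h2; clear; nra.
(* Bound for the increment of the weight; the radius keeps it below P / 2, the range of
   [powR_taylor]. *)
pose D := 2 * pp * dl + dl ^+ 2.
have P0 : 0 < P by lra.
have hD : `|D| <= P / 2.
  have : `|D| <= (2 * pp + 1) * `|dl|.
    have : `|D| <= 2 * pp * `|dl| + dl ^+ 2.
      rewrite /D (le_trans (ler_normD _ _)) // (ger0_norm (sqr_ge0 dl)) normrM.
      by rewrite (ger0_norm (mulr_ge0 (ler0n R 2) pp0)).
    by move: dE hdd; clear; lra.
  move: hd2 P1; clear; lra.
have yle : `|D / P| <= 2^-1.
  by rewrite normrM normfV (ger0_norm (ltW P0)) ler_pdivrMr // mulrC.
have hy := hCa _ yle.
have stepA : weight R0 (x + z) `^ a <= P `^ a * (1 + D / P) `^ a.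
  have hp : 0 <= 1 + D / P by move: yle; rewrite ler_norml => /andP[]; clear; lra.
  rewrite -powRM ?(ltW P0) // mulrDr mulr1 mulrCA divff ?gt_eqF // mulr1.
  apply: ge0_ler_powR => //; rewrite ?nnegrE ?(ltW (weight_gt0 _ _)) //.
  have -> : P + D = P * (1 + D / P) by field; rewrite gt_eqF.
  by rewrite mulr_ge0 // ltW.
apply: (le_trans stepA); clear stepA.
have PaE : P `^ a = P `^ (a - 1) * P.
  rewrite -[X in _ = _ * X](powRr1 (ltW P0)) -powRD ?subrK //.
  by rewrite (gt_eqF P0) implybT.
apply: (le_trans (ler_wpM2l (powR_ge0 _ _) hy)).
have PhE : P `^ (a - 2^-1) = P `^ (a - 1) * P `^ 2^-1.
  rewrite -powRD ?(gt_eqF P0) ?implybT //.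
  by rewrite (_ : a - 2^-1 = a - 1 + 2^-1) //; field.
rewrite dotvZl PhE !PaE; set A := P `^ (a - 1); have A0 : 0 <= A := powR_ge0 _ _.
set h := P `^ 2^-1 in hP *.
have h1 : 1 <= h by rewrite -(powRr0 P) ler_powR //; rewrite invr_ge0.
have hDP : (D / P) ^+ 2 * P <= 10 * dl ^+ 2.
  have -> : (D / P) ^+ 2 * P = D ^+ 2 / P by field; rewrite gt_eqF.
  rewrite ler_pdivrMr // /D PE.
  have h2 : 0 <= dl ^+ 2 * (2 * pp - dl) ^+ 2 by rewrite mulr_ge0 ?sqr_ge0.
  have h3 : dl ^+ 2 * dl ^+ 2 <= dl ^+ 2 * 1.
    by rewrite ler_wpM2l ?sqr_ge0 // dE exprn_ile1.
  have h4 : 0 <= dl ^+ 2 * pp ^+ 2 by rewrite mulr_ge0 ?sqr_ge0.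
  move: h2 h3 h4 (sqr_ge0 dl); clear.
  have -> : (2 * pp * dl + dl ^+ 2) ^+ 2 =
     8 * (dl ^+ 2 * pp ^+ 2) + 2 * (dl ^+ 2 * dl ^+ 2) - dl ^+ 2 * (2 * pp - dl) ^+ 2 by ring.
  lra.
have -> : A * P * (1 + a * (D / P) + Ca * (D / P) ^+ 2) =
    A * P + A * (a * D + Ca * ((D / P) ^+ 2 * P)) by field; rewrite gt_eqF.
have -> : A * P + 4 * a * pp * A * dotv x z +
    (a * (2 + (8 * (R0 ^+ 2 + 1) + 2)) + 10 * Ca * (8 * (R0 ^+ 2 + 1) + 2)) * (A * h) * n2 z
  = A * P + A * (4 * a * pp * dotv x z + (a * (2 + (8 * (R0 ^+ 2 + 1) + 2)) +
     10 * Ca * (8 * (R0 ^+ 2 + 1) + 2)) * (h * n2 z)) by ring.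
rewrite lerD2l ler_wpM2l //.
have hx : 8 * n2 x + 2 <= (8 * (R0 ^+ 2 + 1) + 2) * h.
  have := ler_wpM2l R20 h1; move: hn2 hP h1; clear; lra.
set K := 8 * (R0 ^+ 2 + 1) + 2 in hx *.
have hD3 : dl ^+ 2 <= K * (h * n2 z).
  by apply: (le_trans hD2); rewrite mulrA ler_wpM2r ?n2_ge0.
have hD4 : a * D <= 4 * a * pp * dotv x z + a * ((2 + K) * (h * n2 z)).
  have -> : 4 * a * pp * dotv x z = a * (4 * pp * dotv x z) by ring.
  rewrite -mulrDr ler_wpM2l // /D.
  have : pp * n2 z <= h * n2 z by rewrite ler_wpM2r ?n2_ge0.
  move: hD3; rewrite {2}/dl; clear; lra.
have : Ca * ((D / P) ^+ 2 * P) <= Ca * (10 * (K * (h * n2 z))).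
  by rewrite ler_wpM2l // (le_trans hDP) // ler_pM2l.
move: hD4; clear; lra.
Qed.

Lemma powR_absorb (K c e eta : R) : 0 <= K -> 0 < c -> 0 < e -> 0 < eta ->
  exists2 C : R, 0 <= C & forall P : R, 1 <= P -> K * P `^ (e - eta) <= c * P `^ e + C.
Proof.
move=> K0 c0 e0 eta0; pose B := (K / c) `^ (eta^-1 * e).
exists (K * B) => [|P P1]; first by rewrite mulr_ge0 ?powR_ge0.
have P0 : 0 < P by exact: lt_le_trans P1.
have Pe : P `^ e = P `^ (e - eta) * P `^ eta.
  by rewrite -powRD ?subrK // (gt_eqF P0) implybT.
have Pee := powR_ge0 P (e - eta).
case: (leP (K / c) (P `^ eta)) => h.
  have : K * P `^ (e - eta) <= c * P `^ e.
    rewrite Pe mulrCA mulrC ler_wpM2l // mulrC -ler_pdivrMr //.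
  by move=> h2; apply: (le_trans h2); rewrite lerDl mulr_ge0 ?powR_ge0.
have h1 : P `^ e <= B.
  have -> : P `^ e = (P `^ eta) `^ (eta^-1 * e).
    by rewrite -powRrM mulrA divff ?mul1r // gt_eqF.
  apply: ge0_ler_powR; rewrite ?nnegrE ?powR_ge0 ?(ltW h) //.
    by rewrite mulr_ge0 ?invr_ge0 ?ltW.
  by rewrite divr_ge0 // ltW.
have h2 : P `^ (e - eta) <= P `^ e by rewrite ler_powR // lerBlDr lerDl ltW.
have : K * P `^ (e - eta) <= K * B by rewrite ler_wpM2l // (le_trans h2).
by move=> h3; apply: (le_trans h3); rewrite lerDr mulr_ge0 ?powR_ge0 // ltW.
Qed.

(** Where the excess is positive, |x|^gamma is at least excess^(gamma / 2), so the drift yields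
    weight^(a - 1) (excess^2)^w with a - 1 + w = a - (2 - gamma) / 4. If weight >= 2, then excess^2
    >= weight / 2, the origin of the factor 2^-w; otherwise the subtracted constant makes the left
    side nonpositive. *)
Lemma weight_drift (a R0 gamma alpha : R) x be : 0 <= a -> 0 <= gamma -> 0 <= alpha ->
  0 <= R0 -> (R0 <= enorm x -> alpha * enorm x `^ gamma <= dotv be x) ->
  4 * a * alpha * 2^-1 `^ ((1 + gamma / 2) / 2) *
      (weight R0 x `^ (a - (2 - gamma) / 4) - 2 `^ ((1 + gamma / 2) / 2) * 2 `^ a)
    <= dotv ((4 * a * excess R0 x * weight R0 x `^ (a - 1)) *: x) be.
Proof.
move=> a0 g0 al0 R00 hbe; set w := (1 + gamma / 2) / 2; set P := weight R0 x.
set pp := excess R0 x.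
have w0 : 0 <= w by rewrite /w divr_ge0 // addr_ge0 // divr_ge0.
have pp0 : 0 <= pp := excess_ge0 R0 x.
have P1 : 1 <= P := weight_ge1 R0 x.
have P0 : 0 < P := weight_gt0 R0 x.
have PE : P = 1 + pp ^+ 2 by [].
have A0 : 0 <= P `^ (a - 1) := powR_ge0 _ _.
have eE : P `^ (a - (2 - gamma) / 4) = P `^ (a - 1) * P `^ w.
  rewrite -powRD ?(gt_eqF P0) ?implybT //.
  by rewrite (_ : a - _ = a - 1 + w) // /w; field.
have drift : 4 * a * alpha * P `^ (a - 1) * (pp ^+ 2) `^ w <=
    dotv ((4 * a * pp * P `^ (a - 1)) *: x) be.
  have c2 : (pp ^+ 2) `^ w = pp * pp `^ (gamma / 2).
    rewrite -powR_mulrn // -powRrM /w (_ : 2%:R * _ = 1 + gamma / 2); last by field.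
    have [->|ppn] := eqVneq pp 0; last first.
      by rewrite powRD ?powRr1 // ppn implybT.
    by rewrite mul0r powR0 // gt_eqF // ltr_pwDl // divr_ge0.
  rewrite dotvZl dotvC c2.
  have [p0|ppn] := eqVneq pp 0; first by rewrite p0 !(mul0r, mulr0).
  have ppp : 0 < pp by rewrite lt_def ppn.
  have ppE : pp = n2 x - R0 ^+ 2.
    by move: ppn; rewrite /pp /excess; case: (leP 0 (n2 x - R0 ^+ 2)); rewrite ?eqxx.
  have xR : R0 <= enorm x.
    rewrite -(@ler_pXn2r _ 2) ?nnegrE ?enorm_ge0 // enorm_sqr.
    by move: ppp; rewrite ppE subr_gt0 => /ltW.
  have h1 : pp `^ (gamma / 2) <= enorm x `^ gamma.
    have -> : enorm x `^ gamma = (n2 x) `^ (gamma / 2).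
      by rewrite -enorm_sqr -powR_mulrn ?enorm_ge0 // -powRrM mulrCA divff ?mulr1.
    apply: (@ge0_ler_powR _ (gamma / 2)); rewrite ?nnegrE ?n2_ge0 ?divr_ge0 //.
    by rewrite ppE lerBlDr lerDl sqr_ge0.
  have h2 := le_trans (ler_wpM2l al0 h1) (hbe xR).
  have -> : 4 * a * alpha * P `^ (a - 1) * (pp * pp `^ (gamma / 2)) =
    4 * a * pp * P `^ (a - 1) * (alpha * pp `^ (gamma / 2)) by ring.
  by rewrite ler_wpM2l // !mulr_ge0.
apply: le_trans drift; rewrite -!(mulrA (4 * a * alpha)).
rewrite ler_wpM2l ?mulr_ge0 //.
have tw0 : 0 <= (2^-1 : R) `^ w := powR_ge0 _ _.
have c0 : 0 <= P `^ (a - 1) * (pp ^+ 2) `^ w by rewrite mulr_ge0 ?powR_ge0.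
case: (leP 2 P) => h.
  apply: (@le_trans _ _ (2^-1 `^ w * (P `^ (a - 1) * P `^ w))).
    by rewrite eE ler_wpM2l // lerBlDr lerDl mulr_ge0 ?powR_ge0.
  rewrite mulrCA ler_wpM2l // -powRM ?invr_ge0 ?(ltW P0) //.
  apply: (ge0_ler_powR w0); rewrite ?nnegrE ?sqr_ge0 ?mulr_ge0 ?invr_ge0 ?(ltW P0) //.
  by move: h; rewrite PE; clear; lra.
apply: le_trans c0; rewrite mulr_ge0_le0 // subr_le0.
apply: (@le_trans _ _ (P `^ (w + a))).
  by rewrite ler_powR // /w; move: g0; clear; lra.
rewrite -powRD ?pnatr_eq0 ?implybT //.
apply: (ge0_ler_powR (addr_ge0 w0 a0)); rewrite ?nnegrE ?(ltW P0) //.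
exact: ltW.
Qed.

(** The diffusion costs weight^(a - 1/2), whose exponent lies gamma / 4 below that of the drift
    gain, so half of the gain absorbs it up to a constant. *)
Lemma weight_super (a R0 gamma alpha Lam : R) : 0 < a -> 0 < gamma -> 0 < alpha ->
  0 <= R0 -> 0 <= Lam -> 0 < a - (2 - gamma) / 4 ->
  exists c C : R, [/\ 0 < c, 0 <= C & forall x be,
    (R0 <= enorm x -> alpha * enorm x `^ gamma <= dotv be x) ->
    exists p (Z r : R), [/\ 0 <= Z, 0 < r,
      forall z, enorm z <= r ->
        weight R0 (x + z) `^ a <= weight R0 x `^ a + dotv p z + Z * n2 z &
      c * weight R0 x `^ (a - (2 - gamma) / 4) - C <= dotv p be - 2 * Z * Lam]].
Proof.
move=> a0 g0 al0 R00 L0 e0; set e := a - (2 - gamma) / 4 in e0 *.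
have [Z0 Z00 hZ] := weight_pow_local R0 (ltW a0).
set w := (1 + gamma / 2) / 2.
have tw0 : 0 < (2^-1 : R) `^ w by rewrite powR_gt0 // invr_gt0.
pose c6 := 4 * a * alpha * 2^-1 `^ w.
have c60 : 0 < c6 by rewrite /c6 !mulr_gt0.
have [C C0 hC] := @powR_absorb (2 * Z0 * Lam) (c6 / 2) e (gamma / 4)
  (mulr_ge0 (mulr_ge0 (ler0n R 2) Z00) L0) (divr_gt0 c60 (ltr0n R 2)) e0
  (divr_gt0 g0 (ltr0n R 4)).
exists (c6 / 2), (C + c6 * (2 `^ w * 2 `^ a)); split.
- by rewrite divr_gt0.
- by rewrite addr_ge0 // mulr_ge0 ?(ltW c60) // mulr_ge0 ?powR_ge0.
move=> x be hbe; have [r r0 hr] := hZ x.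
exists ((4 * a * excess R0 x * weight R0 x `^ (a - 1)) *: x).
exists (Z0 * weight R0 x `^ (a - 2^-1)), r; split => //.
  by rewrite mulr_ge0 ?powR_ge0.
have := weight_drift (ltW a0) (ltW g0) (ltW al0) R00 hbe; rewrite -/w -/e -/c6.
have := hC _ (weight_ge1 R0 x).
have -> : e - gamma / 4 = a - 2^-1 by rewrite /e; field.
move: (weight R0 x `^ e) (weight R0 x `^ (a - 2^-1)) (dotv _ be) (2 `^ w * 2 `^ a).
clear => P1 P2 dd tt; lra.
Qed.
End Weights.

(** * Superjets of the time decay and of the concave function of the distance *)

Section Profiles.
Context {R : realType}.
Variable n : nat.
Implicit Types (z p : 'rV[R]_n) (Q : 'M[R]_n).

Definition quad_above (f : 'rV[R]_n -> R) z p Q := forall kap : R, 0 < kap ->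
  exists2 d : R, 0 < d & forall ze, enorm ze <= d ->
    f (z + ze) <= f z + dotv p ze + qf Q ze / 2 + kap * n2 ze.

(** The lower bound keeps T (t + s) - T t nonnegative, which [uj_prod] uses to multiply
    inequalities. *)
Definition left_above (T : R -> R) (t tau : R) := forall kap : R, 0 < kap ->
  exists2 d : R, 0 < d & forall s : R, - d <= s <= 0 ->
    T t <= T (t + s) <= T t + tau * s - kap * s.

Lemma uj_static f (t : R) z p Q : quad_above f z p Q ->
  upper_jet (fun _ y => f y) t z 0 p Q.
Proof.
move=> hf kap kap0; have [d d0 h] := hf kap kap0; exists d => // s ze /andP[_ s0] hd.
have := h ze hd; have := mulr_ge0_le0 (ltW kap0) s0; clear; lra.
Qed.

Lemma uj_prod T f (t : R) z tau p Q : 0 <= T t -> 0 <= f z ->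
  left_above T t tau -> quad_above f z p Q ->
  upper_jet (fun s y => T s * f y) t z (tau * f z) (T t *: p) (T t *: Q).
Proof.
move=> T0 f0 hT hf kap kap0.
have F1 : 0 < 1 + f z + T t by rewrite -addrA ltr_pwDl // addr_ge0.
pose k1 := kap / (2 * (1 + f z + T t)).
have k10 : 0 < k1 by rewrite divr_gt0 // mulr_gt0.
have k1E : 2 * (k1 * (1 + f z + T t)) = kap by rewrite /k1; field; rewrite gt_eqF.
have [d1 d10 h1] := hT k1 k10; have [d2 d20 h2] := hf k1 k10.
set L := `|tau| + k1; have L0 : 0 < L by rewrite ltr_wpDl.
set B := enorm p + enorm Q + k1.
have B0 : 0 < B by rewrite ltr_wpDl // addr_ge0 // enorm_ge0.
pose d3 := kap / (2 * L * B).
have d30 : 0 < d3 by rewrite divr_gt0 // !mulr_gt0.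
have d3E : 2 * (L * (B * d3)) = kap.
  by rewrite /d3; field; rewrite (gt_eqF B0) (gt_eqF L0).
clearbody k1 d3.
exists (Num.min (Num.min d1 d2) (Num.min d3 1)) => [|s ze].
  by rewrite !lt_min d10 d20 d30 ltr01.
rewrite lerNl !le_min => /andP[/andP[/andP[s1 s2] /andP[s3 s4]] s0].
move=> /andP[/andP[z1 z2] /andP[z3 z4]].
have /andP[m0 m1] : T t <= T (t + s) <= T t + tau * s - k1 * s.
  by apply: h1; rewrite s0 andbT lerNl.
have {h2} := h2 ze z2; set X := dotv p ze + qf Q ze / 2 + k1 * n2 ze => fX.
have nz0 := enorm_ge0 ze.
have n2z : n2 ze <= enorm ze by rewrite -enorm_sqr expr2 ler_piMl.
have hX : `|X| <= B * d3.
  have e1 : `|dotv p ze| <= enorm p * enorm ze := dotv_le _ _.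
  have e2 : `|qf Q ze| <= enorm Q * enorm ze.
    by apply: (le_trans (qf_le _ _)); rewrite ler_wpM2l ?enorm_ge0.
  have e3 : `|X| <= `|dotv p ze| + `|qf Q ze| / 2 + k1 * n2 ze.
    rewrite /X (le_trans (ler_normD _ _)) // (ger0_norm (mulr_ge0 (ltW k10) (n2_ge0 _))).
    rewrite lerD2r (le_trans (ler_normD _ _)) // normrM [X in _ * X]ger0_norm //.
  have e4 : B * enorm ze <= B * d3 by rewrite ler_pM2l.
  apply: le_trans e4; have := ler_wpM2l (ltW k10) n2z.
  by move: e1 e2 e3 (normr_ge0 (qf Q ze)); rewrite /B; clear; lra.
have hm : T (t + s) - T t <= - L * s.
  have : tau * s <= `|tau| * - s.
    by have := ler_norm (- tau); rewrite normrN => h; have := ler_wnM2r s0 h; lra.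
  by move: m1; rewrite /L; clear; lra.
have hmX : (T (t + s) - T t) * X <= - s * (kap / 2).
  have m0' : 0 <= T (t + s) - T t by rewrite subr_ge0.
  apply: (@le_trans _ _ ((T (t + s) - T t) * `|X|)).
    by rewrite ler_wpM2l // ler_norm.
  apply: (@le_trans _ _ (- L * s * (B * d3))); first exact: ler_pM.
  by rewrite -d3E; clear; lra.
have step1 : T (t + s) * f (z + ze) <= T (t + s) * (f z + X).
  by rewrite ler_wpM2l ?(le_trans T0) //; move: fX; rewrite /X; clear; lra.
apply: (le_trans step1).
have step2 : (T (t + s) - T t) * f z <= (tau * s - k1 * s) * f z.
  by rewrite ler_wpM2r //; move: m1; clear; lra.
have step3 : T t * (k1 * n2 ze) <= kap * n2 ze.
  have : 0 <= n2 ze * (k1 * (1 + f z)).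
    by rewrite mulr_ge0 ?n2_ge0 // mulr_ge0 ?(ltW k10) // addr_ge0.
  have : 0 <= n2 ze * (k1 * (1 + f z + T t)).
    by rewrite mulr_ge0 ?n2_ge0 // mulr_ge0 ?(ltW k10) // (ltW F1).
  by rewrite -k1E; clear; lra.
have step4 : - k1 * s * f z <= - s * (kap / 2).
  have : 0 <= - s * (k1 * (1 + T t)).
    by rewrite mulr_ge0 ?oppr_ge0 // mulr_ge0 ?(ltW k10) // addr_ge0.
  by rewrite -k1E; clear; lra.
rewrite dotvZl qfZX; move: hmX step2 step3 step4; rewrite /X.
move: (T (t + s)) (T t) (f z) (dotv p ze) (qf Q ze) (n2 ze).
clear => a b c x y w; lra.
Qed.

Definition decay (dl q t : R) : R := (1 + dl * t) `^ (- q).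

Lemma decay_left_above (dl q t : R) : 0 <= dl -> 0 <= q -> 0 < t ->
  left_above (decay dl q) t (- (q * dl * decay dl q t / (1 + dl * t))).
Proof.
move=> dl0 q0 t0 kap kap0; have [C C0 hC] := @powR_taylor R (- q).
have b0 : 0 < 1 + dl * t by rewrite ltr_wpDr // mulr_ge0 // ltW.
set be := 1 + dl * t in b0 *; set E := decay dl q t.
have E0 : 0 <= E := powR_ge0 _ _.
pose c := dl / be; have c0 : 0 <= c by rewrite divr_ge0 // ltW.
have K0 : 0 < 1 + E * C * c ^+ 2.
  by rewrite ltr_pwDl // mulr_ge0 ?sqr_ge0 // mulr_ge0.
exists (Num.min t (Num.min (2 * (1 + c))^-1 (kap / (1 + E * C * c ^+ 2)))).
  by rewrite !lt_min t0 divr_gt0 // invr_gt0 mulr_gt0 // ltr_pwDl.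
move=> s; rewrite lerNl !le_min => /andP[/and3P[s1 s2 s3] s0].
have bs0 : 1 <= 1 + dl * (t + s).
  by rewrite lerDl mulr_ge0 // -lerBlDl sub0r lerNl.
have bs1 : 1 + dl * (t + s) <= be by rewrite /be lerD2l ler_wpM2l // gerDl.
have bsp : 0 < 1 + dl * (t + s) := lt_le_trans ltr01 bs0.
apply/andP; split.
  rewrite /E /decay !powRN lef_pV2 ?posrE ?powR_gt0 //.
  by apply: (ge0_ler_powR q0); rewrite ?nnegrE ?(ltW b0) ?(ltW bsp).
have bE : 1 + dl * (t + s) = be * (1 + c * s) by rewrite /c /be; field; rewrite gt_eqF.
have cs : `|c * s| <= 2^-1.
  rewrite normrM (ger0_norm c0) (ler0_norm s0).
  have : 2 * (1 + c) * - s <= 1.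
    by rewrite -ler_pdivlMl ?mulr1 // mulr_gt0 // ltr_pwDl.
  have : 0 <= - s by rewrite oppr_ge0.
  clear; lra.
have cs0 : 0 <= 1 + c * s by move: cs; rewrite ler_norml => /andP[]; clear; lra.
rewrite {1}/decay bE powRM ?(ltW b0) // -/(decay dl q t) -/E.
apply: (le_trans (ler_wpM2l E0 (hC _ cs))).
have h1 : (1 + E * C * c ^+ 2) * - s <= kap.
  by rewrite mulrC -ler_pdivlMr.
have h2 : - s * ((1 + E * C * c ^+ 2) * - s) <= - s * kap.
  by rewrite ler_wpM2l // oppr_ge0.
have -> : q * dl * E / be = q * E * c by rewrite /c; ring.
clearbody c E; move: h2 (sqr_ge0 s); clear; lra.
Qed.

Lemma exp_norm_above (th : R) z : 0 < th -> z != 0 ->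
  let r := enorm z in let e := r^-1 *: z in
  quad_above (fun y => 2 - expR (- th * enorm y)) z
    ((th * expR (- th * r)) *: e)
    ((th * expR (- th * r)) *: (r^-1 *: (1%:M - e^T *m e) - th *: (e^T *m e))).
Proof.
move=> th0 zn0 r e kap kap0.
have r0 : 0 < r.
  rewrite lt_def enorm_ge0 andbT; apply: contra zn0 => /eqP r0.
  by apply/eqP; exact: enorm0_eq0.
have zE : z = r *: e by rewrite scalerA divff ?scale1r // gt_eqF.
have n2e : n2 e = 1.
  by rewrite n2Z -enorm_sqr -/r exprVn mulVf // gt_eqF // exprn_gt0.
have rn2 : n2 z = r ^+ 2 by rewrite enorm_sqr.
have rE : enorm z = r by [].
clearbody e r; rewrite rE.
set E := expR (- th * r); have E0 : 0 < E := expR_gt0 _.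
have E1 : E <= 1 by rewrite -expR0 ler_expR mulNr oppr_le0 mulr_ge0 // ltW.
pose K := th / r ^+ 2 + th ^+ 2 / r + 32 * th ^+ 3.
have K0 : 0 < K by rewrite /K !addr_gt0 // ?divr_gt0 ?mulr_gt0 ?exprn_gt0.
exists (Num.min (r / 2) (Num.min (2 * th)^-1 (kap / K))).
  by rewrite !lt_min !divr_gt0 // invr_gt0 mulr_gt0.
move=> ze; rewrite !le_min => /and3P[z1 z2 z3].
set m := enorm ze in z1 z2 z3 *; have m0 : 0 <= m := enorm_ge0 ze.
have m2 : n2 ze = m ^+ 2 by rewrite enorm_sqr.
set a := dotv e ze.
have am : `|a| <= m.
  rewrite -(@ler_pXn2r _ 2) ?nnegrE // real_normK ?num_real //.
  by rewrite -m2 -[n2 ze]mul1r -n2e dotv_sqr_le.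
have /andP[a1 a2] : - m <= a <= m by rewrite -ler_norml.
have {}z2 : 2 * th * m <= 1 by rewrite -ler_pdivlMl ?mulr1 // mulr_gt0.
pose rho := r + a; have rho0 : r / 2 <= rho by rewrite /rho; lra.
have rhop : 0 < rho by apply: lt_le_trans rho0; rewrite divr_gt0.
pose N := m ^+ 2 - a ^+ 2.
have aE : a ^+ 2 = `|a| ^+ 2 by rewrite real_normK // num_real.
have N0 : 0 <= N.
  by rewrite subr_ge0 aE lerXn2r // nnegrE.
have N1 : N <= m ^+ 2 by rewrite lerBlDr lerDl sqr_ge0.
(* |z + ze|^2 = rho^2 + N, with [N] the squared component of ze orthogonal to e; [b] is the tangent
   bound of the square root. *)
pose b := N / (2 * rho).
have b0 : 0 <= b by rewrite divr_ge0 // mulr_ge0 // ltW.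
have hr : enorm (z + ze) <= r + a + b.
  rewrite -(@ler_pXn2r _ 2) ?nnegrE ?enorm_ge0 ?(addr_ge0 (ltW rhop) b0) // enorm_sqr.
  rewrite n2D rn2 m2 zE dotvZl -/a.
  have : 2 * rho * b = N by rewrite /b; field; rewrite gt_eqF.
  by rewrite -/rho /N /rho; move: (sqr_ge0 b); clear; nra.
have br : b * r <= m ^+ 2.
  have : b * rho * 2 <= m ^+ 2.
    apply: le_trans N1; rewrite /b.
    by have -> : N / (2 * rho) * rho * 2 = N by field; rewrite gt_eqF.
  by have := ler_wpM2l b0 rho0; clear; lra.
have bm : b <= m / 2.
  rewrite -(@ler_pM2r _ r) // (le_trans br) // expr2 -mulrA ler_wpM2l //.
  by move: z1; clear; lra.
have bN : b - N / (2 * r) <= m ^+ 3 / r ^+ 2.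
  have -> : b - N / (2 * r) = b * (- a) / r.
    by rewrite /b /rho; field; rewrite (gt_eqF r0) -/rho (gt_eqF rhop).
  have -> : m ^+ 3 / r ^+ 2 = m ^+ 2 / r * m / r by field; rewrite gt_eqF.
  rewrite ler_pM2r ?invr_gt0 //.
  apply: (@le_trans _ _ (b * m)); first by rewrite ler_wpM2l // lerNl.
  by rewrite ler_wpM2r // ler_pdivlMr.
pose Y := - th * (a + b).
have Ym : `|Y| <= 2 * th * m.
  rewrite normrM normrN (gtr0_norm th0) [2 * th]mulrC -mulrA ler_pM2l //.
  rewrite (le_trans (ler_normD _ _)) // (ger0_norm b0).
  by move: am bm m0; clear; lra.
have Y1 := le_trans Ym z2.
have := expR_taylor3 Y1; rewrite ler_distl => /andP[hY _].
have step1 : 2 - expR (- th * enorm (z + ze)) <= 2 - E * expR Y.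
  rewrite lerD2l lerN2 -expRD ler_expR /Y !mulNr -opprD lerN2 -mulrDr ler_pM2l //.
  by move: hr; clear; lra.
apply: (le_trans step1).
have hY' : E * (1 + Y + Y ^+ 2 / 2 - 4 * `|Y| ^+ 3) <= E * expR Y by rewrite ler_pM2l.
have Y3 : `|Y| ^+ 3 <= 8 * (th ^+ 3 * m ^+ 3).
  have -> : 8 * (th ^+ 3 * m ^+ 3) = (2 * th * m) ^+ 3 by ring.
  by apply: lerXn2r; rewrite ?nnegrE // !mulr_ge0 // ltW.
have abm : - (a * b) <= m ^+ 3 / r.
  apply: (@le_trans _ _ (m * b)); first by rewrite -mulNr ler_wpM2r // lerNl.
  have -> : m ^+ 3 / r = m * (m ^+ 2 / r) by field; rewrite gt_eqF.
  by rewrite ler_wpM2l // ler_pdivlMr.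
have KE : K * m ^+ 3 = th * (m ^+ 3 / r ^+ 2) + th ^+ 2 * (m ^+ 3 / r) + 32 * (th ^+ 3 * m ^+ 3).
  by rewrite /K; field; rewrite gt_eqF.
have Km : K * m ^+ 3 <= kap * m ^+ 2.
  have -> : K * m ^+ 3 = K * m * m ^+ 2 by ring.
  by rewrite ler_wpM2r ?sqr_ge0 // mulrC -ler_pdivlMr.
have core : - (Y + Y ^+ 2 / 2 - 4 * `|Y| ^+ 3) <=
    th * a + th * (N / (2 * r) - th * a ^+ 2 / 2) + kap * m ^+ 2.
  apply: le_trans (lerD (lexx _) Km); rewrite KE.
  have h1 := ler_wpM2l (ltW th0) bN.
  have h2 := ler_wpM2l (sqr_ge0 th) abm.
  have h3 : 0 <= th ^+ 2 * b ^+ 2 by rewrite mulr_ge0 // sqr_ge0.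
  move: h1 h2 h3 Y3; rewrite /Y.
  move: (m ^+ 3 / r ^+ 2) (m ^+ 3 / r) (th ^+ 3 * m ^+ 3) (N / (2 * r)) (`|_| ^+ 3).
  clear => w1 w2 w3 w4 w5; lra.
have qE : qf ((th * E) *: (r^-1 *: (1%:M - e^T *m e) - th *: (e^T *m e))) ze / 2 =
    E * (th * (N / (2 * r) - th * a ^+ 2 / 2)).
  rewrite qfZX qfDX qfNX !qfZX qfDX qfNX qf_scalar !qf_outer mul1r m2 -/a /N.
  by field; rewrite gt_eqF.
rewrite qE dotvZl -/a -/E m2.
have : E * (- (Y + Y ^+ 2 / 2 - 4 * `|Y| ^+ 3)) <=
    E * (th * a + th * (N / (2 * r) - th * a ^+ 2 / 2) + kap * m ^+ 2).
  by rewrite ler_pM2l.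
have : E * (kap * m ^+ 2) <= kap * m ^+ 2.
  by rewrite ler_piMl // mulr_ge0 ?sqr_ge0 // ltW.
move: hY'; clearbody E.
move: (N / (2 * r)) (`|_| ^+ 3) (Y ^+ 2) (kap * m ^+ 2) => w1 w2 w3 w4.
clear; lra.
Qed.

End Profiles.

(** * The decaying Lyapunov profile and the reflection coupling *)

Section Profile.
Context {R : realType}.
Variable n : nat.
Implicit Types (x z p : 'rV[R]_n).

Lemma quad_above_scalar (f : 'rV[R]_n -> R) x p (Z r : R) : 0 < r ->
  (forall z, enorm z <= r -> f (x + z) <= f x + dotv p z + Z * n2 z) ->
  quad_above f x p (2 * Z)%:M.
Proof.
move=> r0 h kap kap0; exists r => // z zr; apply: (le_trans (h z zr)).
have := mulr_ge0 (ltW kap0) (n2_ge0 z); rewrite qf_scalar; clear; lra.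
Qed.

(* The second branch is only a supersolution where it is the smaller one: there
   weight `^ ((2 - gamma) / 4) <= 1 + dl * t when q = (abar - a) / ((2 - gamma) / 4),
   so that the drift absorbs the time derivative. *)
Definition profile (R0 a abar dl q t : R) x : R :=
  Num.min (weight R0 x `^ a) (decay dl q t * weight R0 x `^ abar).

Lemma decay_le1 (dl q t : R) : 0 <= dl -> 0 <= q -> 0 <= t -> decay dl q t <= 1.
Proof.
move=> dl0 q0 t0; rewrite /decay -[leRHS](powRr0 (1 + dl * t)) ler_powR ?oppr_le0 //.
by rewrite lerDl mulr_ge0.
Qed.

Lemma decay_gt0 (dl q t : R) : 0 <= dl -> 0 <= t -> 0 < decay dl q t.
Proof. by move=> dl0 t0; rewrite powR_gt0 // ltr_pwDl // mulr_ge0. Qed.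

(** The smaller branch touches the profile from above, so its jet is a jet of the minimum. For the
    decaying branch, dl <= c2 / (2 q) lets the time derivative take at most half of the drift
    gain. *)
Lemma profile_super (R0 gamma alpha a abar Lam : R) :
  0 < gamma < 2 -> 0 < alpha -> 0 <= R0 -> 0 <= Lam ->
  (2 - gamma) / 4 < a -> a < abar ->
  let e := a - (2 - gamma) / 4 in let q := (abar - a) / ((2 - gamma) / 4) in
  exists c C dl0 : R, [/\ 0 < c, 0 <= C, 0 < dl0 &
    forall dl t x be, 0 < dl -> dl <= dl0 -> 0 < t ->
    (R0 <= enorm x -> alpha * enorm x `^ gamma <= dotv be x) ->
    exists tau p Z, [/\ 0 <= Z,
      upper_jet (profile R0 a abar dl q) t x tau p (2 * Z)%:M &
      decay dl q t * (c * weight R0 x `^ e - C) <= tau + dotv p be - 2 * Z * Lam]].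
Proof.
move=> /andP[g0 g2] al0 R00 L0 aeta aab e q.
set eta := (2 - gamma) / 4 in aeta e q *.
have eta0 : 0 < eta by rewrite divr_gt0 // subr_gt0.
have a0 : 0 < a := lt_trans eta0 aeta.
have e0 : 0 < e by rewrite subr_gt0.
have q0 : 0 < q by rewrite divr_gt0 // subr_gt0.
have [c1 [C1 [c10 C10 H1]]] := @weight_super R n a R0 gamma alpha Lam a0 g0 al0 R00 L0 e0.
have ab0 : 0 < abar := lt_trans a0 aab.
have eb0 : 0 < abar - eta by rewrite subr_gt0 (lt_trans aeta).
have [c2 [C2 [c20 C20 H2]]] :=
  @weight_super R n abar R0 gamma alpha Lam ab0 g0 al0 R00 L0 eb0.
rewrite -/eta -/e in H1 H2.
pose m1 := ((C1 / c1) `^ e^-1) `^ (abar - a).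
have m10 : 0 <= m1 := powR_ge0 _ _.
exists (Num.min c1 (c2 / 2)), (C1 + C1 * m1 + C2), (c2 / (2 * q)); split.
- by rewrite lt_min c10 divr_gt0.
- by rewrite !addr_ge0 // mulr_ge0.
- by rewrite divr_gt0 // mulr_gt0.
move=> dl t x be dlp dlle t0 hbe.
set E := decay dl q t.
have E1 : E <= 1 := decay_le1 (ltW dlp) (ltW q0) (ltW t0).
have E0 : 0 < E := decay_gt0 q (ltW dlp) (ltW t0).
set P := weight R0 x; have P1 : 1 <= P := weight_ge1 R0 x.
have P0 : 0 < P := weight_gt0 R0 x.
have Pe0 : 0 <= P `^ e := powR_ge0 _ _.
have Ppow (s : R) : P `^ a * P `^ s = P `^ (a + s).
  by rewrite -powRD // (gt_eqF P0) implybT.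
have cle1 : Num.min c1 (c2 / 2) <= c1 by rewrite ge_min lexx.
have cle2 : Num.min c1 (c2 / 2) <= c2 / 2 by rewrite ge_min lexx orbT.
set c := Num.min c1 _ in cle1 cle2 *; set C := C1 + _ + _.
case: (leP (P `^ a) (E * P `^ abar)) => cmp.
  have [p [Z [r [Z0 r0 hl hop]]]] := H1 x be hbe.
  exists 0, p, Z; split=> //.
    apply: (@uj_touch _ _ 1 _ (fun _ y => weight R0 y `^ a)) => //.
      move=> s z _ _; rewrite /profile -/E -/P [X in _ - X]min_l // lerD2r.
      by rewrite ge_min lexx.
    by apply: uj_static; exact: quad_above_scalar r0 hl.
  rewrite add0r; apply: le_trans hop; rewrite -/P.
  have hc : c * P `^ e <= c1 * P `^ e by rewrite ler_wpM2r.
  have Cm0 : 0 <= C1 * m1 by rewrite mulr_ge0.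
  case: (leP C1 (c1 * P `^ e)) => h.
    apply: (@le_trans _ _ (E * (c1 * P `^ e - C1))).
      by rewrite ler_pM2l // /C; move: hc Cm0 C20; clear; lra.
    by rewrite ler_piMl // subr_ge0.
  (* The first branch carries no decay, yet its loss must be a multiple of [E]. Where there is a
     loss, P is bounded, and minimality of this branch gives 1 <= E P^(abar - a) <= E m1. *)
  have Em : 1 <= E * m1.
    have : 1 <= E * P `^ (abar - a).
      rewrite -(@ler_pM2l _ (P `^ a)) ?powR_gt0 // mulr1 mulrCA Ppow.
      by rewrite addrC subrK.
    move=> /le_trans; apply; rewrite ler_pM2l // /m1.
    have ba : 0 <= abar - a by rewrite subr_ge0 ltW.
    apply: (ge0_ler_powR ba); rewrite ?nnegrE ?powR_ge0 ?(ltW P0) //.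
    have -> : P = (P `^ e) `^ e^-1.
      by rewrite -powRrM divff ?powRr1 ?(ltW P0) // gt_eqF.
    have ei0 : 0 <= e^-1 by rewrite invr_ge0 ltW.
    apply: (ge0_ler_powR ei0); rewrite ?nnegrE ?divr_ge0 ?(ltW c10) //.
    by rewrite ler_pdivlMr // mulrC ltW.
  apply: (@le_trans _ _ (- C1)); last by rewrite lerDr mulr_ge0 // ltW.
  apply: (@le_trans _ _ (E * - (C1 * m1))).
    by rewrite ler_pM2l // /C; move: hc h C20; clear; lra.
  by rewrite mulrN lerN2 mulrCA ler_peMr.
have [p [Z [r [Z0 r0 hl hop]]]] := H2 x be hbe.
pose f (y : 'rV[R]_n) := weight R0 y `^ abar.
exists (- (q * dl * E / (1 + dl * t)) * f x), (E *: p), (E * Z); split.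
- by rewrite mulr_ge0 // ltW.
- apply: (@uj_touch _ _ 1 _ (fun s y => decay dl q s * f y)) => //.
    move=> s z _ _; rewrite /profile -/E -/P [X in _ - X]min_r ?(ltW cmp) //.
    by rewrite lerD2r ge_min lexx orbT.
  have -> : (2 * (E * Z))%:M = E *: (2 * Z)%:M :> 'M[R]_n.
    by rewrite scale_scalar_mx mulrCA.
  apply: uj_prod; rewrite ?(ltW E0) ?powR_ge0 //.
    exact: (decay_left_above (ltW dlp) (ltW q0) t0).
  exact: quad_above_scalar r0 hl.
have b0 : 0 < 1 + dl * t by rewrite ltr_pwDl // mulr_ge0 ?(ltW dlp) // ltW.
have Pb : P `^ abar / (1 + dl * t) <= P `^ (abar - eta).
  rewrite ler_pdivrMr //.
  have -> : P `^ abar = P `^ (abar - eta) * P `^ eta.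
    by rewrite -powRD ?subrK // (gt_eqF P0) implybT.
  rewrite ler_wpM2l ?powR_ge0 //.
  have h1 : P `^ (abar - a) <= (1 + dl * t) `^ q.
    have : E * P `^ (abar - a) <= 1.
      rewrite -(@ler_pM2l _ (P `^ a)) ?powR_gt0 // mulr1 mulrCA Ppow.
      by rewrite addrC subrK ltW.
    rewrite /E /decay powRN mulrC ler_pdivrMr ?mul1r //.
    by rewrite powR_gt0.
  have qi : 0 <= q^-1 by rewrite invr_ge0 ltW.
  have := ge0_ler_powR qi _ _ h1; rewrite !nnegrE !powR_ge0 => /(_ isT isT).
  rewrite -!powRrM divff ?gt_eqF // powRr1 ?(ltW b0) //.
  have -> // : (abar - a) / q = eta.
  rewrite /q; field; rewrite !gt_eqF ?subr_gt0 //.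
have PP : P `^ e <= P `^ (abar - eta).
  by rewrite ler_powR // lerD2r ltW.
have {}dlle : q * dl <= c2 / 2.
  have -> : c2 / 2 = q * (c2 / (2 * q)) by field; rewrite gt_eqF.
  by rewrite ler_pM2l.
rewrite dotvZl /f -/P.
have -> : - (q * dl * E / (1 + dl * t)) * P `^ abar + E * dotv p be - 2 * (E * Z) * Lam =
   E * (dotv p be - 2 * Z * Lam - q * dl * (P `^ abar / (1 + dl * t))) by ring.
rewrite ler_pM2l //.
have k1 : q * dl * (P `^ abar / (1 + dl * t)) <= c2 / 2 * P `^ (abar - eta).
  by apply: ler_pM => //; rewrite ?divr_ge0 ?powR_ge0 ?(ltW b0) // mulr_ge0 // ltW.
have k2 : c * P `^ e <= c2 / 2 * P `^ (abar - eta).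
  by apply: le_trans (ler_wpM2r Pe0 cle2) _; rewrite ler_pM2l // divr_gt0.
have Cm0 : 0 <= C1 * m1 by rewrite mulr_ge0.
move: k1 k2 hop C10 Cm0; rewrite /C -/P; clear; lra.
Qed.

Lemma sum_n2_cov l (J : finType) (S : J -> 'rV[R]_n) (lam : R) (Sg : 'M[R]_(n, l)) :
  (forall v, \sum_j dotv v (S j) ^+ 2 = lam * n2 v + n2 (v *m Sg)) ->
  \sum_j n2 (S j) = lam * n%:R + enorm Sg ^+ 2.
Proof.
move=> hS.
have -> : \sum_j n2 (S j) = \sum_i \sum_j dotv (delta_mx 0 i) (S j) ^+ 2.
  rewrite exchange_big; apply: eq_bigr => j _; apply: eq_bigr => i _.
  by rewrite dotvC dotv_delta expr2.
rewrite (eq_bigr (fun i => lam + n2 (row i Sg))); last first.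
  by move=> i _; rewrite hS rowE /n2 dotv_delta mxE !eqxx mulr1.
rewrite big_split /= sumr_const card_ord mulr_natr; congr (_ + _).
rewrite /enorm sqr_sqrtr; last by apply: sumr_ge0 => i _; apply: sumr_ge0 => j _; rewrite sqr_ge0.
by apply: eq_bigr => i _; apply: eq_bigr => j _; rewrite mxE expr2.
Qed.

(* Reflection coupling for the nondegenerate part, synchronous coupling for Sigma. *)
Definition reflected l (lam : R) (e : 'rV[R]_n) (Sg : 'M[R]_(n, l)) (j : 'I_n + 'I_l) : 'rV[R]_n :=
  match j with
  | inl i => Num.sqrt lam *: (delta_mx 0 i - (2 * e 0 i) *: e)
  | inr k => (col k Sg)^T
  end.

(** A reflection is symmetric and isometric: moved onto v, it leaves the norm unchanged. *)
Lemma sum_dotv_reflected l (lam : R) e (Sg : 'M[R]_(n, l)) v : 0 <= lam -> n2 e = 1 ->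
  \sum_j dotv v (reflected lam e Sg j) ^+ 2 = lam * n2 v + n2 (v *m Sg).
Proof.
move=> lam0 e1; pose w := v - (2 * dotv v e) *: e.
have -> : n2 v = n2 w by rewrite n2B n2Z dotvZr e1; ring.
have := sum_dotv_Acol Sg v lam0; rewrite !big_sumType /= => h.
have hw := sum_dotv_Acol Sg w lam0; rewrite !big_sumType /= in hw.
have E1 : \sum_(k < l) dotv v (col k Sg)^T ^+ 2 = n2 (v *m Sg).
  apply: eq_bigr => k _; rewrite -expr2; congr (_ ^+ 2).
  by rewrite mxE; apply: eq_bigr => i _; rewrite !mxE.
have E2 : \sum_(k < l) dotv w (col k Sg)^T ^+ 2 = n2 (w *m Sg).
  apply: eq_bigr => k _; rewrite -expr2; congr (_ ^+ 2).
  by rewrite mxE; apply: eq_bigr => i _; rewrite !mxE.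
rewrite E1; congr (_ + _); move: hw; rewrite E2 => /addIr <-.
apply: eq_bigr => i _; congr (_ ^+ 2).
rewrite !dotvZr dotvBr dotvZr dotvBl dotvZl !dotv_delta.
by congr (_ * _); rewrite mulrAC.
Qed.

(** The reflected noises differ by 2 sqrt(lam) e_i e, parallel to e, where only the concave part of
    the form acts. The synchronous ones differ by the columns of Sx - Sy, which the transverse part
    bounds. *)
Lemma sum_qf_reflection l (lam th r : R) e (Sx Sy : 'M[R]_(n, l)) :
  0 <= lam -> n2 e = 1 -> 0 <= r ->
  \sum_j qf (r^-1 *: (1%:M - e^T *m e) - th *: (e^T *m e))
    (Acol lam Sx j - reflected lam e Sy j) <=
  - (4 * lam * th) + r^-1 * enorm (Sx - Sy) ^+ 2 - th * n2 (e *m (Sx - Sy)).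
Proof.
move=> lam0 e1 r0; rewrite big_sumType /= -addrA; apply: lerD.
  rewrite (eq_bigr (fun i => - (4 * lam * th) * (e 0 i * e 0 i))); last first.
    move=> i _.
    have -> : Num.sqrt lam *: delta_mx 0 i -
        Num.sqrt lam *: (delta_mx 0 i - (2 * e 0 i) *: e) =
        (Num.sqrt lam * (2 * e 0 i)) *: e.
      by rewrite -scalerBr subKr scalerA.
    rewrite qfZ exprMn sqr_sqrtr //.
    by rewrite qfDX qfNX !qfZX qfDX qfNX qf_scalar !qf_outer -/(n2 e) e1; ring.
  by rewrite -mulr_sumr -/(dotv e e) -/(n2 e) e1 mulr1.
have -> : enorm (Sx - Sy) ^+ 2 = \sum_(k < l) n2 (col k (Sx - Sy))^T.
  rewrite /enorm sqr_sqrtr; last by apply: sumr_ge0 => i _; apply: sumr_ge0 => j _; rewrite sqr_ge0.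
  rewrite exchange_big; apply: eq_bigr => k _.
  by apply: eq_bigr => i _; rewrite !mxE expr2.
have -> : n2 (e *m (Sx - Sy)) = \sum_(k < l) dotv e (col k (Sx - Sy))^T ^+ 2.
  apply: eq_bigr => k _; rewrite -expr2; congr (_ ^+ 2).
  by rewrite mxE; apply: eq_bigr => i _; rewrite !mxE.
rewrite !mulr_sumr -sumrB; apply: ler_sum => k _; rewrite -linearB -linearB /=.
rewrite qfDX qfNX !qfZX qfDX qfNX qf_scalar !qf_outer mul1r.
set w := n2 _; have : 0 <= r^-1 * dotv e (col k (Sx - Sy))^T ^+ 2.
  by rewrite mulr_ge0 ?invr_ge0 ?sqr_ge0.
clear; lra.
Qed.

End Profile.

(** * The supersolution for the doubled equation *)

Section Supersolution.
Context {R : realType}.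

(** The jet is taken from above because g serves as an explicit test function: by [super_touch] the
    same inequality passes to any function that g touches from above. *)
Definition super n (J : finType) (be : 'rV[R]_n) (S : J -> 'rV[R]_n)
    (g : R -> 'rV[R]_n -> R) (t : R) z (c : R) :=
  exists tau p Q, upper_jet g t z tau p Q /\
    c <= tau + dotv p be - \sum_j qf Q (S j).

Section Calculus.
Variables (n : nat) (J : finType) (be : 'rV[R]_n) (S : J -> 'rV[R]_n) (t : R) (z : 'rV[R]_n).
Implicit Types g h : R -> 'rV[R]_n -> R.

Lemma super_add g h (c c' : R) : super be S g t z c -> super be S h t z c' ->
  super be S (fun t z => g t z + h t z) t z (c + c').
Proof.
move=> [t1 [p1 [Q1 [j1 h1]]]] [t2 [p2 [Q2 [j2 h2]]]].
exists (t1 + t2), (p1 + p2), (Q1 + Q2); split; first exact: uj_add.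
rewrite dotvDl; under eq_bigr do rewrite qfDX.
by rewrite big_split /=; move: h1 h2; clear; lra.
Qed.

Lemma super_scale g (a c : R) : 0 <= a -> super be S g t z c ->
  super be S (fun t z => a * g t z) t z (a * c).
Proof.
move=> a0 [t1 [p1 [Q1 [j1 h1]]]].
exists (a * t1), (a *: p1), (a *: Q1); split; first exact: uj_scale.
rewrite dotvZl; under eq_bigr do rewrite qfZX.
by rewrite -mulr_sumr -mulrDr -mulrBr ler_wpM2l.
Qed.

Lemma super_time (K : R) : super be S (fun s _ => K * s) t z K.
Proof.
exists K, 0, 0; split; last by rewrite dotv0l big1 ?addr0 ?subr0 // => j _; exact: qf0X.
apply: uj_time => kap kap0; exists 1 => // s /andP[_ s0].
by rewrite mulrDr lerDl oppr_ge0 mulr_ge0_le0 // ltW.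
Qed.

Lemma super_touch g h (d c : R) : 0 < d ->
  (forall s ze, - d <= s <= 0 -> enorm ze <= d ->
    g (t + s) (z + ze) - g t z <= h (t + s) (z + ze) - h t z) ->
  super be S h t z c -> super be S g t z c.
Proof.
move=> d0 H [t1 [p1 [Q1 [j1 h1]]]]; exists t1, p1, Q1; split=> //.
exact: uj_touch d0 H j1.
Qed.

End Calculus.

Lemma super_pull m n (J : finType) (M : 'M[R]_(m, n)) (L : 'rV[R]_m -> 'rV[R]_n)
    be (S : J -> 'rV[R]_m) g (t : R) z (c : R) : (forall z, L z = z *m M) ->
  super (L be) (fun j => L (S j)) g t (L z) c ->
  super be S (fun t z => g t (L z)) t z c.
Proof.
move=> LM [t1 [p1 [Q1 [j1 h1]]]].
exists t1, (p1 *m M^T), (M *m Q1 *m M^T); split.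
  have -> : (fun t z => g t (L z)) = (fun t z => g t (z *m M)).
    by apply/funext => s; apply/funext => y; rewrite LM.
  by apply: uj_pull; rewrite -LM.
rewrite dotv_mulr trmxK -LM; under eq_bigr do rewrite qf_mul -LM.
exact: h1.
Qed.

Lemma lsubmx_mul n (z : 'rV[R]_(n + n)) : lsubmx z = z *m col_mx 1%:M 0.
Proof. by rewrite -{2}(hsubmxK z) mul_row_col mulmx1 mulmx0 addr0. Qed.

Lemma rsubmx_mul n (z : 'rV[R]_(n + n)) : rsubmx z = z *m col_mx 0 1%:M.
Proof. by rewrite -{2}(hsubmxK z) mul_row_col mulmx1 mulmx0 add0r. Qed.

Lemma subsubmx_mul n (z : 'rV[R]_(n + n)) :
  lsubmx z - rsubmx z = z *m col_mx 1%:M (- 1%:M).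
Proof. by rewrite -{3}(hsubmxK z) mul_row_col mulmx1 mulmxN mulmx1. Qed.

Lemma super_scalar n (J : finType) be (S : J -> 'rV[R]_n) g (t tau Lam Z c : R) z p :
  0 <= Z -> \sum_j n2 (S j) <= Lam -> upper_jet g t z tau p (2 * Z)%:M ->
  c <= tau + dotv p be - 2 * Z * Lam -> super be S g t z c.
Proof.
move=> Z0 hS jg hc; exists tau, p, (2 * Z)%:M; split=> //; apply: (le_trans hc).
under eq_bigr do rewrite qf_scalar.
by rewrite -mulr_sumr lerD2l lerN2 ler_wpM2l // mulr_ge0.
Qed.

(** In units of phi' = th exp(- th r), reflection gains 4 lam th = c0 + K + 1, the drift costs c0
    and Sigma costs K, leaving 1. The time derivative of the decay costs at most 2 q dl since phi <=
    2. *)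
Lemma super_exp_norm n l (lam th c0 K dl q t : R) (be z : 'rV[R]_n)
    (Sx Sy : 'M[R]_(n, l)) :
  0 <= lam -> 0 < th -> 4 * lam * th = c0 + K + 1 -> 0 <= dl -> 0 <= q -> 0 < t ->
  z != 0 -> - c0 * enorm z <= dotv be z -> enorm (Sx - Sy) ^+ 2 <= K * enorm z ->
  super be (fun j => Acol lam Sx j - reflected lam ((enorm z)^-1 *: z) Sy j)
    (fun s y => decay dl q s * (2 - expR (- th * enorm y))) t z
    (decay dl q t * (th * expR (- th * enorm z) - 2 * (q * dl))).
Proof.
move=> lam0 th0 thE dl0 q0 t0 zn0 hbe hS.
have r0 : 0 < enorm z.
  rewrite lt_def enorm_ge0 andbT; apply: contra zn0 => /eqP r0.
  by apply/eqP; exact: enorm0_eq0.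
have jf := exp_norm_above th0 zn0; rewrite /= in jf.
set r := enorm z in r0 hbe hS jf *; set e := r^-1 *: z in jf *.
have n2e : n2 e = 1.
  by rewrite n2Z -enorm_sqr -/r exprVn mulVf // gt_eqF // exprn_gt0.
have jT := decay_left_above dl0 q0 t0.
have E0 : 0 < decay dl q t := decay_gt0 q dl0 (ltW t0).
set X := expR (- th * r) in jf *; have X0 : 0 < X := expR_gt0 _.
have X1 : X <= 1 by rewrite -expR0 ler_expR mulNr oppr_le0 mulr_ge0 // ltW.
have f0 : 0 <= 2 - X by lra.
have jj := uj_prod (ltW E0) f0 jT jf.
eexists _, _, _; split; first exact: jj.
set E := decay dl q t in E0 *.
have b1 : 1 <= 1 + dl * t by rewrite lerDl mulr_ge0 // ltW.
have htau : - (E * (2 * (q * dl))) <= - (q * dl * E / (1 + dl * t)) * (2 - X).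
  have qd : 0 <= q * dl * E by rewrite !mulr_ge0 // ltW.
  have : q * dl * E / (1 + dl * t) <= q * dl * E.
    by rewrite ler_pdivrMr ?(lt_le_trans ltr01 b1) // ler_peMr.
  have : 0 <= q * dl * E / (1 + dl * t) by rewrite divr_ge0 // (le_trans ler01).
  have -> : E * (2 * (q * dl)) = 2 * (q * dl * E) by ring.
  move: X0 X1; move: (q * dl * E) (q * dl * E / _); clear => A B; nra.
rewrite !dotvZl; under eq_bigr do rewrite !qfZX.
rewrite -!mulr_sumr.
set Sm := \sum_j _.
have hSm : Sm <= - (4 * lam * th) + K.
  apply: (le_trans (sum_qf_reflection th Sx Sy lam0 n2e (ltW r0))).
  have : r^-1 * enorm (Sx - Sy) ^+ 2 <= K by rewrite mulrC ler_pdivrMr.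
  have := mulr_ge0 (ltW th0) (n2_ge0 (e *m (Sx - Sy))).
  clear; lra.
clearbody Sm.
have hdr : - c0 <= r^-1 * dotv z be by rewrite mulrC ler_pdivlMr // dotvC.
have key : E * (th * X) <= E * (th * X * (r^-1 * dotv z be) - th * X * Sm).
  rewrite ler_pM2l // -mulrBr ler_peMr ?mulr_ge0 ?(ltW th0) ?(ltW X0) //.
  move: hSm hdr thE; move: (r^-1 * _) Sm; clear => w1 w2; lra.
rewrite -/r -/X; clear hSm; move: key htau; move: (- _ * (2 - X)) (r^-1 * _) Sm; clear => w1 w2 w3; lra.
Qed.

End Supersolution.

(** * The complete barrier *)

Section Barrier.
Context {R : realType}.

(* The last summand forces the maxima of u(t, x) - u(t, y) - barrier to exist. *)
Definition barrier n (R0 a abar dl q th B A0 eps mm Cm t : R) (z : 'rV[R]_(n + n)) : R :=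
  A0 * (profile R0 a abar dl q t (lsubmx z) + profile R0 a abar dl q t (rsubmx z)
    + B * (decay dl q t * (2 - expR (- th * enorm (lsubmx z - rsubmx z)))))
  + eps * (weight R0 (lsubmx z) `^ mm + weight R0 (rsubmx z) `^ mm + 2 * Cm * t).

Lemma excess_weight n R0 (x : 'rV[R]_n) : excess R0 x <= weight R0 x.
Proof.
have := sqr_ge0 (excess R0 x - 1); have := excess_ge0 R0 x.
by rewrite /weight; move: (excess R0 x); clear => w; nra.
Qed.

Lemma enorm_mxvec m n (A : 'M[R]_(m, n)) : enorm (mxvec A) = enorm A.
Proof.
congr Num.sqrt; rewrite big_ord1 pair_bigA /= (reindex _ (curry_mxvec_bij m n)) /=.
by apply: eq_bigr => -[i j] _ /=; rewrite mxvecE.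
Qed.

Lemma enormB_mx m n (A B : 'M[R]_(m, n)) : enorm (A - B) <= enorm A + enorm B.
Proof. by rewrite -[leLHS]enorm_mxvec -(enorm_mxvec A) -(enorm_mxvec B) linearB enormB. Qed.

Lemma barrier_super n (lam s0 s1 gamma alpha R0 c0 a abar : R) :
  0 < lam -> 0 < gamma < 2 -> 0 < alpha -> 0 <= R0 -> 0 < c0 ->
  (2 - gamma) / 4 < a -> a < abar ->
  let q := (abar - a) / ((2 - gamma) / 4) in
  exists dl th B : R, [/\ 0 < dl, 0 < th, 0 <= B &
    forall mm, (2 - gamma) / 4 < mm -> exists2 Cm : R, 0 <= Cm &
    forall l (Sg : 'rV[R]_n -> 'M[R]_(n, l)) (b : R -> 'rV[R]_n -> 'rV[R]_n),
    (forall x, enorm (Sg x) <= s0) ->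
    (forall x y, enorm (Sg x - Sg y) <= s1 * enorm (x - y)) ->
    (forall t x, 0 < t -> R0 <= enorm x -> alpha * enorm x `^ gamma <= dotv (b t x) x) ->
    (forall t x y, 0 < t ->
      - c0 * enorm (x - y) <= dotv (b t x - b t y) (x - y)) ->
    forall A0 eps t x y, 0 < A0 -> 0 <= eps -> 0 < t -> x != y -> exists2 c : R, 0 < c &
      super (row_mx (b t x) (b t y))
        (fun j => row_mx (Acol lam (Sg x) j)
          (reflected lam ((enorm (x - y))^-1 *: (x - y)) (Sg y) j))
        (barrier R0 a abar dl q th B A0 eps mm Cm) t (row_mx x y) c].
Proof.
move=> lam0 g02 al0 R00 c00 ha aab q.
pose Lam := lam * n%:R + s0 ^+ 2.
have Lam0 : 0 <= Lam by rewrite addr_ge0 ?sqr_ge0 // mulr_ge0 // ltW.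
have [c [C [dl0 [cp C0 dl00 HF]]]] := @profile_super R n R0 gamma alpha a abar Lam
  g02 al0 R00 Lam0 ha aab.
have e0 : 0 < a - (2 - gamma) / 4 by rewrite subr_gt0.
have q0 : 0 < q.
  by move: g02 => /andP[_ g2]; rewrite divr_gt0 ?subr_gt0 // divr_gt0 // subr_gt0.
rewrite -/q in HF.
set e := a - _ in e0 HF.
pose K := `|2 * s0 * s1|; have K0 : 0 <= K := normr_ge0 _.
pose th := (c0 + K + 1) / (4 * lam).
have th0 : 0 < th by rewrite divr_gt0 ?mulr_gt0 // addr_gt0 // ltr_pwDl.
have thE : 4 * lam * th = c0 + K + 1 by rewrite /th; field; rewrite gt_eqF.
pose P0 := ((2 * C + 1) / c) `^ e^-1.
have P00 : 0 <= P0 := powR_ge0 _ _.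
pose rho := Num.sqrt (R0 ^+ 2 + P0).
have C1 : 0 < 2 * C + 1 by rewrite ltr_wpDl // mulr_ge0.
(* The profiles may lose 2 C in total. If one weight exceeds [P0], its own gain is at least 2 C + 1;
   otherwise both points lie in the ball of radius [rho], and this [B] makes the distance term gain
   as much. *)
pose B := (2 * C + 1) * expR (th * (2 * rho)) / th.
have B0 : 0 < B by rewrite divr_gt0 // mulr_gt0 ?expR_gt0.
have BE : B * th = (2 * C + 1) * expR (th * (2 * rho)).
  by rewrite /B; field; rewrite gt_eqF.
have Pe : (2 * C + 1) / c = P0 `^ e.
  by rewrite /P0 -powRrM mulVf ?gt_eqF // powRr1 // divr_ge0 // ltW.
clearbody B P0 q.
(* The time derivative of the distance term then costs at most 1/2, less than the margin 1 left
   above. *)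
pose dl := Num.min dl0 (4 * (B * q))^-1.
have dlp : 0 < dl by rewrite lt_min dl00 invr_gt0 !mulr_gt0.
have dlle : dl <= dl0 by rewrite ge_min lexx.
have dlB : 4 * (B * q) * dl <= 1.
  by rewrite -ler_pdivlMl ?mulr1 ?ge_min ?lexx ?orbT // !mulr_gt0.
exists dl, th, B; split=> //; first exact: ltW.
clearbody dl th.
move=> mm hmm; have mmp : 0 < mm.
  by apply: lt_trans hmm; rewrite divr_gt0 // subr_gt0; case/andP: g02.
have emm : 0 < mm - (2 - gamma) / 4 by rewrite subr_gt0.
have gp : 0 < gamma by case/andP: g02.
have [cm [Cm [cm0 Cm0 HG]]] := @weight_super R n mm R0 gamma alpha Lam mmp gp al0 R00 Lam0 emm.
exists Cm => // l Sg b hS hL hb hmon A0 eps t x y A00 eps0 t0 xy.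
have xyn : x - y != 0 by rewrite subr_eq0.
set r := enorm (x - y); set ev := r^-1 *: (x - y).
have r0 : 0 < r.
  rewrite lt_def enorm_ge0 andbT; apply: contra xyn => /eqP r0.
  by apply/eqP; exact: enorm0_eq0.
have n2e : n2 ev = 1.
  by rewrite n2Z -enorm_sqr -/r exprVn mulVf // gt_eqF // exprn_gt0.
have s00 : 0 <= s0 := le_trans (enorm_ge0 _) (hS x).
have cov1 : \sum_j n2 (Acol lam (Sg x) j) <= Lam.
  by rewrite sum_n2_Acol ?(ltW lam0) // lerD2l lerXn2r // nnegrE ?enorm_ge0.
have cov2 : \sum_j n2 (reflected lam ev (Sg y) j) <= Lam.
  rewrite (sum_n2_cov (fun v => sum_dotv_reflected (Sg y) v (ltW lam0) n2e)).
  by rewrite lerD2l lerXn2r // nnegrE ?enorm_ge0.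
have hK : enorm (Sg x - Sg y) ^+ 2 <= K * r.
  apply: (@le_trans _ _ (2 * s0 * (s1 * r))).
    rewrite expr2; apply: ler_pM; rewrite ?enorm_ge0 // ?hL //.
    by apply: (le_trans (enormB_mx _ _)); have := hS x; have := hS y; lra.
  by rewrite mulrA /K ler_pM2r // ler_norm.
have E0 : 0 < decay dl q t := decay_gt0 q (ltW dlp) (ltW t0).
set E := decay dl q t in E0 *.
set Px := weight R0 x `^ e; set Py := weight R0 y `^ e.
set X := expR (- th * r); have X0 : 0 < X := expR_gt0 _.
exists (A0 * (E * (c * Px - C) + E * (c * Py - C) + B * (E * (th * X - 2 * (q * dl))))
  + eps * (- Cm + - Cm + 2 * Cm)).
  rewrite (_ : - Cm + - Cm + 2 * Cm = 0) ?mulr0 ?addr0; last by ring.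
  rewrite mulr_gt0 //.
  have -> : E * (c * Px - C) + E * (c * Py - C) + B * (E * (th * X - 2 * (q * dl))) =
    E * (c * Px + c * Py - 2 * C + B * th * X - 2^-1 * (4 * (B * q) * dl)) by field.
  rewrite mulr_gt0 //.
  have cPx : 0 <= c * Px by rewrite mulr_ge0 ?powR_ge0 // ltW.
  have cPy : 0 <= c * Py by rewrite mulr_ge0 ?powR_ge0 // ltW.
  have BX : 0 <= B * th * X by rewrite !mulr_ge0 // ltW.
  have big w : P0 <= weight R0 (w : 'rV[R]_n) -> 2 * C + 1 <= c * weight R0 w `^ e.
    move=> h; rewrite [leRHS]mulrC -ler_pdivrMr //.
    by rewrite Pe; apply: (ge0_ler_powR (ltW e0)); rewrite ?nnegrE ?(ltW (weight_gt0 _ _)).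
  have small w : weight R0 (w : 'rV[R]_n) < P0 -> enorm w <= rho.
    move=> h; rewrite enormE ler_wsqrtr // -lerBlDl.
    apply: (le_trans (excess_ge _ _)); apply: (le_trans (excess_weight _ _)).
    exact: ltW.
  have [/big|/small hx] := leP P0 (weight R0 x).
    by move: cPy BX dlB; rewrite -/Px; clear; lra.
  have [/big|/small hy] := leP P0 (weight R0 y).
    by move: cPx BX dlB; rewrite -/Py; clear; lra.
  have hr : r <= 2 * rho.
    by apply: (le_trans (enormB _ _)); move: hx hy; clear; lra.
  have : 2 * C + 1 <= B * th * X.
    rewrite BE -mulrA ler_peMr ?(ltW C1) // -expRD.
    apply: le_trans (expR_ge1Dx _); rewrite lerDl mulNr -mulrBr.
    by rewrite mulr_ge0 ?(ltW th0) // subr_ge0.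
  by move: cPx cPy dlB; clear; lra.
have sF (w be : 'rV[R]_n) (S : 'I_n + 'I_l -> 'rV[R]_n) :
    (R0 <= enorm w -> alpha * enorm w `^ gamma <= dotv be w) ->
    \sum_j n2 (S j) <= Lam ->
    super be S (profile R0 a abar dl q) t w (E * (c * weight R0 w `^ e - C)).
  move=> hbe hSL; have [tau [p [Z [Z0 jF hF]]]] := HF dl t w be dlp dlle t0 hbe.
  exact: super_scalar Z0 hSL jF hF.
have sG (w be : 'rV[R]_n) (S : 'I_n + 'I_l -> 'rV[R]_n) :
    (R0 <= enorm w -> alpha * enorm w `^ gamma <= dotv be w) ->
    \sum_j n2 (S j) <= Lam ->
    super be S (fun _ z => weight R0 z `^ mm) t w (- Cm).
  move=> hbe hSL; have [p [Z [ra [Z0 ra0 jF hF]]]] := HG w be hbe.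
  apply: (super_scalar Z0 hSL (uj_static t (quad_above_scalar ra0 jF))).
  rewrite add0r; apply: le_trans hF; rewrite lerDr mulr_ge0 ?powR_ge0 //.
  exact: ltW.
have pullL g c' : super (b t x) (Acol lam (Sg x)) g t x c' ->
    super (row_mx (b t x) (b t y))
      (fun j => row_mx (Acol lam (Sg x) j) (reflected lam ev (Sg y) j))
      (fun t z => g t (lsubmx z)) t (row_mx x y) c'.
  move=> h; apply: (super_pull (@lsubmx_mul R n)).
  by under eq_fun do rewrite row_mxKl; rewrite !row_mxKl.
have pullR g c' : super (b t y) (reflected lam ev (Sg y)) g t y c' ->
    super (row_mx (b t x) (b t y))
      (fun j => row_mx (Acol lam (Sg x) j) (reflected lam ev (Sg y) j))
      (fun t z => g t (rsubmx z)) t (row_mx x y) c'.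
  move=> h; apply: (super_pull (@rsubmx_mul R n)).
  by under eq_fun do rewrite row_mxKr; rewrite !row_mxKr.
apply: super_add; apply: super_scale => //; try exact: ltW.
  apply: super_add; first apply: super_add.
  - by apply: pullL; apply: sF => //; exact: hb.
  - by apply: pullR; apply: sF => //; exact: hb.
  apply: super_scale; first exact: ltW.
  apply: (super_pull (@subsubmx_mul R n)
    (g := fun s y => decay dl q s * (2 - expR (- th * enorm y)))).
  under eq_fun do rewrite row_mxKl row_mxKr.
  rewrite !row_mxKl !row_mxKr.
  apply: super_exp_norm; rewrite ?(ltW lam0) ?(ltW dlp) ?(ltW q0) //.
  - exact: thE.
  - exact: hmon.
  - exact: hK.
apply: super_add; first apply: super_add.
- by apply: (pullL (fun _ z => weight R0 z `^ mm)); apply: sG => //; exact: hb.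
- by apply: (pullR (fun _ z => weight R0 z `^ mm)); apply: sG => //; exact: hb.
- exact: super_time.
Qed.

End Barrier.

(** * Comparison *)

Section Comparison.
Context {R : realType}.

Section Continuity.
Variable T : topologicalType.
Implicit Types f g : T -> R.

Lemma cont_comp (phi : R -> R) f : (forall x, {for f x, continuous phi}) ->
  continuous f -> continuous (fun x => phi (f x)).
Proof. by move=> cphi cf x; apply: continuous_comp; [exact: cf|exact: cphi]. Qed.

Lemma cont_powR s f : (forall x, 0 < f x) -> continuous f ->
  continuous (fun x => f x `^ s).
Proof.
move=> f0; apply: (@cont_comp (fun y => y `^ s)) => x.
apply: differentiable_continuous; apply/derivable1_diffP.
by apply: derivable_powR; rewrite in_itv /= f0.
Qed.

Lemma cont_norm f : continuous f -> continuous (fun x => `|f x|).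
Proof. by apply: (@cont_comp (fun y => `|y|)) => x; exact: norm_continuous. Qed.

Lemma cont_sub f g : continuous f -> continuous g -> continuous (fun x => f x - g x).
Proof. by move=> cf cg x; apply: cvgB; [exact: cf|exact: cg]. Qed.

Lemma cont_max0 f : continuous f -> continuous (fun x => Num.max 0 (f x)).
Proof.
move=> cf; under eq_fun do rewrite maxr_absE add0r sub0r normrN.
by apply: contM; [apply: contD => //; exact: cont_norm|exact: cont_cst].
Qed.

Lemma cont_min f g : continuous f -> continuous g ->
  continuous (fun x => Num.min (f x) (g x)).
Proof.
move=> cf cg; under eq_fun do rewrite minr_absE.
apply: contM; last exact: cont_cst.
by apply: cont_sub; [exact: contD|apply: cont_norm; exact: cont_sub].
Qed.

Lemma cont_n2 n (F : T -> 'rV[R]_n) : (forall i, continuous (fun x => F x 0 i)) ->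
  continuous (fun x => n2 (F x)).
Proof. by move=> cF; apply: cont_sum => i; exact: contM. Qed.

End Continuity.

Variable n : nat.

Lemma cont_weight_pow (T : topologicalType) (F : T -> 'rV[R]_n) R0 s :
  (forall i, continuous (fun x => F x 0 i)) ->
  continuous (fun x => weight R0 (F x) `^ s).
Proof.
move=> cF; apply: cont_powR => [x|]; first exact: weight_gt0.
apply: contD; first exact: cont_cst.
apply: contX; apply: cont_max0; apply: cont_sub; last exact: cont_cst.
exact: cont_n2.
Qed.

(** The absolute value keeps 1 + dl |t| positive, which gives continuity on the whole space; only t
    >= 0 is used. *)
Lemma continuous_barrier (R0 a abar dl q th B A0 eps mm Cm : R) : 0 <= dl ->
  continuous (fun p : R * 'rV[R]_(n + n) =>
    barrier R0 a abar dl q th B A0 eps mm Cm `|p.1| p.2).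
Proof.
move=> dl0.
have cc k : continuous (fun p : R * 'rV[R]_(n + n) => p.2 0 k).
  move=> p; apply: (@continuous_comp _ _ _ snd (fun z : 'rV[R]_(n + n) => z 0 k)).
    exact: cvg_snd.
  exact: coord_continuous.
have cl i : continuous (fun p : R * 'rV[R]_(n + n) => (lsubmx p.2) 0 i).
  by under eq_fun do rewrite mxE; exact: cc.
have cr i : continuous (fun p : R * 'rV[R]_(n + n) => (rsubmx p.2) 0 i).
  by under eq_fun do rewrite mxE; exact: cc.
have ct : continuous (fun p : R * 'rV[R]_(n + n) => `|p.1|).
  by apply: cont_norm => p; exact: cvg_fst.
have cd : continuous (fun p : R * 'rV[R]_(n + n) => decay dl q `|p.1|).
  apply: cont_powR => [p|]; first by rewrite ltr_pwDl // mulr_ge0.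
  by apply: contD; [exact: cont_cst|apply: contM => //; exact: cont_cst].
have ce : continuous (fun p : R * 'rV[R]_(n + n) =>
    expR (- th * enorm (lsubmx p.2 - rsubmx p.2))).
  apply: (@cont_comp _ expR); first by move=> p; exact: continuous_expR.
  apply: contM; first exact: cont_cst.
  under eq_fun do rewrite enormE.
  apply: (@cont_comp _ Num.sqrt); first by move=> p; exact: sqrt_continuous.
  apply: cont_n2 => i; under eq_fun do rewrite !mxE.
  by apply: (@cont_sub _ (fun p : R * 'rV[R]_(n + n) => p.2 0 _) (fun p => p.2 0 _)).
have cp (F : 'rV[R]_(n + n) -> 'rV[R]_n) :
    (forall i, continuous (fun p : R * 'rV[R]_(n + n) => (F p.2) 0 i)) ->
    continuous (fun p : R * 'rV[R]_(n + n) => profile R0 a abar dl q `|p.1| (F p.2)).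
  move=> cF; apply: cont_min; first exact: cont_weight_pow.
  by apply: contM => //; exact: cont_weight_pow.
apply: contD; apply: contM; try exact: cont_cst.
  apply: contD; first by apply: contD; exact: cp.
  apply: contM; first exact: cont_cst.
  by apply: contM => //; apply: cont_sub => //; exact: cont_cst.
apply: contD; first by apply: contD; exact: cont_weight_pow.
by apply: contM => //; exact: cont_cst.
Qed.

Lemma profile_ge0 (R0 a abar dl q t : R) (x : 'rV[R]_n) : 0 <= profile R0 a abar dl q t x.
Proof. by rewrite le_min powR_ge0 mulr_ge0 ?powR_ge0. Qed.

Lemma barrier_ge (R0 a abar dl q th B A0 eps mm Cm t : R) (x y : 'rV[R]_n) :
  0 <= th -> 0 <= B -> 0 <= A0 -> 0 <= eps -> 0 <= Cm -> 0 <= t ->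
  A0 * (profile R0 a abar dl q t x + profile R0 a abar dl q t y) +
    eps * (weight R0 x `^ mm + weight R0 y `^ mm) <=
  barrier R0 a abar dl q th B A0 eps mm Cm t (row_mx x y).
Proof.
move=> th0 B0 A00 eps0 Cm0 t0; rewrite /barrier !row_mxKl !row_mxKr.
apply: lerD; rewrite ler_wpM2l // lerDl ?mulr_ge0 ?powR_ge0 // subr_ge0.
apply: (@le_trans _ _ 1); last by rewrite lerDl.
by rewrite -[leRHS]expR0 ler_expR mulNr oppr_le0 mulr_ge0 // enorm_ge0.
Qed.

End Comparison.

(** * Maximum principle for the doubled function *)

Section MaximumPrinciple.
Context {R : realType}.

Lemma weight_growth n (R0 : R) (x : 'rV[R]_n) :
  1 + n2 x <= 2 * (1 + R0 ^+ 2) * weight R0 x.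
Proof.
have := excess_weight R0 x; have := excess_ge R0 x; have := weight_ge1 R0 x.
have := sqr_ge0 R0; move: (R0 ^+ 2) (weight R0 x) (n2 x) (excess R0 x).
clear => r w m e r0 w1 h1 h2.
have := mulr_ge0 r0 (le_trans ler01 w1); have := ler_wpM2l r0 w1; nra.
Qed.

(** The same [M] bounds the expression everywhere and its opposite for large P, so that in a sum
    over x and y one far point outweighs whatever the other contributes. *)
Lemma polynomial_absorbed (K eps : R) N : 0 <= K -> 0 < eps -> exists M X : R,
  [/\ 0 <= X, forall P, 1 <= P -> K * P ^+ N - eps * P ^+ N.+1 <= M &
    forall P, 1 <= P -> X <= P -> K * P ^+ N - eps * P ^+ N.+1 <= - M].
Proof.
move=> K0 eps0; pose M := K * (K / eps) ^+ N.
have M0 : 0 <= M by rewrite mulr_ge0 // exprn_ge0 // divr_ge0 // ltW.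
have fE P : K * P ^+ N - eps * P ^+ N.+1 = P ^+ N * (K - eps * P) by rewrite exprS; ring.
exists M, ((K + M) / eps); split.
- by rewrite divr_ge0 ?addr_ge0 // ltW.
- move=> P P1; have P0 : 0 <= P := le_trans ler01 P1; case: (leP P (K / eps)) => h.
    apply: (@le_trans _ _ (K * P ^+ N)).
      by rewrite lerBlDr lerDl mulr_ge0 ?exprn_ge0 // ltW.
    by rewrite ler_wpM2l // lerXn2r // nnegrE // divr_ge0 // ltW.
  apply: le_trans M0; rewrite fE mulr_ge0_le0 ?exprn_ge0 // subr_le0.
  by rewrite mulrC -ler_pdivrMr // ltW.
move=> P P1 h; rewrite fE.
have hP : K - eps * P <= - M.
  by move: h; rewrite ler_pdivrMr // [P * _]mulrC; lra.
apply: (@le_trans _ _ (P ^+ N * - M)).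
  by rewrite ler_wpM2l // exprn_ge0 // (le_trans ler01).
by rewrite mulrN lerN2 ler_peMl // exprn_ege1.
Qed.

Lemma max_coercive n (g : R -> 'rV[R]_(n + n) -> R) (t1 R0 K eps : R) N z1 :
  0 <= t1 -> 0 <= K -> 0 < eps -> 0 <= R0 ->
  (forall r, cont_on (cyl 0 t1 0 r) g) ->
  (forall (t : R) x y, 0 <= t <= t1 -> g t (row_mx x y) <=
    K * weight R0 x ^+ N - eps * weight R0 x ^+ N.+1 +
    (K * weight R0 y ^+ N - eps * weight R0 y ^+ N.+1)) ->
  0 < g t1 z1 ->
  exists (t0 : R) z0, [/\ 0 <= t0 <= t1, 0 < g t0 z0 &
    forall (t : R) z, 0 <= t <= t1 -> g t z <= g t0 z0].
Proof.
move=> t10 K0 eps0 R00 cg hg g1.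
have [M [X [X0 hM hX]]] := polynomial_absorbed N K0 eps0.
pose r := Num.sqrt (2 * (R0 ^+ 2 + X)).
have rr : 0 <= 2 * (R0 ^+ 2 + X) by rewrite mulr_ge0 // addr_ge0 // sqr_ge0.
have out (t : R) z : 0 <= t <= t1 -> r < enorm z -> g t z <= 0.
  move=> tI; rewrite enormE => hz.
  have {}hz : 2 * (R0 ^+ 2 + X) <= n2 z.
    by rewrite leNgt; apply/negP => h; move: hz; rewrite ltNge ler_wsqrtr // ltW.
  have Xle (w : 'rV[R]_n) : R0 ^+ 2 + X <= n2 w -> X <= weight R0 w.
    move=> h; apply: le_trans (excess_weight R0 w); apply: le_trans (excess_ge R0 w).
    by move: h; clear; lra.
  have := hg t (lsubmx z) (rsubmx z) tI; rewrite hsubmxK => /le_trans; apply.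
  have hx := weight_ge1 R0 (lsubmx z); have hy := weight_ge1 R0 (rsubmx z).
  rewrite n2_pair in hz.
  case: (leP (R0 ^+ 2 + X) (n2 (lsubmx z))) => h.
    by rewrite -(addNr M) lerD // ?hX ?hM // Xle.
  rewrite -(subrr M) lerD // ?hX ?hM // Xle //.
  by move: hz h; clear; lra.
have [t0 [z0 [z0c hmax]]] := cyl_max t10 (sqrtr_ge0 _ : 0 <= r) (cg r).
have z1c : cyl 0 t1 0 r (t1, z1).
  rewrite /cyl /= t10 lexx subr0; split=> //; rewrite leNgt; apply/negP => h.
  by have := out t1 z1 _ h; rewrite t10 lexx leNgt g1 => /(_ isT).
have g0 : 0 < g t0 z0 by apply: lt_le_trans (hmax _ _ z1c).
move: z0c; rewrite /cyl /= => -[t0I _]; exists t0, z0; split=> // t z tI.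
case: (leP (enorm z) r) => h; last by rewrite (le_trans (out t z tI h)) // ltW.
by apply: hmax; rewrite /cyl /= subr0.
Qed.

Lemma cont_on_subl n (A : set (R * 'rV[R]_(n + n))) (B : set (R * 'rV[R]_n)) u
    (L : 'rV[R]_(n + n) -> 'rV[R]_n) :
  (forall z, n2 (L z) <= n2 z) -> (forall z z', L (z - z') = L z - L z') ->
  (forall t z, A (t, z) -> B (t, L z)) -> cont_on B u ->
  cont_on A (fun t z => u t (L z)).
Proof.
move=> hL LB AB /cont_onP cu; apply/cont_onP => t z tA e e0.
have [d d0 h] := cu t (L z) (AB _ _ tA) e e0; exists d => // t' z' tA' h1 h2.
apply: h => //; first exact: AB.
by rewrite -LB; apply: le_trans h2; rewrite !enormE ler_wsqrtr.
Qed.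

(** If the difference exceeded the barrier, a positive maximum over [0, t1] would exist. It is off
    the diagonal and at a positive time, possibly [t1] itself since jets look only backwards; there
    [visc_sums] contradicts the strict inequality of [barrier_super]. *)
Lemma oscillation_decay n (lam s0 s1 gamma alpha R0 c0 a abar : R) :
  (0 < n)%N -> 0 < lam -> 0 < gamma < 2 -> 0 < alpha -> 0 <= R0 -> 0 < c0 ->
  (2 - gamma) / 4 < a -> a < abar ->
  let q := (abar - a) / ((2 - gamma) / 4) in
  exists dl B : R, [/\ 0 < dl, 0 <= B &
    forall l (Sg : 'rV[R]_n -> 'M[R]_(n, l)) (b : R -> 'rV[R]_n -> 'rV[R]_n) T
      (u : R -> 'rV[R]_n -> R) A,
    (forall x, enorm (Sg x) <= s0) ->
    (forall x y, enorm (Sg x - Sg y) <= s1 * enorm (x - y)) ->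
    {within [set p : R * 'rV[R]_n | 0 < p.1], continuous (fun p => b p.1 p.2)} ->
    (forall t x, 0 < t -> R0 <= enorm x -> alpha * enorm x `^ gamma <= dotv (b t x) x) ->
    (forall t x y, 0 < t ->
      - c0 * enorm (x - y) <= dotv (b t x - b t y) (x - y)) ->
    subsol T lam Sg b u -> subsol T lam Sg b (fun t x => - u t x) ->
    0 < A -> (forall x y, u 0 x - u 0 y <= A * (weight R0 x `^ a + weight R0 y `^ a)) ->
    forall t x y, 0 < t < T ->
      u t x - u t y <= A * (decay dl q t * (weight R0 x `^ abar + weight R0 y `^ abar + B))].
Proof.
move=> n0 lam0 g02 al0 R00 c00 ha aab q.
have [dl [th [B [dl0 th0 B0 HB]]]] := @barrier_super R n lam s0 s1 gamma alpha R0 c0 a abar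
  lam0 g02 al0 R00 c00 ha aab.
rewrite -/q in HB.
exists dl, (2 * B); split; rewrite ?mulr_ge0 //.
move=> l Sg b T u A hS hL contb hb hmon su sNu A0 hinit t1 x1 y1 /andP[t10 t1T].
have [cu [C [N hu]] _] := su.
(* The penalty exponent N + 1 beats the growth of u and is large enough for the Lyapunov
   estimate. *)
have emm : (2 - gamma) / 4 < N.+1%:R.
  apply: (@lt_le_trans _ _ 1); last by rewrite ler1n.
  by move: g02 => /andP[? ?]; rewrite ltr_pdivrMr //; lra.
have [Cm Cm0 {}HB] := HB _ emm.
pose W (eps : R) := @barrier R n R0 a abar dl q th B A eps N.+1%:R Cm.
have main (eps : R) : 0 < eps -> u t1 x1 - u t1 y1 <= W eps t1 (row_mx x1 y1).
  move=> eps0; rewrite leNgt; apply/negP => hlt.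
  pose g t z := u t (lsubmx z) - u t (rsubmx z) - W eps t z.
  have pw (w : 'rV[R]_n) : weight R0 w `^ N.+1%:R = weight R0 w ^+ N.+1.
    by rewrite powR_mulrn // ltW // weight_gt0.
  have Wge (t : R) x y : 0 <= t ->
      A * (profile R0 a abar dl q t x + profile R0 a abar dl q t y) +
      eps * (weight R0 x ^+ N.+1 + weight R0 y ^+ N.+1) <= W eps t (row_mx x y).
    move=> t0; rewrite -!pw.
    by apply: barrier_ge; rewrite ?(ltW th0) ?(ltW A0) ?(ltW eps0).
  have cg r : cont_on (cyl 0 t1 0 r) g.
    have AB (t : R) (z : 'rV[R]_(n + n)) (w : 'rV[R]_n) : cyl 0 t1 0 r (t, z) ->
        [set p : R * 'rV[R]_n | 0 <= p.1 <= T] (t, w).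
      by move=> [/= /andP[-> h] _] /=; apply: (le_trans h); exact: ltW.
    apply: cont_onB; first apply: cont_onB.
    - apply: (cont_on_subl (L := lsubmx) (B := [set p : R * 'rV[R]_n | 0 <= p.1 <= T])) => //.
      + by move=> z; rewrite [leRHS]n2_pair lerDl n2_ge0.
      + by move=> z z'; rewrite linearB.
      + by move=> t z; exact: AB.
    - apply: (cont_on_subl (L := rsubmx) (B := [set p : R * 'rV[R]_n | 0 <= p.1 <= T])) => //.
      + by move=> z; rewrite [leRHS]n2_pair lerDr n2_ge0.
      + by move=> z z'; rewrite linearB.
      + by move=> t z; exact: AB.
    apply: (@subspace_eq_continuous _ _ _ (fun p => W eps `|p.1| p.2)).
      by move=> [t z] /set_mem[/= /andP[t0 _] _]; rewrite ger0_norm.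
    apply: continuous_subspaceT; apply: continuous_barrier; exact: ltW.
  pose K := `|C| * (2 * (1 + R0 ^+ 2)) ^+ N.
  have K0 : 0 <= K.
    by rewrite mulr_ge0 // exprn_ge0 // mulr_ge0 // addr_ge0 // sqr_ge0.
  have ub (t : R) x : 0 <= t <= t1 -> `|u t x| <= K * weight R0 x ^+ N.
    move=> /andP[t0 tt1]; have := hu t x; rewrite t0 (le_trans tt1 (ltW t1T)) => /(_ isT).
    move=> /le_trans; apply; rewrite /K -mulrA -exprMn.
    apply: (@le_trans _ _ (`|C| * (1 + n2 x) ^+ N)).
      by rewrite ler_wpM2r ?ler_norm // exprn_ge0 // addr_ge0 // n2_ge0.
    rewrite ler_wpM2l //; apply: lerXn2r; rewrite ?nnegrE ?addr_ge0 ?n2_ge0 //.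
      by rewrite !mulr_ge0 ?addr_ge0 ?sqr_ge0 // ltW // weight_gt0.
    exact: weight_growth.
  have hg (t : R) x y : 0 <= t <= t1 -> g t (row_mx x y) <=
      K * weight R0 x ^+ N - eps * weight R0 x ^+ N.+1 +
      (K * weight R0 y ^+ N - eps * weight R0 y ^+ N.+1).
    move=> tI; have t0 : 0 <= t by case/andP: tI.
    have := Wge t x y t0.
    have := mulr_ge0 (ltW A0) (addr_ge0 (profile_ge0 R0 a abar dl q t x)
      (profile_ge0 R0 a abar dl q t y)).
    have := le_trans (ler_norm _) (ub t x tI).
    have := ub t y tI; rewrite -normrN => /(le_trans (ler_norm _)).
    rewrite /g row_mxKl row_mxKr; clear; lra.
  have g1 : 0 < g t1 (row_mx x1 y1) by rewrite /g row_mxKl row_mxKr subr_gt0.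
  have [t0 [z0 [/andP[t00 t01] g0 hmax]]] :=
    max_coercive (ltW t10) K0 eps0 R00 cg hg g1.
  move: (hsubmxK z0); set x0 := lsubmx z0; set y0 := rsubmx z0 => z0E.
  rewrite -z0E in g0 hmax.
  have Wpos : 0 <= W eps t0 (row_mx x0 y0).
    apply: le_trans (Wge _ _ _ t00).
    apply: addr_ge0; apply: mulr_ge0; rewrite ?(ltW A0) ?(ltW eps0) //.
      by rewrite addr_ge0 ?profile_ge0.
    by rewrite addr_ge0 // exprn_ge0 // ltW // weight_gt0.
  have xy0 : x0 != y0.
    apply/eqP => xy; move: g0 Wpos; rewrite /g row_mxKl row_mxKr xy subrr sub0r oppr_gt0.
    by rewrite ltNge => /negP.
  have t0p : 0 < t0.
    rewrite lt_def t00 andbT; apply/eqP => tz; move: g0.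
    rewrite /g row_mxKl row_mxKr subr_gt0 ltNge => /negP; apply.
    apply: le_trans (Wge _ _ _ t00); rewrite tz; apply: (le_trans (hinit x0 y0)).
    (* At time 0 the undecayed branch is the smaller one, so the barrier starts above the initial
       difference. *)
    have pE (w : 'rV[R]_n) : profile R0 a abar dl q 0 w = weight R0 w `^ a.
      rewrite /profile /decay mulr0 addr0 powR1 mul1r min_l //.
      by rewrite ler_powR ?weight_ge1 // ltW.
    rewrite !pE lerDl mulr_ge0 ?(ltW eps0) // addr_ge0 // exprn_ge0 // ltW //;
      exact: weight_gt0.
  have [c c0' sW] := HB l Sg b hS hL hb hmon A eps t0 x0 y0 A0 (ltW eps0) t0p xy0.
  have {sW}[tau [p [Q [jw hc]]]] : super (row_mx (b t0 x0) (b t0 y0))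
      (fun j => row_mx (Acol lam (Sg x0) j)
        (reflected lam ((enorm (x0 - y0))^-1 *: (x0 - y0)) (Sg y0) j))
      (fun t z => u t (lsubmx z) - u t (rsubmx z)) t0 (row_mx x0 y0) c.
    apply: super_touch t0p _ sW => s ze /andP[s1' s2'] _.
    have := hmax (t0 + s) (row_mx x0 y0 + ze).
    have -> : 0 <= t0 + s <= t1.
      by rewrite -lerBlDl sub0r s1' (le_trans _ t01) // gerDl.
    by move=> /(_ isT); rewrite /g -/(W eps); clear; lra.
  have t0T : 0 < t0 < T by rewrite t0p (le_lt_trans t01).
  have rn : n2 ((enorm (x0 - y0))^-1 *: (x0 - y0)) = 1.
    have : enorm (x0 - y0) != 0.
      apply: contra xy0 => /eqP h; rewrite -subr_eq0; apply/eqP; exact: enorm0_eq0.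
    by move=> h; rewrite n2Z -enorm_sqr exprVn mulVf // expf_neq0.
  have Jn : (0 < #|{: 'I_n + 'I_l}|)%N by rewrite card_sum card_ord ltn_addr.
  have := visc_sums lam0 hL contb su sNu t0T Jn
    (fun v => sum_dotv_Acol (Sg x0) v (ltW lam0))
    (fun v => sum_dotv_reflected (Sg y0) v (ltW lam0) rn) jw.
  by move: hc c0'; clear; lra.
set G := weight R0 x1 `^ N.+1%:R + weight R0 y1 `^ N.+1%:R + 2 * Cm * t1.
have G0 : 0 <= G by rewrite !addr_ge0 ?powR_ge0 // !mulr_ge0 // ltW.
have E0 : 0 < decay dl q t1 := decay_gt0 q (ltW dl0) (ltW t10).
apply/ler_addgt0Pr => e e0.
have ep : 0 < e / (1 + G) by rewrite divr_gt0 // ltr_pwDl.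
apply: (le_trans (main _ ep)); rewrite /W /barrier !row_mxKl !row_mxKr -/G.
apply: lerD; last by rewrite mulrAC ler_pdivrMr ?ltr_pwDl // ler_pM2l // lerDr.
rewrite ler_pM2l // !mulrDr.
apply: lerD; first by apply: lerD; rewrite /profile ge_min lexx orbT.
have := expR_gt0 (- th * enorm (x1 - y1)); set X := expR _ => X0.
have := mulr_ge0 (mulr_ge0 B0 (ltW E0)) (ltW X0); clear; lra.
Qed.

End MaximumPrinciple.

(** * From the weights to the oscillation seminorms *)

Section JapaneseBracket.
Context {R : realType}.
Variable d : nat.
Implicit Type x : 'rV[R]_d.

Lemma japanese_ge1 x : 1 <= japanese x.
Proof. by rewrite /japanese -[leLHS]sqrtr1 ler_wsqrtr // lerDl sqr_ge0. Qed.

Lemma japanese_gt0 x : 0 < japanese x.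
Proof. exact: lt_le_trans (japanese_ge1 x). Qed.

Lemma japanese_powE x k : japanese x `^ k = ((1 + n2 x) ^+ 2) `^ (k / 4).
Proof.
have h0 : 0 <= 1 + n2 x by rewrite addr_ge0 // n2_ge0.
have -> : (1 + n2 x) ^+ 2 = japanese x `^ 4.
  rewrite (powR_mulrn 4) ?(ltW (japanese_gt0 _)) //.
  by rewrite (exprM _ 2 2) /japanese enorm_sqr sqr_sqrtr.
by rewrite -powRrM mulrCA divff ?mulr1.
Qed.

Lemma weight_pow_le_japanese (R0 k : R) x : 0 <= k -> weight R0 x `^ (k / 4) <= japanese x `^ k.
Proof.
move=> k0; rewrite japanese_powE.
have k4 : 0 <= k / 4 by rewrite divr_ge0.
apply: (ge0_ler_powR k4); rewrite ?nnegrE ?sqr_ge0 ?(ltW (weight_gt0 _ _)) //.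
have ex : excess R0 x <= n2 x.
  by rewrite ge_max n2_ge0 lerBlDr lerDl sqr_ge0.
have := @lerXn2r _ 2 _ _ (excess_ge0 R0 x) (n2_ge0 x) ex.
rewrite /weight; have := n2_ge0 x; clear; nra.
Qed.

Lemma japanese_pow_le_weight (R0 k : R) x : 0 <= k ->
  japanese x `^ k <= (2 * (1 + R0 ^+ 2) ^+ 2) `^ (k / 4) * weight R0 x `^ (k / 4).
Proof.
move=> k0; rewrite japanese_powE.
have k4 : 0 <= k / 4 by rewrite divr_ge0.
have D0 : 0 <= 2 * (1 + R0 ^+ 2) ^+ 2 by rewrite mulr_ge0 // sqr_ge0.
rewrite -powRM ?(ltW (weight_gt0 _ _)) //.
apply: (ge0_ler_powR k4); rewrite ?nnegrE ?sqr_ge0 ?(mulr_ge0 D0 (ltW (weight_gt0 _ _))) //.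
have r0 := sqr_ge0 R0; have p0 := excess_ge0 R0 x; have hp := excess_ge R0 x.
have h1 : 1 + n2 x <= (1 + R0 ^+ 2) * (1 + excess R0 x).
  by have := mulr_ge0 r0 p0; move: hp; clear; lra.
have h2 : (1 + excess R0 x) ^+ 2 <= 2 * weight R0 x.
  by rewrite /weight; have := sqr_ge0 (excess R0 x - 1); clear; nra.
apply: (@le_trans _ _ ((1 + R0 ^+ 2) ^+ 2 * (1 + excess R0 x) ^+ 2)).
  rewrite -[leRHS]exprMn; apply: lerXn2r; rewrite ?nnegrE ?mulr_ge0 ?addr_ge0 //.
  exact: n2_ge0.
by rewrite -mulrA [leRHS]mulrCA ler_wpM2l ?sqr_ge0.
Qed.

Lemma osc_ge0 k (u : 'rV[R]_d -> R) : (0 <= osc k u)%E.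
Proof.
apply: ereal_sup_ubound; exists 0, 0.
by rewrite subrr normr0 mul0r.
Qed.

Lemma osc_le k (u : 'rV[R]_d -> R) (O : R) : osc k u = O%:E -> forall x y,
  `|u x - u y| <= O * (japanese x `^ k + japanese y `^ k).
Proof.
move=> uO x y; rewrite -ler_pdivrMr ?addr_gt0 ?powR_gt0 ?japanese_gt0 //.
by rewrite -lee_fin -uO; apply: ereal_sup_ubound; exists x, y.
Qed.

End JapaneseBracket.

(** 1 + dl t is at least min(1, dl) (1 + t). *)
Lemma decay_le (R : realType) (dl q t : R) : 0 < dl -> 0 <= q -> 0 <= t ->
  decay dl q t <= Num.min 1 dl `^ (- q) * (1 + t) `^ (- q).
Proof.
move=> dl0 q0 t0; set m := Num.min 1 dl.
have m0 : 0 < m by rewrite lt_min ltr01.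
have m1 : m <= 1 by rewrite ge_min lexx.
have md : m <= dl by rewrite ge_min lexx orbT.
have t1 : 0 < 1 + t by rewrite ltr_wpDr.
have b0 : 0 < 1 + dl * t by rewrite ltr_wpDr // mulr_ge0 // ltW.
rewrite -powRM ?(ltW m0) ?(ltW t1) // /decay !powRN.
rewrite lef_pV2 ?posrE ?powR_gt0 ?mulr_gt0 //.
apply: (ge0_ler_powR q0); rewrite ?nnegrE ?(ltW b0) ?mulr_ge0 ?(ltW m0) ?(ltW t1) //.
by have := ler_wpM2r t0 md; move: m1; clear; lra.
Qed.

Theorem theorem3p9 (R : realType) (d : nat)
    (lambda0 sigma0 sigma1 gamma alpha R0 c0 k kbar : R)
    (hd : (0 < d)%N) (hlambda0 : 0 < lambda0)
    (hgamma : 0 < gamma < 2) (halpha : 0 < alpha) (hR0 : 0 < R0) (hc0 : 0 < c0)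
    (hk : 2 - gamma < k) (hkbar : k < kbar) :
  exists M : R, 0 < M /\
    forall (l : nat) (Sigma : 'rV[R]_d -> 'M[R]_(d, l))
      (b : R -> 'rV[R]_d -> 'rV[R]_d)
      (T : R) (u0 : 'rV[R]_d -> R) (u : R -> 'rV[R]_d -> R),
    (forall x, enorm (Sigma x) <= sigma0) ->
    (forall x y, enorm (Sigma x - Sigma y) <= sigma1 * enorm (x - y)) ->
    {within [set p : R * 'rV[R]_d | 0 < p.1], continuous (fun p => b p.1 p.2)} ->
    (forall t x, 0 < t -> R0 <= enorm x ->
      alpha * enorm x `^ gamma <= dotv (b t x) x) ->
    (forall t x y, 0 < t ->
      - c0 * enorm (x - y) <= dotv (b t x - b t y) (x - y)) ->
    0 < T ->
    continuous u0 ->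
    viscosity_solution T lambda0 Sigma b u0 u ->
    (exists m C : R, [/\ 0 < m, 0 < C &
      forall t x, 0 <= t <= T -> `|u t x| <= C * (1 + enorm x) `^ m]) ->
    Linfty_weight k u0 ->
    forall t, 0 < t < T ->
      (osc kbar (u t)
        <= (M * (1 + t) `^ (- ((kbar - k) / (2 - gamma))))%:E * osc k u0)%E.
Proof.
have k0 : 0 < k by move: hgamma hk => /andP[_ ?] ?; lra.
have kb0 : 0 < kbar := lt_trans k0 hkbar.
have ha : (2 - gamma) / 4 < k / 4 by rewrite ltr_pM2r // invr_gt0.
have hab : k / 4 < kbar / 4 by rewrite ltr_pM2r // invr_gt0.
have [dl [B [dl0 B0 HB]]] := @oscillation_decay R d lambda0 sigma0 sigma1 gamma alpha R0 c0
  (k / 4) (kbar / 4) hd hlambda0 hgamma halpha (ltW hR0) hc0 ha hab.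
have g2 : 0 < 2 - gamma by case/andP: hgamma; lra.
have qE : (kbar / 4 - k / 4) / ((2 - gamma) / 4) = (kbar - k) / (2 - gamma).
  by field; rewrite gt_eqF.
rewrite qE in HB.
have q0 : 0 < (kbar - k) / (2 - gamma) by rewrite divr_gt0 // subr_gt0.
set q := (kbar - k) / _ in q0 HB *.
pose D := (2 * (1 + R0 ^+ 2) ^+ 2) `^ (k / 4).
have D0 : 0 < D.
  by rewrite powR_gt0 // mulr_gt0 // exprn_gt0 // ltr_pwDl // sqr_ge0.
pose m := Num.min 1 dl `^ (- q).
have m0 : 0 < m by rewrite powR_gt0 // lt_min ltr01.
have B1 : 0 < 1 + B by rewrite ltr_pwDl.
(* [D] converts brackets into weights at time 0, 1 + B absorbs the additive constant because
   brackets are at least 1, and [m] replaces 1 + dl t by 1 + t. *)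
exists (D * (1 + B) * m); split; first by rewrite !mulr_gt0.
move=> l Sigma b T u0 u hS hL contb hb hmon T0 _ hu hgrow _ t /andP[t0 tT].
have [su sNu] := viscosity_subsol hu hgrow; have [_ u00 _ _] := hu.
set Mt := D * (1 + B) * m * (1 + t) `^ (- q).
have Mt0 : 0 < Mt by rewrite !mulr_gt0 // powR_gt0 // addr_gt0.
case E : (osc k u0) => [r| |]; last by have := osc_ge0 k u0; rewrite E.
  have r0 : 0 <= r by rewrite -lee_fin -E osc_ge0.
  have hr := osc_le E.
  (* The amplitude in [oscillation_decay] must be positive while the initial seminorm [r] may
     vanish; hence r + e, with e removed at the end. *)
  have key (e : R) x y : 0 < e ->
      u t x - u t y <= Mt * (r + e) * (japanese x `^ kbar + japanese y `^ kbar).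
    move=> e0; have re : 0 < r + e by rewrite ltr_wpDl.
    have A0 : 0 < D * (r + e) by rewrite mulr_gt0.
    have init x' y' : u 0 x' - u 0 y' <=
        D * (r + e) * (weight R0 x' `^ (k / 4) + weight R0 y' `^ (k / 4)).
      rewrite !u00; apply: (le_trans (le_trans (ler_norm _) (hr x' y'))).
      rewrite mulrAC [leRHS]mulrC.
      apply: ler_pM => //; rewrite ?addr_ge0 ?powR_ge0 ?lerDl ?(ltW e0) //.
      by rewrite mulrDr lerD // japanese_pow_le_weight // ltW.
    have := HB l Sigma b T u _ hS hL contb hb hmon su sNu A0 init t x y.
    rewrite t0 tT => /(_ isT) /le_trans; apply.
    set Jx := japanese x `^ kbar; set Jy := japanese y `^ kbar.
    have Jx1 : 1 <= Jx.
      by rewrite -[leLHS](powRr0 (japanese x)) ler_powR ?japanese_ge1 // ltW.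
    have Jy0 : 0 <= Jy := powR_ge0 _ _.
    have hw : weight R0 x `^ (kbar / 4) + weight R0 y `^ (kbar / 4) + B <=
        (1 + B) * (Jx + Jy).
      have := weight_pow_le_japanese R0 x (ltW kb0).
      have := weight_pow_le_japanese R0 y (ltW kb0).
      rewrite -/Jx -/Jy; have := ler_wpM2l B0 Jx1; have := mulr_ge0 B0 Jy0.
      clear; lra.
    have hd' := decay_le dl0 (ltW q0) (ltW t0).
    apply: (@le_trans _ _ (D * (r + e) * ((m * (1 + t) `^ (- q)) * ((1 + B) * (Jx + Jy))))).
      rewrite ler_pM2l //; apply: ler_pM => //; first exact: powR_ge0.
      by rewrite !addr_ge0 ?powR_ge0.
    by rewrite /Mt le_eqVlt; apply/orP; left; apply/eqP; ring.
  apply: ge_ereal_sup => z [x [y ->]]; rewrite -EFinM lee_fin.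
  have J0 : 0 < japanese x `^ kbar + japanese y `^ kbar.
    by rewrite addr_gt0 // powR_gt0 // japanese_gt0.
  rewrite ler_pdivrMr //; apply/ler_addgt0Pr => e e0.
  set J := _ + _ in J0 *.
  have e1 : 0 < e / (Mt * J) by rewrite divr_gt0 // mulr_gt0.
  have -> : Mt * r * J + e = Mt * (r + e / (Mt * J)) * J.
    by field; rewrite !gt_eqF.
  rewrite ler_norml; apply/andP; split; last exact: key.
  by rewrite lerNl opprB; have := key _ y x e1; rewrite [X in _ <= _ * X]addrC.
by rewrite gt0_muley ?lte_fin // leey.
Qed.
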